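(* Let $\alpha\in(0,2)$, $\beta\in(0,1)$, $p\in\mathbb N$ be such that $\beta_p:=p\beta-p+1<0$, let $F$ be an inter-renewal distribution satisfying the standing assumptions of the context, and let $\{X_k\}_{k\in\mathbb Z}$ be the two-sided stationary extension of the stable-regenerative multiple-stable process $\{X_k\}_{k\in\mathbb N_0}$. Let $\{a_n\}$ be a sequence of positive reals and $\{r_n\}$ a sequence of positive integers with $a_n\to\infty$, $r_n\to\infty$ and $r_n=o(\log a_n)$. Then for every $\eta>0$ and all integers $1\le\ell\le r_n$, $$\mathbb P\left(\max_{\ell\le|k|\le r_n}|X_k|>a_n\eta\;\middle|\;|X_0|>a_n\eta\right)\le\frac{2}{\mathbb P(|X_0|>a_n\eta)}\sum_{k=\ell}^{r_n}\mathbb P\left(|X_0|>a_n\eta,\ |X_k|>a_n\eta\right),$$ and the right-hand side tends to $0$ in the sense that $$\lim_{\ell\to\infty}\limsup_{n\to\infty}\frac{1}{\mathbb P(|X_0|>a_n\eta)}\sum_{k=\ell}^{r_n}\mathbb P\left(|X_0|>a_n\eta,\ |X_k|>a_n\eta\right)=0.$$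
   Context: Notation: $\mathbb N=\{1,2,\dots\}$, $\mathbb N_0=\{0,1,2,\dots\}$. A Rademacher variable takes values $\pm1$ with probability $1/2$ each. Standing assumptions on $F$: $F$ is the cumulative distribution function of an $\mathbb N$-valued random variable with probability mass function $f$, such that $\overline F(x)=1-F(x)\sim \mathsf C_F x^{-\beta}$ as $x\to\infty$ for some constant $\mathsf C_F>0$ and $\beta\in(0,1)$, and $\sup_{n\in\mathbb N} nf(n)/\overline F(n)<\infty$. Renewal processes: a renewal process is the random set $\boldsymbol\tau=\{\tau_0,\tau_1,\dots\}\subset\mathbb N_0$ of its renewal times, where the increments $\tau_i-\tau_{i-1}$, $i\ge1$, are i.i.d. with distribution $F$ (independent of $\tau_0$); it is delayed at $d$ if $\tau_0=d$. The stationary delay measure $\pi$ is the ($\sigma$-finite, infinite) measure on $\mathbb N_0$ with $\pi(\{k\})=\overline F(k)$. The stable-regenerative multiple-stable process: let $\sum_{i\ge1}\delta_{(y_i,d_i)}$ be a Poisson point process on $(0,\infty]\times\mathbb N_0$ with intensity measure $\alpha x^{-\alpha-1}dx\,d\pi$. Given it, let $\boldsymbol\tau^{(i,d_i)}$, $i\in\mathbb N$, be conditionally independent renewal processes with inter-renewal distribution $F$, the $i$-th one delayed at $d_i$. Let $\{\varepsilon_i\}_{i\in\mathbb N}$ be i.i.d. Rademacher variables independent of everything else. Then $\{X_k\}_{k\in\mathbb N_0}$ is the process with the (joint) law of $$X_k=\sum_{0<i_1<\cdots<i_p}\varepsilon_{i_1}\cdots\varepsilon_{i_p}\,y_{i_1}\cdots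 y_{i_p}\,\mathbf 1_{\{k\in\bigcap_{r=1}^p\boldsymbol\tau^{(i_r,d_{i_r})}\}},\quad k\in\mathbb N_0,$$ where for each $k$ the multiple series converges almost surely and unconditionally. This process is stationary, and $\{X_k\}_{k\in\mathbb Z}$ denotes the (unique in law) stationary process indexed by $\mathbb Z$ whose restriction to $\mathbb N_0$ has this law. *)

(* Defs.v *)
From HB Require Import structures.
From mathcomp Require Import all_boot all_order all_algebra finmap.
From mathcomp Require Import all_classical all_reals all_analysis.
From mathcomp Require Import measurable_realfun.

Set Implicit Arguments.
Unset Strict Implicit.
Unset Printing Implicit Defensive.

Import Order.TTheory GRing.Theory Num.Theory.
Import numFieldNormedType.Exports.

Local Open Scope classical_set_scope.
Local Open Scope ring_scope.

Section Probability.
Context d (T : measurableType d) (R : realType) (P : probability T R).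

(* Each [G i] is meant to be a sigma-algebra; as it then contains [setT],
   requiring [G i (E i)] for [i] outside [J] is harmless. *)
Definition mutually_independent (I : choiceType) (G : I -> set (set T)) :=
  forall (J : {fset I}) (E : I -> set T), (forall i, G i (E i)) ->
    P (\bigcap_(i in [set` J]) E i) = (\prod_(i <- J) fine (P (E i)))%:E.

Definition sigma_of d' (U : measurableType d') (f : T -> U) : set (set T) :=
  preimage_set_system setT f measurable.

Definition Pr (A : set T) : R := fine (P A).
(* Equal to 0 when [Pr B = 0]. *)
Definition cond_Pr (A B : set T) : R := Pr (A `&` B) / Pr B.

(* [S] is the almost sure sum of the family [(g i)_(i in D)], D countably
   infinite, whatever (deterministic) order the terms are summed in. *)
Definition ae_unconditional_sum (I : Type) (D : set I) (g : I -> T -> R)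
    (S : T -> R) :=
  forall e : nat -> I, set_bij setT D e ->
    {ae P, forall w, series (fun n => g (e n) w) @ \oo --> S w}.

Definition rademacher (eps : T -> R) :=
  P [set w | eps w = 1] = (2^-1)%:E /\ P [set w | eps w = -1] = (2^-1)%:E.

End Probability.

(* Equality of the laws on R^I: equality on the pi-system of the measurable
   rectangles constraining finitely many coordinates. *)
Definition same_law (R : realType) d1 (T1 : measurableType d1)
    (P1 : probability T1 R) d2 (T2 : measurableType d2)
    (P2 : probability T2 R) (I : choiceType)
    (X1 : I -> T1 -> R) (X2 : I -> T2 -> R) :=
  forall (J : {fset I}) (B : I -> set R), (forall i, measurable (B i)) ->
    P1 (\bigcap_(i in [set` J]) (X1 i @^-1` B i)) =
    P2 (\bigcap_(i in [set` J]) (X2 i @^-1` B i)).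

Definition stationary (R : realType) d (T : measurableType d)
    (P : probability T R) (X : int -> T -> R) :=
  forall h : int, same_law P P (fun k => X (k + h)) X.

Section Renewal.
Context (R : realType) (F : probability nat R).

Definition ir_pmf (n : nat) : R := fine (F [set n]).
Definition ir_cdf (x : R) : R := fine (F [set n | n%:R <= x]).
Definition ir_tail (x : R) : R := 1 - ir_cdf x.

Record inter_renewal (beta : R) : Prop := InterRenewal {
  inter_renewal_gt0 : F [set 0%N] = 0%E ;
  inter_renewal_tail : exists2 C : R, 0 < C &
    ir_tail x / (C * x `^ (- beta)) @[x --> +oo] --> (1 : R) ;
  inter_renewal_sup : has_ubound
    [set n%:R * ir_pmf n / ir_tail n%:R | n in [set n | (0 < n)%N]] }.

Definition stationary_delay (A : set nat) : \bar R :=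
  \esum_(k in A) (ir_tail k%:R)%:E.

Definition renewal_time (delay : nat) (incr : nat -> nat) (j : nat) : nat :=
  (delay + \sum_(m < j) incr m)%N.

Definition renewal_set (delay : nat) (incr : nat -> nat) : set nat :=
  range (renewal_time delay incr).

End Renewal.

Section PoissonPointProcess.
Context d (T : measurableType d) (R : realType) (P : probability T R).
Context d' (U : measurableType d').

Definition point_count (pt : nat -> T -> U) (B : set U) (w : T) : \bar R :=
  (\sum_(0 <= i <oo) (\1_B (pt i w))%:E)%E.

(* The second argument of [poisson_prob] is a dummy. *)
Definition poisson_point_process (nu : set U -> \bar R) (pt : nat -> T -> U) :=
  [/\ forall B, measurable B -> (nu B < +oo)%E -> forall n : nat,
        P [set w | point_count pt B w = n%:R%:E] =
        poisson_prob (fine (nu B)) 0 [set n],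
      forall B, measurable B -> nu B = +oo%E ->
        P [set w | point_count pt B w = +oo%E] = 1%E
    & forall B : nat -> set U, (forall j, measurable (B j)) ->
        trivIset setT B ->
        mutually_independent P (fun j => sigma_of (point_count pt (B j)))].

End PoissonPointProcess.

(* The measure alpha x^(-alpha-1) dx dpi on (0,oo) x N_0. It does not charge
   {oo} x N_0, so that the first coordinates can be taken real. *)
Definition stable_intensity (R : realType) (alpha : R) (F : probability nat R)
    (B : set (R * nat)) : \bar R :=
  (\int[lebesgue_measure]_(x in `]0%R, +oo[)
     ((alpha * x `^ (- alpha - 1))%:E * stationary_delay F (xsection B x)))%E.

Section MultipleStable.
Context d (T : measurableType d) (R : realType) (P : probability T R).

(* The source of randomness number [i] is the point (jump i, delay i), the
   increments [incr i] of the i-th renewal process and the sign [sign i];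
   indices start from 0. *)
Definition source_index : choiceType := (unit + (nat * nat + nat))%type.

Definition source_sigma (jump : nat -> T -> R) (delay : nat -> T -> nat)
    (incr : nat -> nat -> T -> nat) (sign : nat -> T -> R) (j : source_index) :
    set (set T) :=
  match j with
  | inl _ => <<s \bigcup_i sigma_of (fun w => (jump i w, delay i w)) >>
  | inr (inl (i, m)) => sigma_of (incr i m)
  | inr (inr i) => sigma_of (sign i)
  end.

Record stable_regenerative_sources (alpha : R) (F : probability nat R) := Sources {
  jump : nat -> {RV P >-> R} ;
  delay : nat -> {RV P >-> nat} ;
  incr : nat -> nat -> {RV P >-> nat} ;
  sign : nat -> {RV P >-> R} ;
  jump_gt0 : forall i w, 0 < jump i w ;
  points_ppp : poisson_point_process P (stable_intensity alpha F)
    (fun i w => (jump i w, delay i w)) ;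
  incr_law : forall i m A, distribution P (incr i m) A = F A ;
  sign_law : forall i, rademacher P (sign i) ;
  sources_indep :
    mutually_independent P (source_sigma jump delay incr sign) }.

Definition multistable_term (alpha : R) (F : probability nat R)
    (S : stable_regenerative_sources alpha F) (p k : nat) (s : p.-tuple nat)
    (w : T) : R :=
  (\prod_(i <- s) sign S i w) * (\prod_(i <- s) jump S i w) *
  \1_(\bigcap_(i in [set` s])
        renewal_set (delay S i w) (fun m => incr S i m w)) k.

(* [p.-tuple]s sorted by [ltn] are the multi-indices i_1 < ... < i_p. *)
Definition multistable_process (alpha : R) (F : probability nat R)
    (S : stable_regenerative_sources alpha F) (p : nat) (X : nat -> T -> R) :=
  forall k : nat, ae_unconditional_sum P [set s : p.-tuple nat | sorted ltn s]
    (multistable_term S k) (X k).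

End MultipleStable.

Definition two_sided_extension (R : realType)
    d1 (T1 : measurableType d1) (P1 : probability T1 R)
    d2 (T2 : measurableType d2) (P2 : probability T2 R)
    (X : int -> T1 -> R) (X0 : nat -> T2 -> R) :=
  stationary P1 X /\ same_law P1 P2 (fun k : nat => X k%:Z) X0.

(* max_(l <= |k| <= m) |X_k| *)
Definition two_sided_max (T : Type) (R : realType) (X : int -> T -> R)
    (l m : nat) (w : T) : R :=
  \big[Num.max/0]_(l <= k < m.+1) Num.max `|X k%:Z w| `|X (- k%:Z) w|.

(* Main.v *)
Require Import Defs.
From HB Require Import structures.
From mathcomp Require Import all_boot all_order all_algebra finmap.
From mathcomp Require Import all_classical all_reals all_analysis.
From mathcomp Require Import measurable_realfun.
From mathcomp Require Import ring lra.

Set Implicit Arguments.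
Unset Strict Implicit.
Unset Printing Implicit Defensive.

Import Order.TTheory GRing.Theory Num.Theory.
Import numFieldNormedType.Exports.

(** Let [u k] be the probability that an undelayed renewal process visits [k],
    let [x] be the level and [L = 1 + ln x]. The limit follows from two tail
    estimates, valid for large [x] with constants not depending on [k]:
    - P(|X_0| > x) >= c x^(-alpha) L^(p-1)  ([exceedance_lower]);
    - P(|X_0| > x, |X_k| > x) <= C x^(-alpha) (u(k)^p L^(p-1) + L^(p-2))
      ([limit_upper]).
    Their quotient is at most C' (u(k)^p + 1/L). The renewal equation and the
    bound on n f(n) give u(n) = O(n^(beta-1)) ([renewal_seq_smooth]), so that
    u(k)^p is summable when p (1 - beta) > 1, and r_n / L tends to zero because
    r_n = o(ln a_n). The bound on the conditional maximum is a union bound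
    together with stationarity ([cond_max_le]).

    For the upper estimate, condition on all points and renewal processes. A
    partial sum of the series is then a homogeneous Rademacher chaos, and
    Chebyshev's inequality over the signs bounds the conditional probability
    of a joint exceedance by the minimum of 1 and of two sums of squared
    products of jumps, over the configurations of p points visiting 0 and over
    those visiting k. [pattern_bound] turns this minimum into a sum over
    patterns: at most 2p distinct points, each used at time 0, at time k or at
    both times. Factorial moments of the Poisson process bound the expected
    number of occurrences of a pattern in given dyadic cells; as the delay
    measure is stationary, a point used at one time contributes a factor 1, and
    a point used at both times a factor u(k) ([pattern_prob_le]). Summing over
    the cells, a pattern with m shared points contributes
    x^(-alpha) u(k)^m L^(m-1), without logarithm if m = 0 ([pattern_sum_le]). All p points are shared in the
    first term of the estimate, and at most p - 1 of them in the second one.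

    For the lower estimate, averaging over the signs of p given points isolates
    their product, so that one large product of p undelayed jumps makes the
    chaos large with conditional probability at least 2^(-p)
    ([chaos_tail_ge]). Large products abound: choose p - 1 dyadic levels among
    the first n/p ones, and complete them by the level that makes the sum of all
    the levels equal to n. These choices give disjoint events, of probability of
    order 2^(-alpha n) each, and there are about n^(p-1) of them
    ([large_product_prob]).

    Both estimates pass from the partial sums to the series by Fatou's lemma,
    along an enumeration of the increasing p-tuples ([eventual_prob_le]). *)

Local Open Scope classical_set_scope.
Local Open Scope ring_scope.

Lemma eq_lew (disp : Order.disp_t) (T : porderType disp) (x y : T) : x = y -> (x <= y)%O.
Proof. by move=> ->. Qed.

(** * Renewal sequences *)

Section RenewalSequence.
Context (R : realType) (f : nat -> R).

(** The recursion of [u] calls all the earlier values, hence the structural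
    bound [m] on the depth of the calls. *)
Fixpoint renewal_seq_fuel (m n : nat) : R :=
  match n, m with
  | 0%N, _ => 1
  | _, 0%N => 0
  | n'.+1, m'.+1 => \sum_(v < n'.+1) f v.+1 * renewal_seq_fuel m' (n' - v)
  end.

Definition renewal_seq (n : nat) : R := renewal_seq_fuel n n.

Lemma renewal_seq_fuelE m n : (n <= m)%N -> renewal_seq_fuel m n = renewal_seq n.
Proof.
rewrite /renewal_seq; have [k] := ubnP n; elim: k n m => // k IH [|n] [|m] //= nk nm.
apply: eq_bigr => v _; congr (_ * _).
have h : (n - v <= n)%N by rewrite leq_subr.
rewrite IH ?(leq_trans _ nm) ?(leq_ltn_trans h) //; last exact: leq_trans h _.
by rewrite [RHS]IH // (leq_ltn_trans h).
Qed.

Lemma renewal_seq0 : renewal_seq 0 = 1. Proof. by []. Qed.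

Lemma renewal_seqS n :
  renewal_seq n.+1 = \sum_(v < n.+1) f v.+1 * renewal_seq (n - v).
Proof.
rewrite {1}/renewal_seq /=; apply: eq_bigr => v _.
by rewrite renewal_seq_fuelE // leq_subr.
Qed.

Let tail n : R := 1 - \sum_(v < n.+1) f v.
Let U n : R := \sum_(i < n.+1) renewal_seq i.

Hypothesis f_ge0 : forall n, 0 <= f n.
Hypothesis f0 : f 0%N = 0.

Lemma renewal_seq_ge0 n : 0 <= renewal_seq n.
Proof.
have [k] := ubnP n; elim: k n => // k IH [|n] nk; first by rewrite renewal_seq0.
rewrite renewal_seqS sumr_ge0// => v _; rewrite mulr_ge0// IH//.
by rewrite (leq_ltn_trans (leq_subr _ _)).
Qed.

Let tailS n : tail n.+1 = tail n - f n.+1.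
Proof. by rewrite /tail [in LHS]big_ord_recr/= opprD addrA. Qed.

Let tail0 : tail 0 = 1.
Proof. by rewrite /tail big_ord1 f0 subr0. Qed.

(** Decomposition according to the last renewal [n - d] up to [n], after which the
    process waits longer than [d]. *)
Lemma renewal_tail_conv n :
  \sum_(d < n.+1) tail d * renewal_seq (n - d) = 1.
Proof.
elim: n => [|n IH]; first by rewrite big_ord1 tail0 mul1r.
rewrite big_ord_recl tail0 mul1r subn0.
under eq_bigr do rewrite /= /bump/= add1n subSS tailS mulrBl.
by rewrite sumrB IH renewal_seqS addrCA subrr addr0.
Qed.

Hypothesis tail_ge0 : forall n, 0 <= tail n.

Lemma renewal_seq_le1 n : renewal_seq n <= 1.
Proof.
rewrite -(renewal_tail_conv n) big_ord_recl tail0 mul1r subn0 lerDl.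
by rewrite sumr_ge0// => d _; rewrite mulr_ge0// renewal_seq_ge0.
Qed.

Let tail_le m n : (m <= n)%N -> tail n <= tail m.
Proof.
move=> /subnK <-; elim: (n - m)%N => // k IH.
by rewrite addSn tailS (le_trans _ IH)// gerBl.
Qed.

(** In the decomposition above [d <= n], and the tail is nonincreasing. *)
Lemma renewal_sum_tail n : tail n * U n <= 1.
Proof.
rewrite -[X in _ <= X](renewal_tail_conv n) mulr_sumr.
rewrite [leRHS](reindex_inj rev_ord_inj)/=.
apply: ler_sum => i _; rewrite subSS subKn -1?ltnS//.
by rewrite ler_wpM2r ?renewal_seq_ge0// tail_le// leq_subr.
Qed.

Let US n : U n.+1 = 1 + \sum_(v < n.+1) f v.+1 * U (n - v).
Proof.
elim: n => [|n IH].
  by rewrite big_ord1 /U big_ord_recl !big_ord1 /= renewal_seqS big_ord1 subnn.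
have UE m : U m.+1 = U m + renewal_seq m.+1 by rewrite /U big_ord_recr.
rewrite UE IH -[LHS]addrA; congr (_ + _).
rewrite [in RHS]big_ord_recr/= renewal_seqS subnn.
rewrite [X in _ + X = _]big_ord_recr/= subnn renewal_seq0.
have -> : U 0 = 1 by rewrite /U big_ord1.
rewrite addrA.
congr (_ + _); rewrite -big_split/=; apply: eq_bigr => v _.
rewrite -mulrDr; congr (_ * _).
by rewrite subSn -1?ltnS// UE.
Qed.

(** With [D] multiplication by the index, [u = 1 + f u] gives
    [D u = (D f) u + f (D u)]; the bound on [n f(n)] replaces [D f] by [tail],
    and [tail u] is constantly [1], so that [D u] is dominated by the solution
    [U] of [U = 1 + f U]. *)
Lemma renewal_seq_smooth (B : R) : (forall n, n%:R * f n <= B * tail n) ->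
  forall n, n%:R * renewal_seq n <= B * U n.
Proof.
move=> fB; have B0 : 0 <= B by have := fB 0%N; rewrite mul0r tail0 mulr1.
move=> n; have [k] := ubnP n; elim: k n => // k IH [|n] nk.
  by rewrite mul0r mulr_ge0// /U sumr_ge0// => i _; exact: renewal_seq_ge0.
have -> : n.+1%:R * renewal_seq n.+1 =
    \sum_(v < n.+1) (v.+1%:R * f v.+1) * renewal_seq (n - v) +
    \sum_(v < n.+1) f v.+1 * ((n - v)%:R * renewal_seq (n - v)).
  rewrite renewal_seqS mulr_sumr -big_split/=; apply: eq_bigr => v _.
  have -> : n.+1%:R = v.+1%:R + (n - v)%:R :> R.
    by rewrite -natrD addSn subnKC// -ltnS.
  by ring.
apply: (@le_trans _ _ (B * \sum_(v < n.+1) tail v.+1 * renewal_seq (n - v) +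
    B * \sum_(v < n.+1) f v.+1 * U (n - v))).
  apply: lerD; rewrite mulr_sumr; apply: ler_sum => v _.
    by rewrite mulrA ler_wpM2r ?renewal_seq_ge0.
  rewrite [leRHS]mulrCA ler_wpM2l// IH// (leq_ltn_trans (leq_subr _ _))//.
rewrite -mulrDr ler_wpM2l// US lerD2r.
have := renewal_tail_conv n.+1; rewrite big_ord_recl tail0 mul1r subn0.
under eq_bigr do rewrite /= /bump/= add1n subSS.
by move=> <-; rewrite lerDr renewal_seq_ge0.
Qed.

End RenewalSequence.

(** Divided by [n ^ (- t)], this is [1 + t / n <= ((n - 1) / n) ^ (- t)], a
    consequence of [1 + y <= exp y]. *)
Lemma powR_telescope (R : realType) (t : R) (n : nat) : 0 < t -> (1 < n)%N ->
  n%:R `^ (- (1 + t)) <= t^-1 * (n.-1%:R `^ (- t) - n%:R `^ (- t)).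
Proof.
case: n => [|[|n]]// t0 _ /=.
set a : R := n.+1%:R; set b : R := n.+2%:R.
have a0 : 0 < a by rewrite ltr0n.
have b0 : 0 < b by rewrite ltr0n.
have ab : a = b * (1 + - b^-1).
  by rewrite mulrDr mulr1 mulrN mulfV ?gt_eqF// /b -addn1 natrD addrK.
have c0 : 0 < 1 + - b^-1 by rewrite -(pmulr_rgt0 _ b0) -ab.
rewrite opprD powRD; last by rewrite (gt_eqF b0) implybT.
rewrite powR_inv1 ?(ltW b0)// ab powRM ?(ltW b0) ?(ltW c0)//.
rewrite -[X in _ - X]mulr1 -mulrBr mulrCA [leLHS]mulrC.
rewrite ler_wpM2l ?powR_ge0// mulrC ler_pdivlMr// lerBrDl.
rewrite /powR gt_eqF//; apply: (@le_trans _ _ (expR (t * b^-1))).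
  by rewrite [b^-1 * t]mulrC expR_ge1Dx.
rewrite ler_expR mulNr -mulrN ler_pM2l// lerNr le_ln1Dx//.
by rewrite ltrNr opprK invf_lt1// /b ltr1n.
Qed.

Lemma sum_powR_tail (R : realType) (t : R) (l r : nat) : 0 < t -> (1 < l)%N ->
  \sum_(l <= k < r) k%:R `^ (- (1 + t)) <= t^-1 * l.-1%:R `^ (- t).
Proof.
move=> t0 l1; have [rl|lr] := leqP r l.
  by rewrite big_geq// mulr_ge0 ?invr_ge0 ?powR_ge0// ltW.
apply: (@le_trans _ _ (\sum_(l <= k < r) t^-1 * (k.-1%:R `^ (- t) - k%:R `^ (- t)))).
  apply: ler_sum_nat => k /andP[lk _].
  by apply: powR_telescope => //; exact: leq_trans lk.
rewrite -mulr_sumr ler_wpM2l ?invr_ge0 ?(ltW t0)//.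
case: l l1 lr => // l l1 lr; case: r lr => // r lr.
rewrite big_add1 (@telescope_sumr_eq _ _ _ (fun k => - (k%:R `^ (- t)))).
- by have := powR_ge0 (r%:R : R) (- t); rewrite /=; lra.
- exact: ltnW.
- by move=> k _ /=; lra.
Qed.

Section InterRenewal.
Context (R : realType) (F : probability nat R) (beta : R).

Lemma ir_pmf_ge0 n : 0 <= ir_pmf F n.
Proof. exact: fine_ge0. Qed.

Lemma ir_cdfE n : ir_cdf F n%:R = \sum_(v < n.+1) ir_pmf F v.
Proof.
rewrite /ir_cdf /ir_pmf.
have -> : [set m | m%:R <= n%:R :> R] = \big[setU/set0]_(v < n.+1) [set (v : nat)].
  rewrite -(bigcup_mkord n.+1 (fun v => [set v])); apply/seteqP; split => [m /=|m [k /= kn ->]].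
    by rewrite ler_nat => mn; exists m.
  by rewrite ler_nat -ltnS.
rewrite measure_semi_additive_ord//=.
- by rewrite sum_fine// => v _; exact: fin_num_measure.
- by apply/trivIsetP => i j _ _ ij; apply/seteqP; split => x //= [-> /eqP];
    rewrite -val_eqE/= in ij; rewrite (negbTE ij).
Qed.

Lemma ir_tailE n : ir_tail F n%:R = 1 - \sum_(v < n.+1) ir_pmf F v.
Proof. by rewrite /ir_tail ir_cdfE. Qed.

Lemma ir_tail_ge0 x : 0 <= ir_tail F x.
Proof.
rewrite subr_ge0 -lee_fin fineK ?fin_num_measure//; exact: probability_le1.
Qed.

Lemma ir_tail_nat_le m n : (m <= n)%N -> ir_tail F n%:R <= ir_tail F m%:R.
Proof.
move=> mn; rewrite lerD2l lerN2 fine_le ?fin_num_measure// le_measure ?inE//.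
by move=> k /= km; rewrite (le_trans km)// ler_nat.
Qed.

Hypothesis hF : inter_renewal F beta.
Hypothesis beta01 : 0 < beta < 1.

Lemma ir_pmf0 : ir_pmf F 0 = 0.
Proof. by rewrite /ir_pmf (inter_renewal_gt0 hF). Qed.

(** Regular variation gives the bound for large [n]; below that threshold the tail is at
    least its value at the threshold. *)
Lemma ir_tail_lower : exists2 c : R, 0 < c &
  forall n, (0 < n)%N -> c * n%:R `^ (- beta) <= ir_tail F n%:R.
Proof.
have /andP[beta0 beta1] := beta01; have half0 : 0 < 2^-1 :> R by lra.
have [C C0 /cvgrPdist_lt/(_ _ half0) [x0 [_ hx0]]] := inter_renewal_tail hF.
have key n : x0 < n%:R -> (0 < n)%N -> C / 2 * n%:R `^ (- beta) <= ir_tail F n%:R.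
  move=> xn n0; have := hx0 _ xn; rewrite distrC ltr_distl => /andP[+ _].
  have p0 : 0 < C * n%:R `^ (- beta) by rewrite mulr_gt0// powR_gt0// ltr0n.
  rewrite ltr_pdivlMr// => /ltW; apply: le_trans.
  by rewrite mulrAC -mulrA mulrCA mulrA; lra.
pose N := (Num.truncn `|x0|).+1.
have xN : x0 < N%:R by apply: le_lt_trans (ler_norm _) _; exact: truncnS_gt.
exists (Num.min (C / 2) (C / 2 * N%:R `^ (- beta))).
  by rewrite lt_min divr_gt0//= mulr_gt0 ?divr_gt0// powR_gt0// ltr0n.
move=> n n0; have [nN|Nn] := leqP n N.
  apply: le_trans (ir_tail_nat_le nN); apply: le_trans (key N xN isT).
  apply: le_trans (_ : _ <= Num.min (C / 2) (C / 2 * N%:R `^ (- beta)) * 1) _.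
    rewrite ler_wpM2l ?le_min ?mulr_ge0 ?divr_ge0 ?powR_ge0 ?(ltW C0)//.
    by rewrite powRN invf_le1 ?powR_gt0 ?ltr0n// -[leLHS](powRr0 n%:R) ler_powR ?ler1n//; lra.
  by rewrite mulr1 ge_min lexx orbT.
apply: le_trans (key n _ n0); last by rewrite (lt_trans xN)// ltr_nat.
by rewrite ler_wpM2r ?powR_ge0// ge_min lexx.
Qed.

Local Notation u := (renewal_seq (ir_pmf F)).

(** Monotonicity of the tail turns [tail u = 1] into
    [u 0 + ... + u n <= 1 / tail n], and smoothness then gives
    [u n = O(1 / (n tail n))], of order [n ^ (beta - 1)]. The excess of
    [p (1 - beta)] over [1] is the exponent [t]. *)
Lemma renewal_summable (p : nat) : p%:R * beta - p%:R + 1 < 0 ->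
  exists C t : R, [/\ 0 <= C, 0 < t & forall l r : nat, (1 < l)%N ->
    \sum_(l <= k < r) u k ^+ p <= C * l.-1%:R `^ (- t)].
Proof.
move=> hp; have /andP[beta0 beta1] := beta01; have [c c0 hc] := ir_tail_lower.
have [B hB] := inter_renewal_sup hF.
pose B' := Num.max B 0.
have tail_gt0 n : 0 < ir_tail F n%:R.
  case: n => [|n]; last by apply: lt_le_trans (hc n.+1 isT); rewrite mulr_gt0// powR_gt0.
  by apply: lt_le_trans (ir_tail_nat_le (leq0n 1)); apply: lt_le_trans (hc 1 isT);
    rewrite mulr_gt0// powR_gt0.
have fB n : n%:R * ir_pmf F n <= B' * ir_tail F n%:R.
  case: n => [|n]; first by rewrite mul0r mulr_ge0// ?ir_tail_ge0 // le_max lexx orbT.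
  rewrite -ler_pdivrMr//; apply: le_trans (_ : B <= _); last by rewrite le_max lexx.
  by apply: hB; exists n.+1.
have B'0 : 0 <= B' by rewrite le_max lexx orbT.
have f_ge0 := ir_pmf_ge0; have f0 := ir_pmf0.
have tail_ge0 n : 0 <= 1 - \sum_(v < n.+1) ir_pmf F v.
  by rewrite -ir_tailE ir_tail_ge0.
have tail_ge0' n : n%:R * ir_pmf F n <= B' * (1 - \sum_(v < n.+1) ir_pmf F v).
  by rewrite -ir_tailE.
have u_le n : (0 < n)%N -> u n <= B' / c * n%:R `^ (beta - 1).
  move=> n0; have n0' : 0 < n%:R :> R by rewrite ltr0n.
  have h1 := renewal_seq_smooth f_ge0 f0 tail_ge0' n.
  have h2 := renewal_sum_tail f_ge0 f0 n.
  rewrite -ir_tailE in h2.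
  have h3 : \sum_(i < n.+1) u i <= (c * n%:R `^ (- beta))^-1.
    rewrite -[leRHS]mul1r ler_pdivlMr; last by rewrite mulr_gt0// powR_gt0.
    apply: le_trans h2; rewrite mulrC ler_wpM2r ?hc//.
    by apply: sumr_ge0 => i _; exact: renewal_seq_ge0.
  rewrite -(ler_pM2l n0'); apply: (le_trans h1).
  apply: le_trans (ler_wpM2l B'0 h3) _.
  by rewrite invfM -powRN opprK [leRHS]mulrCA mulr_powRB1 ?(ltW n0')// mulrA.
pose t : R := p%:R - p%:R * beta - 1.
have t0 : 0 < t by rewrite /t; lra.
exists ((B' / c) ^+ p / t), t; split=> //.
  by rewrite divr_ge0 ?(ltW t0)// exprn_ge0// divr_ge0// ltW.
move=> l r l1.
have h : \sum_(l <= k < r) u k ^+ p <=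
   (B' / c) ^+ p * \sum_(l <= k < r) k%:R `^ (- (1 + t)).
  rewrite mulr_sumr; apply: ler_sum_nat => k /andP[lk _].
  have k0 : (0 < k)%N by rewrite (leq_trans _ lk)// ltnW.
  have -> : (B' / c) ^+ p * k%:R `^ (- (1 + t)) = (B' / c * k%:R `^ (beta - 1)) ^+ p.
    rewrite [RHS]exprMn; congr (_ * _).
    rewrite -[RHS]powR_mulrn ?powR_ge0// -powRrM; congr (_ `^ _).
    rewrite /t; ring.
  rewrite lerXn2r ?nnegrE ?u_le//.
    exact: renewal_seq_ge0.
  by rewrite mulr_ge0 ?powR_ge0 ?divr_ge0 ?(ltW c0).
apply: (le_trans h); rewrite -mulrA ler_wpM2l ?exprn_ge0 ?divr_ge0 ?(ltW c0)//.
exact: sum_powR_tail.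
Qed.

End InterRenewal.

(** * Independence of the sources of randomness *)

Section MutualIndependence.
Context d (T : measurableType d) (R : realType) (P : probability T R).
Context (I : choiceType) (G : I -> set (set T)).
Hypothesis indepG : mutually_independent P G.

Lemma mutually_independent_seq (s : seq I) (E : I -> set T) : uniq s ->
  (forall i, G i (E i)) ->
  P (\bigcap_(i in [set` s]) E i) = (\prod_(i <- s) fine (P (E i)))%:E.
Proof.
move=> us GE; have := indepG (seq_fset tt s) GE.
have -> : [set` seq_fset tt s] = [set` s].
  by apply/seteqP; split => i; rewrite /mkset seq_fsetE.
move=> ->; congr (_%:E); apply: perm_big.
by rewrite (perm_trans (seq_fset_perm _ _))// undup_id.
Qed.

Hypothesis GT : forall i, G i setT.
Hypothesis GI : forall i, setI_closed (G i).
Hypothesis Gm : forall i, G i `<=` measurable.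

(** Both sides are finite measures in [A] that agree on the finite
    intersections of events of the other indices, a pi-system. *)
Lemma mutually_independent_block (s : seq I) (E : I -> set T) (A : set T) :
  uniq s -> (forall i, G i (E i)) ->
  <<s \bigcup_(j in [set j | j \notin s]) G j >> A ->
  P (A `&` \bigcap_(i in [set` s]) E i) = (P A * P (\bigcap_(i in [set` s]) E i))%E.
Proof.
move=> us GE; set B := \bigcap_(i in [set` s]) E i.
have mcap (r : seq I) E' : (forall i, G i (E' i)) ->
    measurable (\bigcap_(i in [set` r]) E' i).
  by move=> GE'; apply: fin_bigcap_measurable => // i _; exact: Gm (GE' i).
have mB : measurable B by exact: mcap.
pose H := [set A | exists r E', [/\ uniq r, {subset r <= predC (mem s)},
  forall i, G i (E' i) & A = \bigcap_(i in [set` r]) E' i]].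
have sGH : <<s \bigcup_(j in [set j | j \notin s]) G j >> `<=` <<s H >>.
  apply: smallest_sub; first exact: smallest_sigma_algebra.
  apply: subset_trans (@sub_gen_smallest _ _ _) => C [j /= js GC].
  exists [:: j], (fun i => if i == j then C else setT); split => //.
  - by move=> i; rewrite inE => /eqP->.
  - by move=> i; case: eqVneq => [->|_].
  - rewrite (_ : [set` [:: j]] = [set j]) ?bigcap_set1 ?eqxx//.
    by apply/seteqP; split => i /=; rewrite inE => /eqP.
pose c := NngNum (fine_ge0 (measure_ge0 P B)).
have PB : (c%:num)%:E = P B by rewrite /c/= fineK// fin_num_measure.
have mscE X : mscale c P X = (P B * P X)%E by rewrite -PB.
move=> /sGH HA.
have := @g_sigma_algebra_measure_unique _ R T H _ (fun=> setT) _ _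
  (mrestr P mB) (mscale c P) _ _ _ A HA.
rewrite /mrestr => h; rewrite [RHS]muleC -mscE; apply: h.
- by move=> _ [r [E' [_ _ GE' ->]]]; exact: mcap.
- move=> _; exists [::], (fun=> setT); split => //.
  by apply/seteqP; split.
- by apply/seteqP; split => // w _; exists 0%N.
- move=> _ _ [r1 [E1 [u1 s1 G1 ->]]] [r2 [E2 [u2 s2 G2 ->]]].
  exists (undup (r1 ++ r2)),
    (fun i => (if i \in r1 then E1 i else setT) `&` (if i \in r2 then E2 i else setT)).
  split.
  + exact: undup_uniq.
  + by move=> i; rewrite mem_undup mem_cat => /orP[/s1|/s2].
  + by move=> i; apply: GI; case: ifP.
  + apply/seteqP; split => [w [h1 h2] i /= _|w h].
      by split; case: ifP => // ?; [apply: h1|apply: h2].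
    split => i /= ir.
      have /h[] : i \in undup (r1 ++ r2) by rewrite mem_undup mem_cat ir.
      by rewrite ir.
    have /h[_] : i \in undup (r1 ++ r2) by rewrite mem_undup mem_cat ir orbT.
    by rewrite ir.
- move=> _ [r [E' [ur rs GE' ->]]].
  rewrite [RHS]mscE.
  pose E'' i := if i \in s then E i else E' i.
  have GE'' i : G i (E'' i) by rewrite /E''; case: ifP.
  have -> : \bigcap_(i in [set` r]) E' i = \bigcap_(i in [set` r]) E'' i.
    by apply: eq_bigcapr => i /= /rs; rewrite /E'' inE/= => /negbTE ->.
  have BE : B = \bigcap_(i in [set` s]) E'' i.
    by apply: eq_bigcapr => i /= si; rewrite /E'' si.
  change (P (\bigcap_(i in [set` r]) E'' i `&` B) =
    (P B * P (\bigcap_(i in [set` r]) E'' i))%E).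
  rewrite BE -bigcap_setU.
  have -> : [set` r] `|` [set` s] = [set` r ++ s].
    by apply/seteqP; split => i /=; rewrite mem_cat => /orP.
  rewrite !mutually_independent_seq//; first by rewrite big_cat/= EFinM muleC.
  rewrite cat_uniq ur us andbT; apply/hasPn => i /= si.
  by apply/negP => /rs; rewrite inE/= si.
- move=> _; change (P (setT `&` B) < +oo)%E; rewrite setTI.
  by rewrite (le_lt_trans (probability_le1 _ _)) ?ltry.
Qed.

End MutualIndependence.

Section LevelFree.
Context d (T : measurableType d) (R : realType) (P : probability T R).
Context (I : choiceType) (lev : I -> nat -> set T) (pm : I -> nat -> R).

(** Independence from the statistics with level sets [lev t v], in the form that
    can be carried along while their values are prescribed one at a time. *)
Definition level_free (A : set T) (Fr : set I) :=
  measurable A /\ forall (s : seq I) (v : I -> nat), uniq s -> [set` s] `<=` Fr ->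
    P (A `&` \big[setI/setT]_(t <- s) lev t (v t)) =
    (P A * (\prod_(t <- s) pm t (v t))%:E)%E.

Lemma level_free_cons A Fr t v : measurable (lev t v) -> level_free A Fr -> Fr t ->
  level_free (A `&` lev t v) (Fr `\ t) /\ P (A `&` lev t v) = (P A * (pm t v)%:E)%E.
Proof.
move=> mtv [mA hA] Ft.
have h1 : P (A `&` lev t v) = (P A * (pm t v)%:E)%E.
  have := hA [:: t] (fun=> v) isT; rewrite !big_seq1; apply.
  by move=> x /=; rewrite inE => /eqP->.
split => //; split; first exact: measurableI.
move=> s v' us sFr; rewrite h1 -muleA -EFinM.
have ts : t \notin s by apply/negP => /sFr [_]; apply.
pose v1 x := if x == t then v else v' x.
have v1E x : x \in s -> v1 x = v' x.
  by rewrite /v1; case: eqVneq => // ->; rewrite (negbTE ts).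
have := hA (t :: s) v1; rewrite /= ts us !big_cons {1 3}/v1 eqxx setIA => /(_ isT).
rewrite (eq_big_seq (fun x => lev x (v' x))); last by move=> x /v1E ->.
rewrite (eq_big_seq (fun x => pm x (v' x))); last by move=> x /v1E ->.
by apply=> x /=; rewrite inE => /orP[/eqP->//|/sFr[]].
Qed.

End LevelFree.

Section SourceEvents.
Context (R : realType) (alpha : R) (F : probability nat R).
Context d (T : measurableType d) (P : probability T R).
Variable S : stable_regenerative_sources P alpha F.

Definition source_events : source_index -> set (set T) :=
  source_sigma (jump S) (delay S) (incr S) (sign S).

Lemma source_events_indep : mutually_independent P source_events.
Proof. exact: sources_indep. Qed.

Lemma sigma_of_preimage d' (U : measurableType d') (f : T -> U) (B : set U) :
  measurable B -> sigma_of f (f @^-1` B).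
Proof. by move=> mB; exists B => //; rewrite setTI. Qed.

Lemma sigma_of_setI d' (U : measurableType d') (f : T -> U) :
  setI_closed (sigma_of f).
Proof.
move=> _ _ [A mA <-] [B mB <-]; exists (A `&` B); first exact: measurableI.
by rewrite !setTI preimage_setI.
Qed.

Lemma sigma_of_measurable d' (U : measurableType d') (f : T -> U) :
  measurable_fun setT f -> sigma_of f `<=` measurable.
Proof. by move=> mf _ [A mA <-]; exact: mf. Qed.

Lemma source_eventsT j : source_events j setT.
Proof.
case: j => [u|[[i m]|i]] /=.
- by apply: sub_sigma_algebra; exists 0%N => //; exists setT => //; rewrite setTI.
- by exists setT => //; rewrite setTI.
- by exists setT => //; rewrite setTI.
Qed.

Lemma point_events_setI : setI_closed (source_events (inl tt)).
Proof.
move=> A B mA mB.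
exact: (@measurableI _ (g_sigma_algebraType
  (\bigcup_i sigma_of (fun w => (jump S i w, delay S i w)))) A B mA mB).
Qed.

Lemma source_events_setI j : setI_closed (source_events j).
Proof.
case: j => [[]|[[i m]|i]].
- exact: point_events_setI.
- exact: sigma_of_setI.
- exact: sigma_of_setI.
Qed.

Lemma source_events_measurable j : source_events j `<=` measurable.
Proof.
case: j => [u|[[i m]|i]] /=.
- apply: smallest_sub; first exact: sigma_algebra_measurable.
  move=> A [i _]; apply: sigma_of_measurable.
  exact/measurable_fun_pair.
- exact: sigma_of_measurable.
- exact: sigma_of_measurable.
Qed.

Lemma point_event i (B : set (R * nat)) : measurable B ->
  source_events (inl tt) [set w | B (jump S i w, delay S i w)].
Proof.
by move=> mB; apply: sub_sigma_algebra; exists i => //; exact: sigma_of_preimage.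
Qed.

Lemma incr_pmf i m v : P [set w | incr S i m w = v] = (ir_pmf F v)%:E.
Proof.
have := incr_law S i m [set v]; rewrite /ir_pmf fineK ?fin_num_measure//.
Qed.

Lemma measurable_incr i m v : measurable [set w | incr S i m w = v].
Proof. exact: (@measurable_funPTI _ _ _ _ (incr S i m) [set v]). Qed.

Definition incr_free : set T -> set (nat * nat) -> Prop :=
  level_free P (fun t v => [set w | incr S t.1 t.2 w = v]) (fun=> ir_pmf F).

Lemma point_event_incr_free A : source_events (inl tt) A -> incr_free A setT.
Proof.
move=> hA; split; first exact: source_events_measurable hA.
move=> s v us _.
pose E (j : source_index) : set T := match j with
  | inl _ => A
  | inr (inl t) => [set w | incr S t.1 t.2 w = v t]
  | inr (inr _) => setT end.
have GE j : source_events j (E j).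
  case: j => [[]|[[i m]|i]] //=; last exact: (source_eventsT (inr (inr i))).
  exact: (@sigma_of_preimage _ _ (incr S i m) [set v (i, m)]).
pose s' : seq source_index := inl tt :: [seq inr (inl t) | t <- s].
have us' : uniq s'.
  rewrite /= map_inj_uniq ?us ?andbT; first by apply/mapP => -[].
  by move=> x y [].
have := mutually_independent_seq source_events_indep us' GE.
rewrite bigcap_seq big_cons/= big_map big_cons/= big_map => ->.
rewrite EFinM fineK ?fin_num_measure//; last exact: source_events_measurable hA.
congr (_ * _%:E)%E; apply: eq_bigr => t _ /=.
by rewrite incr_pmf.
Qed.

Lemma incr_free_cons A Fr t v : incr_free A Fr -> Fr t ->
  incr_free (A `&` [set w | incr S t.1 t.2 w = v]) (Fr `\ t) /\
  P (A `&` [set w | incr S t.1 t.2 w = v]) = (P A * (ir_pmf F v)%:E)%E.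
Proof.
by move=> hA Ft; apply: level_free_cons => //; exact: measurable_incr.
Qed.

End SourceEvents.

(** * Visits of a renewal process *)

Section Hits.
Context (R : realType) (alpha : R) (F : probability nat R).
Context d (T : measurableType d) (P : probability T R).
Variable S : stable_regenerative_sources P alpha F.
Hypothesis F0 : F [set 0%N] = 0%E.

Local Notation f := (ir_pmf F).
Local Notation u := (renewal_seq (ir_pmf F)).

(** Restarting after [m] increments leaves a process driven by the increments
    from [m] on, which is what the renewal recursion conditions on. *)
Definition hits (i m n : nat) : set T :=
  [set w | exists j, \sum_(l < j) incr S i (m + l) w = n]%N.

Lemma measurable_hits i m n : measurable (hits i m n).
Proof.
have -> : hits i m n = \bigcup_j [set w | \sum_(l < j) incr S i (m + l) w = n]%N.
  by apply/seteqP; split=> w [j] => [|_] h; exists j.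
apply: bigcup_measurable => j _.
suff /(_ measurableT [set n] I) : measurable_fun setT
  (fun w => \sum_(l < j) incr S i (m + l) w)%N by rewrite setTI.
elim: j => [|j IH].
  by under eq_fun do rewrite big_ord0; exact: measurable_cst.
under eq_fun do rewrite big_ord_recr/=.
exact: measurable_fun_addn.
Qed.

Lemma hits0 i m : hits i m 0 = setT.
Proof. by apply/seteqP; split=> // w _; exists 0%N; rewrite big_ord0. Qed.

Lemma hitsS_sub i m n : hits i m n.+1 `<=`
  \big[setU/set0]_(v < n.+2) ([set w | incr S i m w = v] `&` hits i m.+1 (n.+1 - v)).
Proof.
move=> w [[|j]]; first by rewrite big_ord0.
rewrite big_ord_recl addn0 => h.
have vn : (incr S i m w < n.+2)%N by rewrite ltnS -h leq_addr.
rewrite -(bigcup_mkord _ (fun v => [set w | incr S i m w = v] `&` hits i m.+1 (n.+1 - v))).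
exists (incr S i m w) => //; split=> //; exists j.
by rewrite -h addKn; apply: eq_bigr => l _; rewrite /= /bump addnA addn1 .
Qed.

(** Condition on the first increment of the first process and use the renewal recursion; the
    processes have pairwise distinct indices, so that the increments used are
    never used again. The induction is on the number of processes plus the
    total distance left to travel. *)
Lemma hits_prob_le (l : seq (nat * nat * nat)) (A : set T) (Fr : set (nat * nat)) :
  uniq [seq x.1.1 | x <- l] -> incr_free S A Fr ->
  (forall x, x \in l -> forall m, (x.1.2 <= m)%N -> Fr (x.1.1, m)) ->
  (P (A `&` \big[setI/setT]_(x <- l) hits x.1.1 x.1.2 x.2) <=
   P A * (\prod_(x <- l) u x.2)%:E)%E.
Proof.
have u0 n : 0 <= u n by apply: renewal_seq_ge0; exact: ir_pmf_ge0.
have [K] := ubnP (\sum_(x <- l) x.2 + size l).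
elim: K l A Fr => // K IH [|[[i m] n] l] A Fr lK /= ul hA hl.
  by rewrite !big_nil setIT mule1.
move: ul => /andP[il ul].
have mA : measurable A by case: hA.
have mhits (s : seq (nat * nat * nat)) :
    measurable (\big[setI/setT]_(x <- s) hits x.1.1 x.1.2 x.2).
  by apply: bigsetI_measurable => x _; exact: measurable_hits.
rewrite !big_cons/=; case: n lK hl => [|n] lK hl.
  rewrite hits0 setTI renewal_seq0 mul1r; apply: (IH _ _ Fr) => //.
    by move: lK; rewrite big_cons/= add0n addnS.
  by move=> x xl; apply: hl; rewrite inE xl orbT.
set H := \big[setI/setT]_(x <- l) _.
pose Y v := (A `&` [set w | incr S i m w = v]) `&` (hits i m.+1 (n.+1 - v) `&` H).
have mY v : measurable (Y v).
  apply: measurableI; apply: measurableI => //.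
  - exact: measurable_incr.
  - exact: measurable_hits.
  - exact: mhits.
have Yle : (P (A `&` (hits i m n.+1 `&` H)) <= \sum_(v < n.+2) P (Y v))%E.
  apply: content_subadditive => //.
    apply: measurableI => //; apply: measurableI; first exact: measurable_hits.
    exact: mhits.
  move=> w [Aw [/hitsS_sub]].
  rewrite -(bigcup_mkord _ (fun v => [set w | incr S i m w = v] `&` hits i m.+1 (n.+1 - v))).
  by move=> [v /= vn [h1 h2]] Hw; rewrite -(bigcup_mkord _ Y); exists v.
apply: (le_trans Yle).
have tFr : Fr (i, m) by apply: (hl (i, m, n.+1)); rewrite // inE eqxx.
have Yv v : (v < n.+1)%N -> (P (Y v.+1) <= P A * (f v.+1 * (u (n - v) * \prod_(x <- l) u x.2))%:E)%E.
  move=> vn; have [hA' PA'] := incr_free_cons v.+1 hA tFr.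
  have := IH ((i, m.+1, (n - v)%N) :: l) _ _ _ _ hA'.
  rewrite /= !big_cons/= /Y subSS PA' -muleA -EFinM; apply.
  - move: lK; rewrite big_cons/= !addnS ltnS; apply: leq_ltn_trans.
    by rewrite ltnS leq_add2r leq_add2r leq_subr.
  - by rewrite il.
  - move=> x; rewrite inE => /orP[/eqP-> /= m' mm'|xl m' xm'].
      split; first by apply: (hl (i, m, n.+1)); rewrite ?inE ?eqxx//= ltnW.
      by move=> [mm]; move: mm'; rewrite mm ltnn.
    split; first by apply: hl => //; rewrite inE xl orbT.
    by move=> [xi _]; move/negP: il; apply; apply/mapP; exists x.
have Y0 : P (Y 0%N) = 0%E.
  apply/eqP; rewrite -measure_le0.
  have <- : P [set w | incr S i m w = 0%N] = 0%E by rewrite incr_pmf /ir_pmf F0.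
  apply: le_measure; rewrite ?inE//; first exact: measurable_incr.
  by move=> w [[]].
rewrite big_ord_recl Y0 add0e.
apply: (@le_trans _ _ (\sum_(v < n.+1) (P A *
    (f v.+1 * (u (n - v) * \prod_(x <- l) u x.2))%:E))%E).
  by apply: lee_sum => v _; exact: Yv.
rewrite renewal_seqS mulr_suml.
rewrite -ge0_sume_distrr; last first.
  by move=> v _; rewrite lee_fin !mulr_ge0// ?ir_pmf_ge0// prodr_ge0.
rewrite sumEFin (eq_bigr (fun v : 'I_n.+1 => f v.+1 * u (n - v) * \prod_(x <- l) u x.2))//.
by move=> v _; rewrite mulrA.
Qed.

End Hits.

(** * Distinct points of a Poisson process in prescribed cells *)

Local Close Scope classical_set_scope.

Section InjectionsWithPrescribedClasses.
Context (C I : finType).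

Definition class_injections n (X : C -> {set I}) (c : {ffun 'I_n -> C}) :=
  [set f : {ffun 'I_n -> I} | injectiveb f && [forall r, f r \in X (c r)]].

(** Choosing the values of an injection one index at a time: the index added
    last may take any value of its class not yet used. *)
Lemma card_class_injections n (X : C -> {set I}) (c : {ffun 'I_n -> C}) :
  (#|class_injections X c| <= \prod_(j : C) #|X j| ^_ #|[set r | c r == j]|)%N.
Proof.
elim: n c => [|n IH] c.
  rewrite big1 => [|j _].
    apply: leq_trans (max_card _) _.
    by rewrite card_ffun card_ord expn0.
  rewrite (_ : #|[set r | c r == j]| = 0%N) ?ffactn0//.
  by apply: eq_card0 => -[].
pose rest (T : finType) (f : {ffun 'I_n.+1 -> T}) := [ffun r => f (lift ord0 r)].
pose c0 := c ord0; pose c' := rest _ c; pose k := #|[set r | c' r == c0]|.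
have step : (#|class_injections X c| <=
    \sum_(g in class_injections X c') (#|X c0| - k))%N.
  rewrite -[leqLHS]sum1_card.
  rewrite (partition_big (rest I) (fun g => g \in class_injections X c'))/=; last first.
    move=> f; rewrite !inE => /andP[/injectiveP fi /forallP fX].
    apply/andP; split; last by apply/forallP => r; rewrite !ffunE.
    by apply/injectiveP => r1 r2; rewrite !ffunE => /fi/lift_inj.
  apply: leq_sum => g; rewrite inE => /andP[/injectiveP gi /forallP gX].
  rewrite sum1_card; pose V := [set g r | r in [set r | c' r == c0]].
  have VX : V \subset X c0.
    by apply/fintype.subsetP => x /imsetP[r]; rewrite inE => /eqP <- ->.
  have <- : #|V| = k by rewrite card_imset.
  rewrite -(finset.setIidPr VX) -cardsD.
  rewrite -(@card_in_imset _ _ (fun f : {ffun 'I_n.+1 -> I} => f ord0)).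
    apply: subset_leq_card; apply/fintype.subsetP => x /imsetP[f /= ].
    rewrite unfold_in inE => /andP[/andP[/injectiveP fi /forallP fX] /eqP fg] ->.
    rewrite !inE.
    rewrite fX andbT; apply/imsetP => -[r _]; rewrite -fg ffunE => /fi.
    by move/eqP; rewrite (negbTE (neq_lift _ _)).
  move=> f1 f2; rewrite !unfold_in => /andP[_ /eqP f1g] /andP[_ /eqP f2g] f0.
  apply/ffunP => r; case: (unliftP ord0 r) => [r' ->|->//].
  by move/ffunP/(_ r'): f1g; rewrite -f2g !ffunE.
apply: (leq_trans step); rewrite sum_nat_const.
apply: leq_trans (leq_mul (IH c') (leqnn _)) _.
rewrite (bigD1 c0)//= [leqRHS](bigD1 c0)//= mulnAC leq_mul//.
  rewrite -/k -ffactnSr leq_eqVlt; apply/orP; left; apply/eqP; congr (_ ^_ _).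
  rewrite [RHS](cardsD1 ord0) inE eqxx add1n; congr _.+1.
  rewrite -[LHS](card_imset _ (@lift_inj _ ord0)); apply: eq_card => r.
  rewrite !inE; apply/imsetP/andP => [[r']|[r0 /eqP rc]].
    by rewrite inE ffunE => h ->; rewrite eq_sym neq_lift.
  case: (unliftP ord0 r) r0 rc => [r' ->|->] // _ rc.
  by exists r' => //; rewrite inE ffunE rc.
apply: eq_leq; apply: eq_bigr => j jc0.
congr (_ ^_ _); rewrite -[LHS](card_imset _ (@lift_inj _ ord0)); apply: eq_card => r.
rewrite !inE; apply/imsetP/eqP => [[r']|rc].
  by rewrite inE ffunE => /eqP <- ->.
case: (unliftP ord0 r) rc => [r' -> <-|-> rc]; first by exists r'; rewrite ?inE ?ffunE.
by rewrite -rc eqxx in jc0.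
Qed.

End InjectionsWithPrescribedClasses.

Local Open Scope classical_set_scope.

Section PoissonFactorialMoments.
Context (R : realType) (lambda : R).
Hypothesis lambda0 : 0 <= lambda.

Local Notation pois m := (fine (poisson_prob lambda 0 [set m])).

Lemma poisson_prob1E m : poisson_prob lambda 0 [set m] =
  (lambda ^+ m * m`!%:R^-1 * expR (- lambda))%:E.
Proof.
rewrite /poisson_prob; case: ifPn => l0.
  rewrite esum_set1 /poisson_pmf ?l0// lee_fin mulr_ge0 ?expR_ge0//.
  by rewrite divr_ge0// exprn_ge0.
have {l0} -> : lambda = 0 by apply/eqP; rewrite eq_le lambda0 leNgt l0.
rewrite diracE oppr0 expR0 mulr1; case: m => [|m].
  by rewrite mem_set// expr0 fact0 invr1 mulr1.
by rewrite memNset// expr0n mul0r.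
Qed.

(** The product [m (m-1) .. (m-k+1)] cancels against the first factors of [m!], so
    that passing from [k] to [k.+1] shifts the series by one. *)
Lemma poisson_factorial_moment k :
  (\sum_(0 <= m <oo) ((m ^_ k)%:R * pois m)%:E = (lambda ^+ k)%:E)%E.
Proof.
have pois0 m : 0 <= pois m by exact: fine_ge0.
have poisE m : pois m = lambda ^+ m * m`!%:R^-1 * expR (- lambda).
  by rewrite poisson_prob1E.
elim: k => [|k IH].
  rewrite expr0 -(probability_setT (poisson_prob lambda 0)).
  have -> : [set: nat] = \bigcup_m [set m] by apply/seteqP; split=> m // _; exists m.
  rewrite measure_bigcup//=; last by apply/trivIsetP => i j _ _ ij;
    apply/seteqP; split=> // m [/= -> ijE]; rewrite ijE eqxx in ij.
  rewrite [RHS](@eq_eseriesl _ _ xpredT)//; last by move=> m; rewrite in_setT.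
  by apply: eq_eseriesr => m _; rewrite ffactn0 mul1r fineK// fin_num_measure.
rewrite nneseries_recl//; last by move=> m _; rewrite lee_fin mulr_ge0.
rewrite ffact0n mul0r add0e -(nneseries_addn 1)/=; last first.
  by move=> m; rewrite lee_fin mulr_ge0.
rewrite exprS EFinM -IH -nneseriesZl; last by move=> m _; rewrite lee_fin mulr_ge0.
apply: eq_eseriesr => m _; rewrite addn1 -EFinM; congr (_%:E).
rewrite ffactSS natrM !poisE factS natrM exprS.
have m1 : m.+1%:R != 0 :> R by rewrite pnatr_eq0.
rewrite invfM; have m2 : m`!%:R != 0 :> R by rewrite pnatr_eq0 -lt0n fact_gt0.
move: (m.+1%:R) (m`!%:R) m1 m2 => M D m1 m2.
by field; rewrite m1 m2.
Qed.

End PoissonFactorialMoments.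

Section CellCounts.
Context (R : realType) d (T : measurableType d) (P : probability T R).
Context d' (U : measurableType d') (nu : set U -> \bar R) (pt : nat -> T -> U).
Hypothesis pt_ppp : poisson_point_process P nu pt.
Hypothesis mpt : forall i, measurable_fun setT (pt i).
Context (C : finType) (B : C -> set U).
Hypothesis mB : forall c, measurable (B c).
Hypothesis nuB : forall c, (0 <= nu (B c) < +oo)%E.
Hypothesis trivB : forall c c' x, B c x -> B c' x -> c = c'.

Local Notation lambda c := (fine (nu (B c))).
Local Notation cpmf := (fun (c : C) m => fine (poisson_prob (lambda c) 0 [set m])).

Definition cell_level (c : C) (m : nat) : set T :=
  [set w | point_count R pt (B c) w = m%:R%:E].

Let cell_seq (j : nat) : set U :=
  if insub j is Some o then B (enum_val (o : 'I_#|C|)) else set0.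

Let mcell_seq j : measurable (cell_seq j).
Proof. by rewrite /cell_seq; case: insub => //. Qed.

Let triv_cell_seq : trivIset setT cell_seq.
Proof.
move=> i j _ _ [x []]; rewrite /cell_seq.
case: insubP => // oi _ <-; case: insubP => // oj _ <- Bi Bj.
by rewrite (enum_val_inj (trivB Bi Bj)).
Qed.

Lemma measurable_point_count c : measurable_fun setT (point_count R pt (B c)).
Proof.
rewrite /point_count; apply: (@ge0_emeasurable_sum _ _ _ setT _ xpredT) => //.
move=> i _; apply/measurable_EFinP; apply: measurableT_comp (mpt i).
exact: measurable_indic.
Qed.

Lemma measurable_cell_level c m : measurable (cell_level c m).
Proof.
have := measurable_point_count c measurableT (emeasurable_set1 m%:R%:E).
by rewrite setTI.
Qed.

Lemma cell_level_prob c m : P (cell_level c m) = (cpmf c m)%:E.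
Proof.
case: pt_ppp => h _ _; have /andP[nu0 nuoo] := nuB c.
by rewrite fineK ?fin_num_measure//; exact: h.
Qed.

Lemma cell_level_indep : level_free P cell_level cpmf setT setT.
Proof.
split => // s v us _; rewrite setTI probability_setT mul1e.
case: pt_ppp => _ _ /(_ cell_seq mcell_seq triv_cell_seq) indep.
pose E j : set T := if insub j is Some o then
  cell_level (enum_val (o : 'I_#|C|)) (v (enum_val o)) else setT.
have EE c : E (enum_rank c) = cell_level c (v c).
  by rewrite /E valK enum_rankK.
have GE j : sigma_of (point_count R pt (cell_seq j)) (E j).
  rewrite /E /cell_seq; case: insubP => [ o _ _ | _].
    exists [set (v (enum_val o))%:R%:E]; first exact: emeasurable_set1.
    by rewrite setTI.
  by exists setT => //; rewrite setTI preimage_setT.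
have us' : uniq [seq val (enum_rank c) | c <- s].
  by rewrite map_inj_uniq// => x y /val_inj/enum_rank_inj.
have := mutually_independent_seq indep us' GE.
rewrite bigcap_seq !big_map.
under eq_bigr do rewrite EE.
move=> ->; congr (_%:E).
by apply: eq_bigr => c _; rewrite EE cell_level_prob.
Qed.

Lemma cell_level_ae c : P (~` \bigcup_m cell_level c m) = 0%E.
Proof.
have mc m : measurable (cell_level c m) by exact: measurable_cell_level.
rewrite probability_setC; last exact: bigcupT_measurable.
rewrite measure_bigcup//=; last first.
  apply/trivIsetP => i j _ _ ij; apply/seteqP; split=> // w [].
  by rewrite /cell_level/= => -> [] /eqP; rewrite eqr_nat (negbTE ij).
rewrite (@eq_eseriesl _ _ xpredT)//; last by move=> m; rewrite in_setT.
have := @poisson_factorial_moment R (lambda c) _ 0; rewrite expr0.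
under eq_eseriesr do rewrite ffactn0 mul1r -cell_level_prob.
move=> ->; first by rewrite subee.
by rewrite fine_ge0//; have /andP[] := nuB c.
Qed.

Variable N : nat.

Definition cell_indices (w : T) (c : C) : {set 'I_N} :=
  finset (fun i : 'I_N => `[< B c (pt i w) >]).

Lemma cell_indices_le c m w : cell_level c m w -> (#|cell_indices w c| <= m)%N.
Proof.
rewrite /cell_level/= /point_count => h.
rewrite -(ler_nat R) -lee_fin -h.
apply: le_trans (@nneseries_lim_ge _ _ xpredT 0%N N _) => //.
rewrite big_mkord sumEFin lee_fin -sum1_card natr_sum big_mkcond/=.
apply: eq_lew; apply: eq_bigr => i _.
rewrite inE indicE; case: ifPn => /asboolP h1; first by rewrite mem_set.
by rewrite memNset.
Qed.

Lemma measurable_cell_indices c : measurable_fun setT (fun w => #|cell_indices w c|).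
Proof.
have -> : (fun w => #|cell_indices w c|) =
    (fun w => \sum_(i < N) (if `[< B c (pt i w) >] then 1 else 0))%N.
  by apply/funext => w; rewrite -sum1_card big_mkcond/=; apply: eq_bigr => i _; rewrite inE.
elim: N => [|n IH].
  by under eq_fun do rewrite big_ord0; exact: measurable_cst.
under eq_fun do rewrite big_ord_recr/=.
apply: measurable_fun_addn => //.
apply: measurable_fun_if => //.
apply: (@measurable_fun_bool _ _ _ _ true); rewrite setTI.
have -> : (fun w => `[< B c (pt n w) >]) @^-1` [set true] = pt n @^-1` B c.
  by apply/seteqP; split=> w /= => [/asboolP|] h //; apply/asboolP.
by rewrite -[X in measurable X]setTI; exact: mpt.
Qed.

Lemma measurable_cell_ffact (l : seq C) (k : C -> nat) : measurable_fun setT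
  (fun w => ((\prod_(c <- l) #|cell_indices w c| ^_ (k c))%:R : R)%:E).
Proof.
apply/measurable_EFinP; elim: l => [|c l IH].
  by under eq_fun do rewrite big_nil; exact: measurable_cst.
under eq_fun do rewrite big_cons natrM.
apply: measurable_funM => //.
rewrite -[X in measurable_fun _ X]/((fun n => (n ^_ k c)%:R : R) \o (fun w => #|cell_indices w c|)).
by apply: measurableT_comp => //; exact: measurable_cell_indices.
Qed.

(** Integrate over the number of points in one cell after the other: each
    contributes a factorial moment of a Poisson law. *)
Lemma integral_cell_ffact (l : seq C) (k : C -> nat) (A : set T) (Fr : set C) :
  uniq l -> level_free P cell_level cpmf A Fr -> [set` l] `<=` Fr ->
  (\int[P]_(w in A) ((\prod_(c <- l) #|cell_indices w c| ^_ (k c))%:R : R)%:E <=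
   P A * (\prod_(c <- l) lambda c ^+ k c)%:E)%E.
Proof.
elim: l A Fr => [|c l IH] A Fr /=.
  move=> _ [mA _] _; under eq_integral do rewrite big_nil.
  by rewrite integral_cst// big_nil mul1e mule1.
move=> /andP[cl ul] hA lFr; have mA := hA.1.
have PAfin : P A \is a fin_num by rewrite fin_num_measure.
have cFr : Fr c by apply: lFr; rewrite /= inE eqxx.
set f := (fun w => _%:E).
have mf : measurable_fun setT f by exact: measurable_cell_ffact.
have f0 w : (0 <= f w)%E by rewrite lee_fin.
pose Am m := A `&` cell_level c m.
have mAm m : measurable (Am m) by apply: measurableI => //; exact: measurable_cell_level.
have AE : A `\` ~` (\bigcup_m cell_level c m) = \bigcup_m Am m.
  by rewrite setDE setCK setI_bigcupr.
rewrite (@ge0_negligible_integral _ _ _ _ A (~` (\bigcup_m cell_level c m)))//; last 3 first.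
- by apply: measurableC; apply: bigcupT_measurable => m; exact: measurable_cell_level.
- exact: measurable_funTS.
- exact: cell_level_ae.
rewrite AE ge0_integral_bigcup//; last 2 first.
- exact: measurable_funTS.
- apply/trivIsetP => i j _ _ ij; apply/seteqP; split=> // w [[_ wi] [_]].
  by move: wi; rewrite /cell_level/= => -> [] /eqP; rewrite eqr_nat (negbTE ij).
pose L := \prod_(c <- l) lambda c ^+ k c.
have lam0 c' : 0 <= lambda c' by rewrite fine_ge0//; have /andP[] := nuB c'.
have L0 : 0 <= L by rewrite prodr_ge0// => c' _; rewrite exprn_ge0.
apply: (@le_trans _ _ (\sum_(0 <= m <oo) (L%:E * P A) * ((m ^_ k c)%:R * cpmf c m)%:E)%E).
  apply: lee_nneseries => [m _ _ | m _]; first exact: integral_ge0.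
  have [hAm PAm] := level_free_cons (measurable_cell_level c m) hA cFr.
  apply: (@le_trans _ _ (\int[P]_(w in Am m) ((m ^_ k c)%:R%:E *
     ((\prod_(c <- l) #|cell_indices w c| ^_ (k c))%:R : R)%:E))%E).
    apply: ge0_le_integral => //.
    - exact: measurable_funTS.
    - apply: measurable_funTS; apply: measurable_funeM; exact: measurable_cell_ffact.
    - move=> w [_ /cell_indices_le h]; rewrite /f big_cons -EFinM -natrM lee_fin ler_nat.
      by rewrite leq_mul// !ffact_prod leq_prod// => i _; exact: leq_sub2r.
  rewrite ge0_integralZl//; last by apply: measurable_funTS; exact: measurable_cell_ffact.
  apply: le_trans (lee_wpmul2l _ (IH _ _ ul hAm _)) _ => //.
    move=> x xl; split; first by apply: lFr; rewrite /= inE xl orbT.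
    by move=> xc; move: cl; rewrite -xc xl.
  rewrite PAm -/L -(fineK PAfin) -!EFinM lee_fin; apply: eq_lew; ring.
rewrite -(fineK PAfin) -EFinM nneseriesZl; last first.
  by move=> m _; rewrite lee_fin mulr_ge0// fine_ge0.
rewrite poisson_factorial_moment// big_cons -!EFinM lee_fin -/L.
by apply: eq_lew; ring.
Qed.

(** Factorial moment measures of a Poisson process are dominated by powers of
    its intensity: the expected number of ways of choosing distinct points,
    one in each prescribed cell. *)
Lemma sum_distinct_points_le n (c : {ffun 'I_n -> C}) :
  (\sum_(f : {ffun 'I_n -> 'I_N} | injectiveb f)
     P (\bigcap_(r in [set: 'I_n]) [set w | B (c r) (pt (f r) w)]) <=
   (\prod_r lambda (c r))%:E)%E.
Proof.
pose E (f : {ffun 'I_n -> 'I_N}) := \bigcap_(r in [set: 'I_n]) [set w | B (c r) (pt (f r) w)].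
have mE f : measurable (E f).
  apply: fin_bigcap_measurable => // r _; rewrite -[X in measurable X]setTI.
  exact: mpt (mB _).
rewrite (eq_bigr (fun f => \int[P]_(w in setT) (\1_(E f) w)%:E)%E); last first.
  by move=> f _; rewrite integral_indic// setIT.
rewrite -big_filter -ge0_integral_sum//; last first.
  by move=> f; apply/measurable_EFinP; exact: measurable_indic.
pose k (j : C) := #|finset (fun r => c r == j)|.
apply: (@le_trans _ _ (\int[P]_(w in setT)
   ((\prod_(j <- enum C) #|cell_indices w j| ^_ (k j))%:R : R)%:E)%E).
  apply: ge0_le_integral => //.
  - by move=> w _; rewrite sume_ge0.
  - apply: emeasurable_sum => f; apply/measurable_EFinP; exact: measurable_indic.
  - exact: measurable_cell_ffact.
  - move=> w _; rewrite sumEFin lee_fin big_filter.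
    rewrite big_enum/=; apply: le_trans (_ : #|class_injections (cell_indices w) c|%:R <= _).
      rewrite -sum1_card natr_sum [leRHS]big_mkcond/= big_mkcond/=.
      apply: ler_sum => f _; case: (boolP (injectiveb f)) => fi; last by case: ifP.
      rewrite inE fi/= indicE.
      case: (boolP (w \in E f)) => [|_]; last by case: ifP.
      rewrite inE => wE; rewrite ifT//; apply/forallP => r; rewrite inE.
      by apply/asboolP; exact: wE.
    by rewrite ler_nat; exact: card_class_injections.
have := @integral_cell_ffact (enum C) k setT setT (enum_uniq C) cell_level_indep.
rewrite probability_setT mul1e => /(_ (fun _ _ => I)) /le_trans; apply.
rewrite lee_fin big_enum/=; apply: eq_lew.
rewrite [RHS](partition_big c xpredT)//=; apply: eq_bigr => j _.
rewrite (eq_bigr (fun=> lambda j)); last by move=> r /eqP ->.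
by rewrite prodr_const; congr (_ ^+ _); apply: eq_card => r; rewrite !inE.
Qed.

End CellCounts.

(** * Dyadic cells of the stable intensity *)

Section DyadicCells.
Context (R : realType).

(** Dyadic intervals [(lo, 2 lo]]: [2^j] is the lower end for [(false, j)]
    (values larger than one), [2^-(j+1)] for [(true, j)]. *)
Definition dyadic_lo (b : bool) (j : nat) : R := if b then 2^-1 ^+ j.+1 else 2 ^+ j.
Definition dyadic_hi (b : bool) (j : nat) : R := 2 * dyadic_lo b j.

Definition dyadic_cell (b : bool) (j k : nat) : set (R * nat) :=
  [set z | dyadic_lo b j < z.1 <= dyadic_hi b j /\ z.2 = k].

(** The weight [lo ^ (- alpha)] as a power of an exponential base. *)
Definition dyadic_weight (alpha : R) (b : bool) (j : nat) : R :=
  if b then (2 `^ alpha) ^+ j.+1 else (2 `^ alpha)^-1 ^+ j.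

Lemma dyadic_lo_gt0 b j : 0 < dyadic_lo b j.
Proof. by case: b; rewrite exprn_gt0// invr_gt0. Qed.

Lemma dyadic_weightE alpha b j : dyadic_weight alpha b j = dyadic_lo b j `^ (- alpha).
Proof.
rewrite /dyadic_weight /dyadic_lo; case: b.
  rewrite exprVn -!powR_mulrn ?powR_ge0// -powRN -!powRrM mulrC; congr (_ `^ _).
  by ring.
rewrite exprVn -!powR_mulrn ?powR_ge0// -powRN -!powRrM; congr (_ `^ _).
by ring.
Qed.

Lemma dyadic_weight_ge0 alpha b j : 0 <= dyadic_weight alpha b j.
Proof. by rewrite dyadic_weightE powR_ge0. Qed.

Lemma dyadic_cellE b j k :
  dyadic_cell b j k = `]dyadic_lo b j, dyadic_hi b j]%classic `*` [set k].
Proof. by apply/seteqP; split=> -[x y] /=; rewrite in_itv. Qed.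

Lemma measurable_dyadic_cell b j k : measurable (dyadic_cell b j k).
Proof.
by rewrite dyadic_cellE; exact: measurableX.
Qed.

Lemma dyadic_disjoint b j k b' j' k' z :
  dyadic_cell b j k z -> dyadic_cell b' j' k' z -> (b, j, k) = (b', j', k').
Proof.
move=> [/andP[h1 h2] <-] [/andP[h3 h4] <-].
have lt1 : dyadic_lo b j < dyadic_hi b' j' by exact: lt_le_trans h4.
have lt2 : dyadic_lo b' j' < dyadic_hi b j by exact: lt_le_trans h2.
have half i : 2 * 2^-1 ^+ i.+1 = 2^-1 ^+ i :> R.
  by rewrite exprS mulrA mulfV ?mul1r.
have big (i i' : nat) : 2 ^+ i < 2 * 2 ^+ i' :> R -> (i <= i')%N.
  by rewrite -exprS ltr_eXn2l ?ltr1n.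
have small (i i' : nat) : 2^-1 ^+ i.+1 < 2 * 2^-1 ^+ i'.+1 :> R -> (i' <= i)%N.
  by rewrite half ltr_iXn2l ?invr_gt0// ?invf_lt1 ?ltr1n.
have mix (i i' : nat) : ~ (2 ^+ i < 2 * 2^-1 ^+ i'.+1 :> R).
  rewrite half => h; have : 1 <= 2 ^+ i :> R by rewrite exprn_ege1// ler1n.
  by rewrite leNgt (lt_le_trans h)// exprn_ile1// invf_le1// ler1n.
move: lt1 lt2; rewrite /dyadic_hi /dyadic_lo.
case: b {h1 h2}; case: b' {h3 h4} => lt1 lt2.
- by have -> : j = j' by apply/eqP; rewrite eqn_leq (small _ _ lt1) (small _ _ lt2).
- by have := mix _ _ lt2.
- by have := mix _ _ lt1.
- by have -> : j = j' by apply/eqP; rewrite eqn_leq (big _ _ lt1) (big _ _ lt2).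
Qed.

Context (alpha : R) (F : probability nat R).
Hypothesis alpha0 : 0 < alpha.

Lemma stationary_delay1 k : stationary_delay F [set k] = (ir_tail F k%:R)%:E.
Proof. by rewrite /stationary_delay esum_set1// lee_fin ir_tail_ge0. Qed.

Lemma stable_intensity_dyadic b j k :
  stable_intensity alpha F (dyadic_cell b j k) =
  (\int[lebesgue_measure]_(x in `]dyadic_lo b j, dyadic_hi b j])
     (alpha * x `^ (- alpha - 1) * ir_tail F k%:R)%:E)%E.
Proof.
rewrite /stable_intensity.
rewrite (_ : `]dyadic_lo b j, dyadic_hi b j]%classic =
    `]0%R, +oo[%classic `&` `]dyadic_lo b j, dyadic_hi b j]%classic); last first.
  apply/seteqP; split=> [x|x []]//=; rewrite !in_itv/= andbT => /andP[lx xh].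
  by split; [exact: lt_trans (dyadic_lo_gt0 b j) lx|rewrite lx].
rewrite integral_mkcondr; apply: eq_integral => x _.
rewrite patchE dyadic_cellE; case: ifPn => h.
  by rewrite in_xsectionX// stationary_delay1 -EFinM.
by rewrite notin_xsectionX// /stationary_delay esum_set0 mule0.
Qed.

Lemma dyadic_powR b j x : dyadic_lo b j < x <= dyadic_hi b j ->
  (2 `^ (- alpha - 1) * dyadic_weight alpha b j) <=
    dyadic_lo b j * x `^ (- alpha - 1) <= dyadic_weight alpha b j.
Proof.
move=> /andP[lx xh]; have l0 := dyadic_lo_gt0 b j.
have x0 : 0 < x by exact: lt_trans lx.
have ->: dyadic_weight alpha b j = dyadic_lo b j * dyadic_lo b j `^ (- alpha - 1).
  rewrite dyadic_weightE powRD ?(gt_eqF l0) ?implybT// powR_inv1 ?(ltW l0)//.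
  by rewrite mulrCA mulfV ?mulr1// gt_eqF.
rewrite mulrCA !ler_pM2l//.
have e : - alpha - 1 = - (alpha + 1) by ring.
have a1 : 0 <= alpha + 1 by rewrite addr_ge0 ?(ltW alpha0).
apply/andP; split.
  rewrite -powRM ?(ltW l0)// -/(dyadic_hi b j) e !powRN lef_pV2 ?posrE ?powR_gt0//.
    by rewrite ge0_ler_powR ?nnegrE ?(ltW x0)// (le_trans (ltW x0)).
  by rewrite (lt_le_trans x0).
by rewrite e !powRN lef_pV2 ?posrE ?powR_gt0// ge0_ler_powR ?nnegrE ?(ltW x0) ?(ltW l0)// ltW.
Qed.

(** The density varies by a factor [2 ^ (alpha + 1)] on a dyadic interval. *)
Lemma stable_intensity_dyadic_bounds b j k :
  ((alpha * 2 `^ (- alpha - 1) * dyadic_weight alpha b j * ir_tail F k%:R)%:E <=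
   stable_intensity alpha F (dyadic_cell b j k) <=
   (alpha * dyadic_weight alpha b j * ir_tail F k%:R)%:E)%E.
Proof.
have l0 := dyadic_lo_gt0 b j; have t0 := ir_tail_ge0 F k%:R.
have lh : dyadic_lo b j < dyadic_hi b j.
  by rewrite /dyadic_hi mulr_natl mulr2n ltrDl.
have cst_int (c : R) :
  (\int[lebesgue_measure]_(x in `]dyadic_lo b j, dyadic_hi b j])
     (c / dyadic_lo b j)%:E = c%:E)%E.
  rewrite integral_cst//= lebesgue_measure_itv/= lte_fin lh -EFinB -EFinM.
  congr (_%:E); rewrite /dyadic_hi.
  by field; rewrite gt_eqF.
have mf : measurable_fun `]dyadic_lo b j, dyadic_hi b j]
    (fun x => (alpha * x `^ (- alpha - 1) * ir_tail F k%:R)%:E).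
  apply: measurable_funTS; apply/measurable_EFinP.
  apply: measurable_funM => //; apply: measurable_funM => //.
rewrite stable_intensity_dyadic; apply/andP; split.
  rewrite -(cst_int (_ * _)); apply: ge0_le_integral => //.
  - move=> x _; rewrite lee_fin divr_ge0 ?(ltW l0)// !mulr_ge0 ?powR_ge0 ?(ltW alpha0) ?dyadic_weight_ge0//.
  - move=> x; rewrite /= in_itv/= => /dyadic_powR /andP[h _].
    rewrite lee_fin ler_pdivrMr// [leRHS]mulrAC ler_wpM2r// -!mulrA ler_pM2l//.
    by rewrite [leRHS]mulrC.
rewrite -(cst_int (_ * _)); apply: ge0_le_integral => //.
- move=> x _; rewrite lee_fin !mulr_ge0 ?powR_ge0 ?(ltW alpha0)//.
- move=> x; rewrite /= in_itv/= => /dyadic_powR /andP[_ h].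
  rewrite lee_fin ler_pdivlMr// mulrAC ler_wpM2r// -!mulrA ler_pM2l//.
  by rewrite mulrC.
Qed.

End DyadicCells.

(** * Sums over dyadic cells *)

Section DyadicSums.
Context (R : realType) (alpha : R).
Hypothesis alpha02 : 0 < alpha < 2.

Definition dyadic_big (z : bool * nat) : R := Num.max 1 (dyadic_hi R z.1 z.2).
Definition dyadic_small (z : bool * nat) : R := Num.min 1 (dyadic_hi R z.1 z.2).
(** The intensity of a cell, up to [alpha], times the squared truncation at
    [1] of its points: only this square makes the small jumps summable. *)
Definition dyadic_mass (z : bool * nat) : R :=
  dyadic_small z ^+ 2 * dyadic_weight alpha z.1 z.2.

Let theta : R := 2 `^ alpha.

Let theta_gt1 : 1 < theta.
Proof.
have /andP[a0 _] := alpha02.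
have : 1 `^ alpha < theta by apply: gt0_ltr_powR; rewrite ?nnegrE ?ltr1n.
by rewrite powR1.
Qed.

Let theta_lt4 : theta < 4.
Proof.
have /andP[_ a2] := alpha02.
have -> : 4 = theta * 2 `^ (2 - alpha) :> R.
  rewrite -powRD ?pnatr_eq0 ?implybT// addrC subrK powR_mulrn//; lra.
rewrite ltr_pMr ?powR_gt0//.
have : 1 `^ (2 - alpha) < 2 `^ (2 - alpha) :> R.
  by apply: gt0_ltr_powR; rewrite ?nnegrE ?ltr1n ?subr_gt0.
by rewrite powR1.
Qed.

Let theta0 : 0 < theta. Proof. exact: lt_trans theta_gt1. Qed.

Lemma dyadic_hiF j : dyadic_hi R false j = 2 ^+ j.+1.
Proof. by rewrite /dyadic_hi/= -exprS. Qed.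

Lemma dyadic_hiT j : dyadic_hi R true j = 2^-1 ^+ j.
Proof. by rewrite /dyadic_hi/= exprS mulrA mulfV// mul1r. Qed.

Let hiF_ge1 j : 1 <= dyadic_hi R false j.
Proof. by rewrite dyadic_hiF exprn_ege1// ler1n. Qed.

Let hiT_le1 j : dyadic_hi R true j <= 1.
Proof. by rewrite dyadic_hiT exprn_ile1// ?invr_ge0// invf_le1// ler1n. Qed.

Lemma dyadic_bigF j : dyadic_big (false, j) = 2 ^+ j.+1.
Proof. by rewrite -dyadic_hiF; exact: max_r. Qed.

Lemma dyadic_bigT j : dyadic_big (true, j) = 1.
Proof. exact: max_l. Qed.

Lemma dyadic_massF j : dyadic_mass (false, j) = theta^-1 ^+ j.
Proof. by rewrite /dyadic_mass /dyadic_small/= min_l// expr1n mul1r. Qed.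

Lemma dyadic_massT j : dyadic_mass (true, j) = theta * (theta / 4) ^+ j.
Proof.
rewrite /dyadic_mass /dyadic_small/= min_r// dyadic_hiT /dyadic_weight -/theta.
rewrite exprMn [theta ^+ j.+1]exprS mulrC -!mulrA; congr (_ * (_ * _)).
by rewrite exprAC; congr (_ ^+ _); rewrite expr2 -invfM; congr (_^-1); lra.
Qed.

Lemma dyadic_mass_ge0 z : 0 <= dyadic_mass z.
Proof. by rewrite mulr_ge0 ?sqr_ge0 ?dyadic_weight_ge0. Qed.

Lemma dyadic_big_ge1 z : 1 <= dyadic_big z.
Proof. by rewrite le_max lexx. Qed.

Lemma geometric_tail_le (q : R) (J M : nat) : 0 <= q < 1 ->
  \sum_(J <= j < M) q ^+ j <= q ^+ J / (1 - q).
Proof.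
move=> /andP[q0 q1]; rewrite ler_pdivlMr ?subr_gt0//.
have [MJ|JM] := leqP M J; first by rewrite big_geq// mul0r exprn_ge0.
rewrite mulr_suml (@telescope_sumr_eq _ _ _ (fun j => - q ^+ j)); last 2 first.
- exact: ltnW.
- by move=> j _ /=; rewrite exprS; ring.
by have := exprn_ge0 M q0; lra.
Qed.

Lemma geometric_sum_lt (q : R) (M : nat) : 0 <= q < 1 ->
  \sum_(j < M) q ^+ j <= (1 - q)^-1.
Proof.
by move=> /(geometric_tail_le 0 M); rewrite big_mkord expr0 div1r.
Qed.

Lemma first_power_above (q x : R) : 1 < q ->
  exists J, x < q ^+ J /\ forall j, (j < J)%N -> q ^+ j <= x.
Proof.
move=> q1; have bernoulli n : 1 + n%:R * (q - 1) <= q ^+ n.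
  elim: n => [|n IH]; first by rewrite mul0r addr0 expr0.
  rewrite exprS; apply: le_trans (_ : q * (1 + n%:R * (q - 1)) <= _).
    have := mulr_ge0 (ler0n R n) (sqr_ge0 (q - 1)); rewrite -natr1; nra.
  by rewrite ler_wpM2l// (le_trans ler01)// ltW.
have ex : exists J, x < q ^+ J.
  exists (Num.truncn (`|x| / (q - 1))).+1; apply: lt_le_trans (bernoulli _).
  have q10 : 0 < q - 1 by rewrite subr_gt0.
  have := truncnS_gt (`|x| / (q - 1)); rewrite ltr_pdivrMr// => h.
  by apply: le_lt_trans (ler_norm x) _; rewrite (lt_trans h)// ltrDr.
exists (ex_minn ex); case: ex_minnP => J xJ minJ; split=> // j jJ.
by rewrite leNgt; apply/negP => /minJ; rewrite leqNgt jJ.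
Qed.

Lemma sum_dyadic_cells M (h : bool * nat -> R) :
  \sum_(c : bool * 'I_M) h (c.1, c.2 : nat) =
  \sum_(j < M) h (true, j : nat) + \sum_(j < M) h (false, j : nat).
Proof.
by rewrite -(pair_bigA _ (fun b (j : 'I_M) => h (b, j : nat)))/= big_bool.
Qed.

Let qT : 0 <= theta / 4 < 1.
Proof. by rewrite divr_ge0 ?(ltW theta0)//= ltr_pdivrMr// mul1r. Qed.

Let qF : 0 <= theta^-1 < 1.
Proof. by rewrite invr_ge0 (ltW theta0)/= invf_lt1. Qed.

Let cT : R := theta / (1 - theta / 4).
Let cT_ge0 : 0 <= cT.
Proof. by have /andP[_ h] := qT; rewrite divr_ge0 ?(ltW theta0)// subr_ge0 ltW. Qed.

Let sum_massT M : \sum_(j < M) dyadic_mass (true, j : nat) <= cT.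
Proof.
under eq_bigr do rewrite dyadic_massT.
rewrite -mulr_sumr ler_wpM2l ?(ltW theta0)//; exact: geometric_sum_lt.
Qed.

(** The small cells are summable as [alpha < 2]; a large cell has mass
    [2 ^ (- alpha j)], the square root of which remains. *)
Lemma sum_mass_sqrt : exists2 C : R, 0 <= C & forall M,
  \sum_(c : bool * 'I_M) dyadic_mass (c.1, c.2 : nat) *
    dyadic_big (c.1, c.2 : nat) `^ (alpha / 2) <= C.
Proof.
have /andP[a0 _] := alpha02.
pose s : R := 2 `^ (alpha / 2).
have s2 : theta = s ^+ 2 by rewrite -powR_mulrn ?powR_ge0// -powRrM mulfVK.
have s0 : 0 < s by exact: powR_gt0.
have s1 : 1 < s by have := theta_gt1; rewrite s2 expr2; nra.
have qs : 0 <= s^-1 < 1 by rewrite invr_ge0 (ltW s0) invf_lt1.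
have C0 : 0 <= s / (1 - s^-1).
  by have /andP[_ h] := qs; rewrite divr_ge0 ?(ltW s0)// subr_ge0 ltW.
exists (cT + s / (1 - s^-1)); first by rewrite addr_ge0.
move=> M; rewrite (sum_dyadic_cells M (fun z => dyadic_mass z * dyadic_big z `^ (alpha / 2))).
apply: lerD.
  by under eq_bigr do rewrite dyadic_bigT powR1 mulr1.
rewrite (eq_bigr (fun j : 'I_M => s * s^-1 ^+ j)); last first.
  move=> j _; rewrite dyadic_massF dyadic_bigF s2.
  rewrite -[2 ^+ _]powR_mulrn// powRAC -/s powR_mulrn ?(ltW s0)//.
  rewrite [s ^+ j.+1]exprS mulrCA; congr (_ * _); rewrite !exprVn -exprM mulnC exprM.
  by rewrite expr2 invfM mulfVK// expf_neq0// gt_eqF.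
by rewrite -mulr_sumr ler_wpM2l ?(ltW s0)//; exact: geometric_sum_lt.
Qed.

(** Each of the roughly [ln x] levels below [x] contributes a constant: here the
    logarithms of the tail asymptotics arise. *)
Lemma sum_mass_trunc : exists2 C : R, 0 <= C & forall M x, 1 <= x ->
  \sum_(c : bool * 'I_M) dyadic_mass (c.1, c.2 : nat) *
    Num.min (dyadic_big (c.1, c.2 : nat)) x `^ alpha <= C * (1 + ln x).
Proof.
have /andP[a0 _] := alpha02.
have ln2 : 0 < ln 2 :> R by rewrite ln_gt0// ltr1n.
pose cF : R := (1 - theta^-1)^-1.
have cF0 : 0 <= cF by have /andP[_ h] := qF; rewrite invr_ge0 subr_ge0 ltW.
exists (cT + theta + theta / ln 2 + cF).
  by rewrite !addr_ge0 ?(ltW theta0)// divr_ge0 ?(ltW theta0) ?(ltW ln2).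
move=> M x x1; have lx : 0 <= ln x by exact: ln_ge0.
have x0 : 0 < x by exact: lt_le_trans x1.
rewrite (sum_dyadic_cells M (fun z => dyadic_mass z * Num.min (dyadic_big z) x `^ alpha)).
have [J [xJ Jx]] := first_power_above x (ltr1n R 2 : 1 < 2).
have hT : \sum_(j < M) dyadic_mass (true, j : nat) * Num.min (dyadic_big (true, j : nat)) x `^ alpha <= cT.
  by under eq_bigr do rewrite dyadic_bigT min_l// powR1 mulr1.
have hJ : J%:R <= 1 + (ln 2)^-1 * ln x.
  case: J xJ Jx => [|J] _ Jx; first by rewrite addr_ge0// mulr_ge0// invr_ge0 ltW.
  rewrite -natr1 addrC lerD2l mulrC ler_pdivlMr// mulr_natl -lnXn//.
  by rewrite ler_ln ?posrE ?exprn_gt0//; exact: Jx.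
have hF : \sum_(j < M) dyadic_mass (false, j : nat) * Num.min (dyadic_big (false, j : nat)) x `^ alpha
    <= theta * J%:R + cF.
  apply: (@le_trans _ _ (\sum_(0 <= j < maxn J M)
     (if (j < J)%N then theta else x `^ alpha * theta^-1 ^+ j))).
    rewrite -(big_mkord xpredT (fun j => dyadic_mass (false, j) * Num.min (dyadic_big (false, j)) x `^ alpha)).
    rewrite [leRHS](@big_cat_nat _ _ _ M)//=; last exact: leq_maxr.
    apply: ler_wpDr.
      by apply: sumr_ge0 => j _; case: ifP => _; rewrite ?(ltW theta0)// mulr_ge0 ?powR_ge0 ?exprn_ge0 ?invr_ge0 ?(ltW theta0).
    apply: ler_sum => j _; rewrite dyadic_massF dyadic_bigF.
    have tj : 0 <= theta^-1 ^+ j by rewrite exprn_ge0// invr_ge0 ltW.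
    have mj : 0 <= Num.min (2 ^+ j.+1) x by rewrite le_min (ltW x0) exprn_ge0.
    case: ifP => _.
      apply: le_trans (_ : theta^-1 ^+ j * (2 ^+ j.+1) `^ alpha <= _).
        rewrite ler_wpM2l// ge0_ler_powR ?nnegrE ?exprn_ge0 ?(ltW a0)//.
        by rewrite ge_min lexx.
      rewrite -[2 ^+ _]powR_mulrn// powRAC -/theta powR_mulrn ?(ltW theta0)//.
      by rewrite exprS mulrCA exprVn mulVf ?mulr1// expf_neq0// gt_eqF.
    rewrite mulrC ler_wpM2r// ge0_ler_powR ?nnegrE ?(ltW x0) ?(ltW a0)//.
    by rewrite ge_min lexx orbT.
  rewrite (@big_cat_nat _ _ _ J)//=; last exact: leq_maxl.
  apply: lerD.
    rewrite big_mkord (eq_bigr (fun=> theta)); last by move=> j _; rewrite ltn_ord.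
    by rewrite sumr_const card_ord mulr_natr.
  rewrite (eq_big_nat _ _ (F2 := fun j => x `^ alpha * theta^-1 ^+ j)); last first.
    by move=> j /andP[Jj _]; rewrite ltnNge Jj.
  rewrite -mulr_sumr; apply: le_trans (ler_wpM2l (powR_ge0 _ _) (geometric_tail_le _ _ qF)) _.
  rewrite mulrA -/cF ler_piMl// exprVn ler_pdivrMr ?exprn_gt0// mul1r.
  have -> : theta ^+ J = (2 ^+ J) `^ alpha.
    by rewrite -[_ ^+ J]powR_mulrn ?(ltW theta0)// -[2 ^+ J]powR_mulrn// powRAC.
  by rewrite ge0_ler_powR ?nnegrE ?exprn_ge0 ?(ltW x0) ?(ltW a0)// ltW.
apply: le_trans (lerD hT hF) _.
have := mulr_ge0 cT_ge0 lx; have := mulr_ge0 cF0 lx; have := mulr_ge0 (ltW theta0) lx.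
have : 0 <= theta / ln 2 by rewrite divr_ge0 ?(ltW theta0) ?(ltW ln2).
have := ler_wpM2l (ltW theta0) hJ; rewrite mulrDr mulr1 mulrA; lra.
Qed.

(** The two terms in the minimum cross at the level where [4 ^ j * A] is
    about [1], and both geometric sums are of the size of their term there. *)
Lemma sum_mass_min : exists2 C : R, 0 <= C & forall M A, 0 < A ->
  \sum_(c : bool * 'I_M) dyadic_mass (c.1, c.2 : nat) *
    Num.min 1 (dyadic_big (c.1, c.2 : nat) ^+ 2 * A) <= C * Num.min 1 A `^ (alpha / 2).
Proof.
have /andP[a0 a2] := alpha02.
pose cF : R := (1 - theta^-1)^-1.
have cF0 : 0 <= cF by have /andP[_ h] := qF; rewrite invr_ge0 subr_ge0 ltW.
pose q : R := 4 / theta.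
have q1 : 1 < q by rewrite ltr_pdivlMr// mul1r.
have q0 : 0 < q by exact: lt_trans q1.
pose cq : R := 4 * q / (q - 1).
have cq0 : 0 <= cq by rewrite divr_ge0 ?subr_ge0 ?(ltW q1)// mulr_ge0 ?(ltW q0).
exists (cT + cF + cq); first by rewrite !addr_ge0.
move=> M A A0.
rewrite (sum_dyadic_cells M (fun z => dyadic_mass z * Num.min 1 (dyadic_big z ^+ 2 * A))).
have m0 : 0 < Num.min 1 A by rewrite lt_min ltr01.
have m1 : Num.min 1 A <= 1 by rewrite ge_min lexx.
have mp : Num.min 1 A <= Num.min 1 A `^ (alpha / 2).
  by rewrite ger1_powR ?m0//; lra.
have hT : \sum_(j < M) dyadic_mass (true, j : nat) * Num.min 1 (dyadic_big (true, j : nat) ^+ 2 * A)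
    <= cT * Num.min 1 A `^ (alpha / 2).
  under eq_bigr do rewrite dyadic_bigT expr1n mul1r.
  by rewrite -mulr_suml ler_pM ?sumr_ge0 ?(ltW m0)// => j _; exact: dyadic_mass_ge0.
suff hF : \sum_(j < M) dyadic_mass (false, j : nat) * Num.min 1 (dyadic_big (false, j : nat) ^+ 2 * A)
    <= (cF + cq) * Num.min 1 A `^ (alpha / 2).
  by rewrite -addrA mulrDl lerD.
have tj j : 0 <= theta^-1 ^+ j by rewrite exprn_ge0// invr_ge0 ltW.
have [A1|A1] := leP 1 A.
  rewrite powR1 mulr1; apply: ler_wpDr => //.
  apply: le_trans (geometric_sum_lt M qF); apply: ler_sum => j _.
  by rewrite dyadic_massF ler_piMr// ge_min lexx.
have lt14 : 1 < 4 :> R by rewrite ltr1n.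
have [J [AJ JA]] := first_power_above A^-1 lt14.
have J0 : (0 < J)%N.
  by rewrite lt0n; apply: contraTN AJ => /eqP ->; rewrite expr0 -leNgt invf_ge1// ltW.
have theta_pow n : theta ^+ n = (4 ^+ n) `^ (alpha / 2).
  have -> : 4 = 2 ^+ 2 :> R by lra.
  rewrite -exprM -[2 ^+ _]powR_mulrn// -powRrM -[LHS]powR_mulrn ?(ltW theta0)//.
  by rewrite -powRrM natrM; congr (_ `^ _); field.
apply: (@le_trans _ _ (\sum_(0 <= j < maxn J M)
   (if (j < J)%N then 4 * A * q ^+ j else theta^-1 ^+ j))).
  rewrite -(big_mkord xpredT (fun j => dyadic_mass (false, j) * Num.min 1 (dyadic_big (false, j) ^+ 2 * A))).
  rewrite [leRHS](@big_cat_nat _ _ _ M)//=; last exact: leq_maxr.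
  apply: ler_wpDr.
    by apply: sumr_ge0 => j _; case: ifP => _//; rewrite !mulr_ge0 ?exprn_ge0 ?(ltW q0) ?(ltW A0).
  apply: ler_sum => j _; rewrite dyadic_massF dyadic_bigF; case: ifP => _; last first.
    by rewrite ler_piMr// ge_min lexx.
  apply: le_trans (_ : theta^-1 ^+ j * ((2 ^+ j.+1) ^+ 2 * A) <= _).
    by rewrite ler_wpM2l// ge_min lexx orbT.
  apply: eq_lew.
  have -> : (2 ^+ j.+1) ^+ 2 = 4 * 4 ^+ j :> R.
    by rewrite -exprM mulnC exprM -exprS; congr (_ ^+ _); lra.
  by rewrite /q exprMn; ring.
rewrite (@big_cat_nat _ _ _ J)//=; last exact: leq_maxl.
rewrite [leRHS]mulrDl [leRHS]addrC; apply: lerD.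
  rewrite big_mkord (eq_bigr (fun j : 'I_J => 4 * A * q ^+ j)); last first.
    by move=> j _; rewrite ltn_ord.
  rewrite -mulr_sumr.
  have geo : \sum_(j < J) q ^+ j <= q ^+ J / (q - 1).
    rewrite -(big_mkord xpredT (fun j => q ^+ j)) ler_pdivlMr ?subr_gt0// mulr_suml.
    rewrite (@telescope_sumr_eq _ _ _ (fun j => q ^+ j))//; last first.
      by move=> j _ /=; rewrite exprS; ring.
    by rewrite expr0 gerBl.
  have A40 : 0 <= 4 * A by rewrite mulr_ge0// ltW.
  apply: (le_trans (ler_wpM2l A40 geo)).
  have qJ : A * q ^+ J <= q * A `^ (alpha / 2).
    case: J J0 JA {AJ geo} => // J _ /(_ J (ltnSn J)) JA.
    rewrite exprS mulrCA ler_wpM2l ?(ltW q0)// /q exprMn exprVn theta_pow.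
    have p0 : 0 < 4 ^+ J :> R by rewrite exprn_gt0.
    rewrite mulrA ler_pdivrMr ?powR_gt0// -powRM ?(ltW A0) ?(ltW p0)//.
    have y1 : A * 4 ^+ J <= 1.
      by have := ler_wpM2l (ltW A0) JA; rewrite mulfV// gt_eqF.
    by rewrite ger1_powR ?mulr_gt0//; lra.
  have h : 0 < (q - 1)^-1 by rewrite invr_gt0 subr_gt0.
  have h4 : 0 <= 4 / (q - 1) by rewrite mulr_ge0// ltW.
  apply: le_trans (_ : 4 / (q - 1) * (A * q ^+ J) <= _); first by apply: eq_lew; ring.
  apply: le_trans (ler_wpM2l h4 qJ) _.
  by apply: eq_lew; rewrite /cq; ring.
rewrite (eq_big_nat _ _ (F2 := fun j => theta^-1 ^+ j)); last first.
  by move=> j /andP[Jj _]; rewrite ltnNge Jj.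
apply: le_trans (geometric_tail_le _ _ qF) _; rewrite mulrC -/cF ler_wpM2l//.
rewrite exprVn theta_pow -[leRHS]invrK lef_pV2 ?posrE ?invr_gt0 ?powR_gt0 ?exprn_gt0//.
rewrite -powR_inv1 ?powR_ge0// -powRAC powR_inv1 ?(ltW A0)//.
rewrite ge0_ler_powR ?nnegrE ?invr_ge0 ?(ltW A0) ?exprn_ge0 ?(ltW AJ)//.
by rewrite divr_ge0 ?(ltW a0).
Qed.

End DyadicSums.

Local Close Scope classical_set_scope.

Section FfunUpdate.
Context (n : nat) (X : finType).

Definition ffun_update (e : {ffun 'I_n -> X}) (r0 : 'I_n) (v : X) : {ffun 'I_n -> X} :=
  [ffun r => if r == r0 then v else e r].

Lemma sum_ffun_update (R : nmodType) (r0 : 'I_n) (x0 : X) (F : {ffun 'I_n -> X} -> R) :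
  \sum_c F c = \sum_(e : {ffun 'I_n -> X} | e r0 == x0) \sum_v F (ffun_update e r0 v).
Proof.
rewrite (partition_big (fun c => ffun_update c r0 x0) (fun e => e r0 == x0))/=; last first.
  by move=> c _; rewrite ffunE eqxx.
apply: eq_bigr => e /eqP er0.
rewrite (reindex_onto (fun v => ffun_update e r0 v) (fun c => c r0))/=.
  apply: eq_bigl => v; rewrite ffunE !eqxx andbT; apply/eqP/ffunP => r.
  by rewrite !ffunE; case: eqVneq => [->|].
move=> c /eqP <-; apply/ffunP => r; rewrite !ffunE; case: eqVneq => [->//|_].
by [].
Qed.

Lemma sum_ffun_prod_at (R : comPzSemiRingType) (r0 : 'I_n) (x0 : X) (h : 'I_n -> X -> R) :
  \sum_(e : {ffun 'I_n -> X} | e r0 == x0) \prod_(r | r != r0) h r (e r) =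
  \prod_(r | r != r0) \sum_v h r v.
Proof.
pose h' r v : R := if r == r0 then (v == x0)%:R else h r v.
transitivity (\sum_(e : {ffun 'I_n -> X}) \prod_r h' r (e r)).
  rewrite big_mkcond/=; apply: eq_bigr => e _.
  rewrite [RHS](bigD1 r0)//= {1}/h' eqxx; case: ifP => _; last by rewrite mul0r.
  by rewrite mul1r; apply: eq_bigr => r rr0; rewrite /h' (negbTE rr0).
rewrite -(bigA_distr_bigA h') (bigD1 r0)//= (bigD1 x0)//=.
rewrite [X in (_ + X) * _]big1 => [|v vx0].
  rewrite /h' !eqxx addr0 mul1r; apply: eq_bigr => r rr0.
  by apply: eq_bigr => v _; rewrite (negbTE rr0).
by rewrite /h' eqxx (negbTE vx0).
Qed.

End FfunUpdate.

Section PatternSum.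
Context (R : realType) (alpha : R).
Hypothesis alpha02 : 0 < alpha < 2.

(** A point used by both configurations has role [None] and counts twice in
    the product of the two weights. *)
Definition role_mult (rho : option bool) : nat := if rho is None then 2 else 1.

Definition pattern_weight (x : R) n (rho : {ffun 'I_n -> option bool}) (b : 'I_n -> R) : R :=
  Num.min 1 (x ^- 2 * \prod_r b r ^+ role_mult (rho r)).

Definition cell_val M (c : bool * 'I_M) : bool * nat := (c.1, c.2 : nat).

(** If no point is shared, [min 1 y <= y ^ (alpha / 2)] with
    [y = x ^ (-2) * \prod b] decouples all the points. Otherwise sum out one
    shared point [r0] first ([sum_mass_min]): this yields [x ^ (- alpha)]
    together with a product over the other points, in which each shared point
    is truncated at [x] and so costs a logarithm. Hence the exponent is one
    less than the number of shared points. *)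
Lemma pattern_sum_le n : exists2 C : R, 0 <= C &
  forall (rho : {ffun 'I_n -> option bool}) (x : R) M, 1 <= x ->
  \sum_(c : {ffun 'I_n -> bool * 'I_M.+1})
    pattern_weight x rho (fun r => dyadic_big R (cell_val (c r))) *
    \prod_r dyadic_mass alpha (cell_val (c r)) <=
  C * (x `^ (- alpha) * (1 + ln x) ^+ #|[set r | rho r == None]|.-1).
Proof.
have [C1 C10 hC1] := sum_mass_sqrt alpha02.
have [C2 C20 hC2] := sum_mass_trunc alpha02.
have [C3 C30 hC3] := sum_mass_min alpha02.
have /andP[a0 a2] := alpha02.
pose C := 1 + C1 + C2 + C3.
have C_ge1 : 1 <= C by rewrite /C; lra.
have C_ge0 : 0 <= C by exact: le_trans C_ge1.
exists (C ^+ n); first exact: exprn_ge0.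
move=> rho x M x1; have x0 : 0 < x by exact: lt_le_trans x1.
have xa0 : 0 <= x `^ (- alpha) by exact: powR_ge0.
have lx1 : 1 <= 1 + ln x by rewrite lerDl ln_ge0.
have x2a : (x ^- 2) `^ (alpha / 2) = x `^ (- alpha).
  rewrite -powR_invn ?(ltW x0)// -powRrM; by congr (_ `^ _); field.
have big1 z := dyadic_big_ge1 R z; have mass0 z := dyadic_mass_ge0 alpha z.
have big0 z : 0 <= dyadic_big R z by exact: le_trans (big1 z).
have sqrt_pow k z : 0 <= z -> (z ^+ k) `^ (alpha / 2) = z `^ (k%:R * (alpha / 2)) :> R.
  by move=> z0; rewrite -powR_mulrn// -powRrM.
have prod_pow (Q : pred 'I_n) (F : 'I_n -> R) s : (forall r, 0 <= F r) ->
    (\prod_(r | Q r) F r) `^ s = \prod_(r | Q r) F r `^ s.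
  move=> F0; suff : 0 <= \prod_(r | Q r) F r /\
      (\prod_(r | Q r) F r) `^ s = \prod_(r | Q r) F r `^ s by case.
  elim/big_rec2 : _ => [|r y1 y2 _ [y0 <-]]; first by rewrite powR1.
  by rewrite mulr_ge0// powRM.
have [r0 r0K|K0] := pickP [pred r | rho r == None]; last first.
  have -> : #|[set r | rho r == None]| = 0%N.
    by apply: eq_card0 => r; rewrite inE; exact: K0.
  rewrite expr0 mulr1.
  apply: (@le_trans _ _ (\sum_(c : {ffun 'I_n -> bool * 'I_M.+1}) x `^ (- alpha) *
      \prod_r (dyadic_mass alpha (cell_val (c r)) * dyadic_big R (cell_val (c r)) `^ (alpha / 2)))).
    apply: ler_sum => c _; rewrite [X in _ <= _ * X]big_split/= [leRHS]mulrCA [leRHS]mulrC ler_wpM2r ?prodr_ge0//.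
    rewrite /pattern_weight; set Y := \prod_r _ ^+ role_mult _.
    have YE : Y = \prod_r dyadic_big R (cell_val (c r)).
      apply: eq_bigr => r _; have := K0 r; rewrite /= /role_mult.
      by case: (rho r).
    have Y0 : 0 < x ^- 2 * Y.
      rewrite mulr_gt0 ?invr_gt0 ?exprn_gt0// YE prodr_gt0// => r _.
      exact: lt_le_trans (big1 _).
    rewrite -prod_pow// -x2a -YE -powRM ?invr_ge0 ?sqr_ge0//; last first.
      by rewrite YE prodr_ge0.
    case: (leP 1 (x ^- 2 * Y)) => h.
      by rewrite -[leLHS](powRr0 (x ^- 2 * Y)) ler_powR// divr_ge0// ltW.
    by rewrite ger1_powR ?Y0 ?(ltW h)//; lra.
  rewrite -mulr_sumr mulrC ler_wpM2r//.
  rewrite -(bigA_distr_bigA (fun r v => dyadic_mass alpha (cell_val v) * dyadic_big R (cell_val v) `^ (alpha / 2))).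
  rewrite prodr_const card_ord lerXn2r ?nnegrE//.
    by rewrite sumr_ge0// => v _; rewrite mulr_ge0// powR_ge0.
  by apply: le_trans (hC1 M.+1) _; rewrite /C; lra.
pose z0 : bool * 'I_M.+1 := (true, ord0).
pose mass (v : bool * 'I_M.+1) := dyadic_mass alpha (cell_val v).
pose dbig (v : bool * 'I_M.+1) := dyadic_big R (cell_val v).
have dbig0 v : 0 <= dbig v by exact: big0.
pose A (e : {ffun 'I_n -> bool * 'I_M.+1}) :=
  x ^- 2 * \prod_(r | r != r0) dbig (e r) ^+ role_mult (rho r).
(* the factor left to the point in position r once the point r0 is summed out *)
pose b r v := if rho r == None then Num.min (dbig v) x `^ alpha else dbig v `^ (alpha / 2).
have b_ge1 r v : 1 <= b r v.
  have one : 1 = 1 `^ alpha :> R by rewrite powR1.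
  have one' : 1 = 1 `^ (alpha / 2) :> R by rewrite powR1.
  rewrite /b; case: ifP => _.
    by rewrite [leLHS]one ge0_ler_powR ?nnegrE ?(ltW a0) ?le_min ?ler01 ?(ltW x0) ?big0 ?big1.
  by rewrite [leLHS]one' ge0_ler_powR ?nnegrE ?divr_ge0 ?(ltW a0) ?big0 ?big1.
have A_le e : Num.min 1 (A e) `^ (alpha / 2) <= x `^ (- alpha) * \prod_(r | r != r0) b r (e r).
  have Ae0 : 0 < A e.
    rewrite mulr_gt0 ?invr_gt0 ?exprn_gt0// prodr_gt0// => r _.
    by rewrite exprn_gt0// (lt_le_trans ltr01)// big1.
  have [/existsP[r1 /and3P[r10 r1K r1x]]|] := boolP [exists r, [&& r != r0, rho r == None & x < dbig (e r)]].
    apply: (@le_trans _ _ 1).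
      have one : 1 = 1 `^ (alpha / 2) :> R by rewrite powR1.
      rewrite [leRHS]one ge0_ler_powR ?nnegrE ?divr_ge0 ?(ltW a0)// ?ge_min ?lexx//.
      by rewrite le_min ler01 ltW.
    rewrite (bigD1 r1)//= {1}/b r1K (min_r (ltW r1x)) mulrA powRN mulVf ?mul1r; last first.
      by rewrite gt_eqF// powR_gt0.
    elim/big_ind : _ => [//|u v u1 v1|r _]; last exact: b_ge1.
    by rewrite -[leLHS]mulr1 ler_pM.
  rewrite negb_exists => /forallP nox.
  apply: (@le_trans _ _ (A e `^ (alpha / 2))).
    rewrite ge0_ler_powR ?nnegrE ?divr_ge0 ?(ltW a0) ?(ltW Ae0) ?le_min ?ler01 ?(ltW Ae0)//.
    by rewrite ge_min lexx orbT.
  rewrite /A powRM ?invr_ge0 ?sqr_ge0//; last first.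
    by apply: prodr_ge0 => r _; rewrite exprn_ge0 ?dbig0.
  rewrite x2a ler_wpM2l// prod_pow; last by move=> r; rewrite exprn_ge0 ?dbig0.
  apply: eq_lew; apply: eq_bigr => r rr0.
  rewrite /b /role_mult; have := nox r; rewrite rr0/= negb_and -leNgt.
  case: (rho r) => [s|] /=; first by rewrite expr1.
  by move=> h; rewrite (min_l h) sqrt_pow//; congr (_ `^ _); field.
rewrite (sum_ffun_update r0 z0)/=.
apply: (@le_trans _ _ (\sum_(e : {ffun 'I_n -> bool * 'I_M.+1} | e r0 == z0)
   C3 * x `^ (- alpha) * \prod_(r | r != r0) (mass (e r) * b r (e r)))).
  apply: ler_sum => e _.
  rewrite (eq_bigr (fun v => (mass v * Num.min 1 (dbig v ^+ 2 * A e)) *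
     \prod_(r | r != r0) mass (e r))); last first.
    move=> v _; rewrite (bigD1 r0)//= ffunE eqxx mulrA [_ * mass v]mulrC.
    congr (_ * Num.min _ _ * _).
      rewrite (bigD1 r0)//= ffunE eqxx (eqP r0K) /A mulrCA; congr (_ * (_ * _)).
      by apply: eq_bigr => r /negbTE rr0; rewrite ffunE rr0.
    by apply: eq_bigr => r /negbTE rr0; rewrite ffunE rr0.
  rewrite -mulr_suml [X in _ <= _ * X]big_split/= mulrCA mulrC ler_wpM2l ?prodr_ge0//.
    by move=> r _; exact: mass0.
  have Ae0 : 0 < A e.
    rewrite mulr_gt0 ?invr_gt0 ?exprn_gt0// prodr_gt0// => r _.
    by rewrite exprn_gt0// (lt_le_trans ltr01)// big1.
  by apply: le_trans (hC3 M.+1 _ Ae0) _; rewrite -mulrA ler_wpM2l.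
rewrite -mulr_sumr (sum_ffun_prod_at r0 z0 (fun r v => mass v * b r v)).
have sb r : \sum_v mass v * b r v <= C * (if rho r == None then 1 + ln x else 1).
  rewrite /b; case: ifP => _; last first.
    by apply: le_trans (hC1 M.+1) _; rewrite mulr1 /C; lra.
  apply: le_trans (hC2 M.+1 x x1) _; rewrite ler_wpM2r ?(le_trans ler01)//.
  by rewrite /C; lra.
have sb0 r : 0 <= \sum_v mass v * b r v.
  by apply: sumr_ge0 => v _; rewrite mulr_ge0 ?mass0// (le_trans ler01).
apply: (@le_trans _ _ (C * x `^ (- alpha) * \prod_(r | r != r0) (C * (if rho r == None then 1 + ln x else 1)))).
  rewrite ler_pM ?mulr_ge0 ?prodr_ge0//.
    by rewrite ler_wpM2r// /C; lra.
  by apply: ler_prod => r _; rewrite sb0 sb.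
rewrite big_split/= prodr_const -big_mkcondr/= prodr_const.
have -> : #|(fun i : 'I_n => i != r0)| = n.-1.
  by rewrite -[in RHS](card_ord n); exact: cardC1.
have -> : #|[set r | rho r == None]|.-1 = #|(fun i : 'I_n => (i != r0) && (rho i == None))|.
  have r0K' : rho r0 == None by exact: r0K.
  rewrite (cardsD1 r0) inE r0K' add1n/=.
  apply: eq_card => r.
  by rewrite !inE unfold_in.
apply: eq_lew.
have -> : C ^+ n = C * C ^+ n.-1.
  by rewrite -exprS prednK// (leq_ltn_trans _ (ltn_ord r0)).
by ring.
Qed.

End PatternSum.

Local Open Scope classical_set_scope.

(** * Rademacher chaos *)

Local Close Scope classical_set_scope.

Section SignAverages.
Context (R : realFieldType) (I K : finType).

Implicit Types (t A B D : {set I}) (e : {ffun I -> bool}).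

Definition sgn (b : bool) : R := (-1) ^+ b.

Definition walsh (A : {set I}) (e : {ffun I -> bool}) : R := \prod_(i in A) sgn (e i).

(** A subcube of sign vectors, with free coordinates [t]: averages over it are
    conditional expectations given the other signs. *)
Definition flips (t : {set I}) (e0 : {ffun I -> bool}) : {pred {ffun I -> bool}} :=
  [pred e : {ffun I -> bool} | [forall i, (i \in t) || (e i == e0 i)]].

Lemma sgn_sq b : sgn b * sgn b = 1. Proof. by rewrite -expr2 sqrr_sign. Qed.

Lemma normr_sgn b : `|sgn b| = 1. Proof. exact: normr_sign. Qed.

Lemma flips_sym t e e' : (e' \in flips t e) = (e \in flips t e').
Proof. by rewrite !inE; apply: eq_forallb => i; rewrite eq_sym. Qed.

Lemma sum_flips_prod t e0 (h : I -> bool -> R) :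
  \sum_(e in flips t e0) \prod_i h i (e i) =
  \prod_i (if i \in t then h i true + h i false else h i (e0 i)).
Proof.
pose Q i := [pred b | (i \in t) || (b == e0 i)].
transitivity (\sum_(e in family Q) \prod_i h i (e i)).
  apply: eq_bigl => e; rewrite !inE; apply: eq_forallb => i.
  by [] .
rewrite -(bigA_distr_big_dep Q h); apply: eq_bigr => i _.
rewrite /Q/=; case: ifP => it /=; first by rewrite big_bool.
by rewrite (big_pred1 (e0 i)).
Qed.

Lemma card_flips t e0 : #|flips t e0| = (2 ^ #|t|)%N.
Proof.
apply/eqP; rewrite -(eqr_nat R) -[X in X%:R == _]sum1_card natr_sum.
have -> : \sum_(e in flips t e0) 1 = \prod_i (if i \in t then 1 + 1 else 1) :> R.
  rewrite -(sum_flips_prod t e0 (fun _ _ => 1)).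
  by apply: eq_bigr => e _; rewrite big1.
rewrite (bigID (mem t))/= [X in _ * X]big1 => [|i /negbTE ->//].
rewrite (eq_bigr (fun=> 2)); last by move=> i ->.
by rewrite prodr_const mulr1 natrX.
Qed.

Lemma sum_walsh_eq t e0 A :
  \sum_(e in flips t e0) walsh A e * walsh A e = 2 ^+ #|t|.
Proof.
rewrite (eq_bigr (fun=> 1)); last first.
  move=> e _; rewrite /walsh -big_split/= big1// => i _; exact: sgn_sq.
by rewrite sumr_const card_flips natrX.
Qed.

Lemma sum_walsh_neq t e0 A B i : i \in t -> i \in A -> i \notin B ->
  \sum_(e in flips t e0) walsh A e * walsh B e = 0.
Proof.
move=> it iA iB.
pose h j b := (if j \in A then sgn b else 1) * (if j \in B then sgn b else 1).
rewrite (eq_bigr (fun e : {ffun I -> bool} => \prod_j h j (e j))); last first.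
  by move=> e _; rewrite big_split/= /walsh -!big_mkcond.
rewrite sum_flips_prod (bigD1 i)//= it /h iA (negbTE iB) /sgn expr1 expr0.
by rewrite !mulr1 addNr mul0r.
Qed.

Context (s : K -> {set I}) (p : nat).
Hypothesis s_inj : injective s.
Hypothesis s_card : forall m, #|s m| = p.
Context (y : I -> R).

(** The multiple series, cut to finitely many terms and to the points [D]
    visiting a given time, is a homogeneous Rademacher chaos. *)
Definition chaos (D : {set I}) (e : {ffun I -> bool}) : R :=
  \sum_(m | s m \subset D) \prod_(i in s m) (sgn (e i) * y i).

Lemma chaosE D e : chaos D e =
  \sum_(m | s m \subset D) (\prod_(i in s m) y i) * walsh (s m) e.
Proof. by apply: eq_bigr => m _; rewrite big_split mulrC. Qed.

(** Distinct Walsh functions are orthogonal. *)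
Lemma chaos_second_moment D :
  \sum_e chaos D e ^+ 2 = 2 ^+ #|I| * \sum_(m | s m \subset D) \prod_(i in s m) y i ^+ 2.
Proof.
pose e0 : {ffun I -> bool} := [ffun=> true].
have inT e : e \in flips [set: I] e0 by rewrite inE; apply/forallP => i; rewrite inE.
rewrite (eq_bigl (mem (flips [set: I] e0))); last by move=> e; rewrite /= inT.
rewrite (eq_bigr (fun e => \sum_(m | s m \subset D) \sum_(m' | s m' \subset D)
  ((\prod_(i in s m) y i) * (\prod_(i in s m') y i)) * (walsh (s m) e * walsh (s m') e))); last first.
  move=> e _; rewrite expr2 chaosE mulr_suml; apply: eq_bigr => m _.
  by rewrite mulr_sumr; apply: eq_bigr => m' _; ring.
rewrite exchange_big/= mulr_sumr; apply: eq_bigr => m mD.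
rewrite exchange_big/= (bigD1 m)//= -mulr_sumr sum_walsh_eq [X in _ + X]big1.
  by rewrite addr0 cardsT mulrC prodrXl expr2.
move=> m' /andP[_ m'm]; rewrite -mulr_sumr.
have [i im im'] : exists2 i, i \in s m & i \notin s m'.
  apply/subsetPn; apply: contra m'm => sub; apply/eqP/s_inj/esym/eqP.
  by rewrite eqEcard sub !s_card /=.
by rewrite (@sum_walsh_neq _ _ _ _ i) ?mulr0 ?inE.
Qed.

(** Chebyshev's inequality over the signs. *)
Lemma chaos_tail_le D x : 0 < x ->
  #|[set e | x < `|chaos D e|]|%:R * x ^+ 2 <=
  2 ^+ #|I| * \sum_(m | s m \subset D) \prod_(i in s m) y i ^+ 2.
Proof.
move=> x0; rewrite -chaos_second_moment -sum1_card natr_sum mulr_suml big_mkcond/=.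
apply: ler_sum => e _; rewrite inE; case: ifP => h; last exact: sqr_ge0.
by rewrite mul1r -[leRHS]real_normK ?num_real// lerXn2r ?nnegrE ?(ltW x0)// ltW.
Qed.

(** Averaging over the [p] signs of one index set isolates its coefficient, so
    for some choice of these [p] signs the chaos is at least that large. *)
Lemma chaos_tail_ge D x m0 : s m0 \subset D -> x <= \prod_(i in s m0) y i ->
  (2 ^ #|I| <= 2 ^ p * #|[set e | (x <= `|chaos D e|)%R]|)%N.
Proof.
move=> m0D xy.
have ex e : exists2 e', e' \in flips (s m0) e & x <= `|chaos D e'|.
  apply/exists_inP; apply: contraT; rewrite negb_exists_in => /forall_inP h.
  have : \sum_(e' in flips (s m0) e) walsh (s m0) e' * chaos D e' =
      2 ^+ p * \prod_(i in s m0) y i.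
    rewrite (eq_bigr (fun e' => \sum_(m | s m \subset D)
       (\prod_(i in s m) y i) * (walsh (s m0) e' * walsh (s m) e'))); last first.
      by move=> e' _; rewrite chaosE mulr_sumr; apply: eq_bigr => m _; ring.
    rewrite exchange_big/= (bigD1 m0)//= -mulr_sumr sum_walsh_eq [X in _ + X]big1.
      by rewrite addr0 s_card mulrC.
    move=> m /andP[_ mm0]; rewrite -mulr_sumr.
    have [i im im'] : exists2 i, i \in s m0 & i \notin s m.
      apply/subsetPn; apply: contra mm0 => sub; apply/eqP/s_inj/esym/eqP.
      by rewrite eqEcard sub !s_card /=.
    by rewrite (@sum_walsh_neq _ _ _ _ i) ?mulr0.
  move=> hsum; suff : `|\sum_(e' in flips (s m0) e) walsh (s m0) e' * chaos D e'| < 2 ^+ p * x.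
    rewrite hsum => /(le_lt_trans (ler_norm _)).
    by rewrite ltr_pM2l ?exprn_gt0// ltNge xy.
  apply: le_lt_trans (ler_norm_sum _ _ _) _.
  apply: (@lt_le_trans _ _ (\sum_(e' in flips (s m0) e) x)).
    apply: ltr_sum.
      by apply/hasP; exists e; rewrite ?mem_index_enum// inE; apply/forallP => i; rewrite eqxx orbT.
    move=> e' /h; rewrite -ltNge normrM => hx.
    suff -> : `|walsh (s m0) e'| = 1 by rewrite mul1r.
    by rewrite normr_prod big1// => i _; exact: normr_sgn.
  by rewrite sumr_const card_flips s_card -natrX mulr_natl.
have -> : (2 ^ #|I| = \sum_(e : {ffun I -> bool}) 1)%N.
  by rewrite sum1_card card_ffun card_bool.
apply: (@leq_trans (\sum_e \sum_(e' in flips (s m0) e | (x <= `|chaos D e'|)%R) 1)).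
  apply: leq_sum => e _; have [e' he' xe'] := ex e.
  by rewrite (bigD1 e') ?he'.
rewrite (exchange_big_dep (fun e' => (x <= `|chaos D e'|)%R))/=; last by move=> e e' _ /andP[].
rewrite mulnC -sum_nat_const.
rewrite [leqRHS](eq_bigl (fun e' => (x <= `|chaos D e'|)%R)); last by move=> e; rewrite inE.
apply: leq_sum => e' xe'; rewrite -(s_card m0) -(card_flips _ e') sum1_card.
by apply: subset_leq_card; apply/fintype.subsetP => e; rewrite unfold_in xe' andbT flips_sym.
Qed.

End SignAverages.

Local Open Scope classical_set_scope.

(** * Patterns formed by two configurations of points *)

Local Close Scope classical_set_scope.

Lemma min_sum_le (R : realDomainType) (I : finType) (Q : pred I) (c : R) (F : I -> R) :
  0 <= c -> (forall i, 0 <= F i) ->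
  Num.min c (\sum_(i | Q i) F i) <= \sum_(i | Q i) Num.min c (F i).
Proof.
move=> c0 F0; suff : 0 <= \sum_(i | Q i) F i /\
    Num.min c (\sum_(i | Q i) F i) <= \sum_(i | Q i) Num.min c (F i) by case.
elim/big_rec2 : _ => [|i a b _ [b0 ab]]; first by rewrite min_r.
split; first exact: addr_ge0.
have Fi0 := F0 i; apply: le_trans (lerD (lexx _) ab).
by rewrite !minEle; do !case: ifP => //; lra.
Qed.

Section PatternBound.
Context (R : realType) (I : finType) (p : nat) (y : I -> R) (x : R).
Hypothesis y0 : forall i, 0 < y i.
Hypothesis x0 : 0 < x.

Local Notation B i := (Num.max 1 (y i)).
Local Notation m i := (Num.min 1 (y i)).

Let Big := [set i | 1 < y i].

Let B_ge1 i : 1 <= B i. Proof. by rewrite le_max lexx. Qed.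
Let B_ge0 i : 0 <= B i. Proof. exact: le_trans (B_ge1 i). Qed.
Let m_ge0 i : 0 <= m i. Proof. by rewrite le_min ler01 ltW. Qed.
Let m_le1 i : m i <= 1. Proof. by rewrite ge_min lexx. Qed.

Let prod_B (s : {set I}) : \prod_(i in s) B i = \prod_(i in s :&: Big) B i.
Proof.
rewrite (big_setID Big)/= [X in _ * X]big1 ?mulr1// => i.
by rewrite !inE -leNgt => /andP[yi _]; exact: max_l.
Qed.

Let fiber (D : {set I}) (A : {set I}) : R :=
  \sum_(s : {set I} | [&& s \subset D, (#|s| <= p)%N & s :&: Big == A])
     \prod_(i in s) m i ^+ 2.

Let fiber_ge1 (D A : {set I}) :
  A \subset D -> A \subset Big -> (#|A| <= p)%N -> 1 <= fiber D A.
Proof.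
move=> AD AB Ap; rewrite /fiber (bigD1 A)/=; last first.
  by rewrite AD Ap (finset.setIidPl AB) eqxx.
rewrite big1 => [|i /(fintype.subsetP AB)]; last first.
  by rewrite inE => /ltW yi; rewrite min_l// expr1n.
by rewrite lerDl sumr_ge0// => s _; rewrite prodr_ge0// => i _; exact: sqr_ge0.
Qed.

Let bigs (D : {set I}) (A : {set I}) :=
  [&& A \subset D, A \subset Big & (#|A| <= p)%N].

Let square_sum_le (D : {set I}) :
  x ^- 2 * (\sum_(s : {set I} | (#|s| == p) && (s \subset D)) \prod_(i in s) y i ^+ 2) <=
  \sum_(A | bigs D A) (x ^- 2 * (\prod_(i in A) B i) ^+ 2) * fiber D A.
Proof.
have xx0 : 0 <= x ^- 2 by rewrite invr_ge0 exprn_ge0// ltW.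
under [leRHS]eq_bigr do rewrite -mulrA.
rewrite -[leRHS]mulr_sumr ler_wpM2l//.
rewrite (partition_big (fun s => s :&: Big) (bigs D))/=; last first.
  move=> s /andP[/eqP sp sD]; rewrite /bigs finset.subsetIr/=.
  rewrite (fintype.subset_trans (finset.subsetIl _ _) sD)/= -sp.
  exact: subset_leq_card (finset.subsetIl _ _).
apply: ler_sum => A _; rewrite /fiber mulr_sumr.
rewrite [leRHS]big_mkcond/= [leLHS]big_mkcond/=; apply: ler_sum => s _.
case: ifP => [/andP[/andP[/eqP sp sD] /eqP sA]|_]; last first.
  case: ifP => // _; rewrite mulr_ge0 ?sqr_ge0 ?prodr_ge0// => i _; exact: sqr_ge0.
rewrite sD sA eqxx sp leqnn/= -sA -prod_B -prodrXl -big_split/=.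
apply: ler_prod => i _; rewrite sqr_ge0/= -exprMn.
have -> : B i * m i = y i.
  by have [h|h] := leP 1 (y i); rewrite ?mulr1 ?mul1r.
by [].
Qed.

Definition role_set (D0 Dk : {set I}) (rho : option bool) : {set I} :=
  match rho with None => D0 :&: Dk | Some false => D0 | Some true => Dk end.

(** Group the configurations by the set [A] of their points larger than one.
    Within a group only the product over [A] matters for the minimum, and the
    remaining points enter through the sum of their squares, [fiber]. Since
    [fiber >= 1], a minimum of two sums is at most a double sum, and the
    geometric mean of the two weights replaces their minimum. *)
Let pair_bound (D0 Dk : {set I}) :
  Num.min 1 (Num.min
    (x ^- 2 * \sum_(s : {set I} | (#|s| == p) && (s \subset D0)) \prod_(i in s) y i ^+ 2)
    (x ^- 2 * \sum_(s : {set I} | (#|s| == p) && (s \subset Dk)) \prod_(i in s) y i ^+ 2)) <=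
  \sum_(s : {set I} | (s \subset D0) && (#|s| <= p)%N)
    \sum_(s' : {set I} | (s' \subset Dk) && (#|s'| <= p)%N)
      Num.min 1 (x ^- 2 * ((\prod_(i in s) B i) * \prod_(i in s') B i)) *
      ((\prod_(i in s) m i ^+ 2) * \prod_(i in s') m i ^+ 2).
Proof.
have xx0 : 0 <= x ^- 2 by rewrite invr_ge0 exprn_ge0// ltW.
have fiber0 D A : 0 <= fiber D A.
  by apply: sumr_ge0 => s _; rewrite prodr_ge0// => i _; exact: sqr_ge0.
pose a (A : {set I}) := x ^- 2 * (\prod_(i in A) B i) ^+ 2.
have a_ge0 A : 0 <= a A by rewrite mulr_ge0 ?sqr_ge0.
pose g (A A' : {set I}) := Num.min 1 (x ^- 2 * ((\prod_(i in A) B i) * \prod_(i in A') B i)).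
have prodB_ge0 (A : {set I}) : 0 <= \prod_(i in A) B i by rewrite prodr_ge0.
have g_ge0 A A' : 0 <= g A A' by rewrite le_min ler01/= !mulr_ge0.
apply: (@le_trans _ _ (\sum_(A | bigs D0 A) \sum_(A' | bigs Dk A')
    g A A' * (fiber D0 A * fiber Dk A'))).
  set S0 := \sum_(A | bigs D0 A) a A * fiber D0 A.
  set Sk := \sum_(A | bigs Dk A) a A * fiber Dk A.
  apply: (@le_trans _ _ (Num.min 1 (Num.min S0 Sk))).
    rewrite le_min ge_min lexx/= le_min; apply/andP; split.
      by apply: le_trans (square_sum_le D0); rewrite !ge_min lexx orbT.
    by apply: le_trans (square_sum_le Dk); rewrite !ge_min lexx !orbT.
  have Sk0 : 0 <= Sk by apply: sumr_ge0 => A _; rewrite mulr_ge0.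
  rewrite [Num.min S0 _]minC minA.
  apply: le_trans (min_sum_le _ _ _) _ => [|A|].
  - by rewrite le_min ler01.
  - by rewrite mulr_ge0.
  apply: ler_sum => A /and3P[AD AB Ap].
  rewrite -minA minC -minA [Num.min _ 1]minC minC.
  apply: le_trans (min_sum_le _ _ _) _ => [|A'|].
  - by rewrite le_min ler01 mulr_ge0.
  - by rewrite mulr_ge0.
  apply: ler_sum => A' /and3P[A'D A'B A'p].
  have f1 := fiber_ge1 AD AB Ap; have f2 := fiber_ge1 A'D A'B A'p.
  set f := fiber D0 A in f1 *; set f' := fiber Dk A' in f2 *.
  have sq : Num.min (a A) (a A') <= x ^- 2 * ((\prod_(i in A) B i) * \prod_(i in A') B i).
    have := prodB_ge0 A; have := prodB_ge0 A'; rewrite /a.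
    move: (\prod_(i in A) B i) (\prod_(i in A') B i) => u v v0 u0.
    rewrite -minr_pMr// ler_wpM2l//.
    have [uv|vu] := leP u v.
      apply: le_trans (_ : u ^+ 2 <= _); first by rewrite ge_min lexx.
      by rewrite expr2 ler_wpM2l.
    apply: le_trans (_ : v ^+ 2 <= _); first by rewrite ge_min lexx orbT.
    by rewrite expr2 ler_wpM2r// ltW.
  have ff' : 1 <= f * f' by rewrite -[leLHS]mulr1 ler_pM.
  have aA0 := a_ge0 A; have aA'0 := a_ge0 A'.
  apply: (@le_trans _ _ (Num.min 1 (Num.min (a A) (a A')) * (f * f'))).
    rewrite !minr_pMl ?mulr_ge0 ?(le_trans ler01)// !le_min; apply/and3P; split.
    - by rewrite mul1r; apply: le_trans ff'; rewrite !ge_min lexx.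
    - apply: (@le_trans _ _ (a A * f)); first by rewrite !ge_min lexx orbT.
      by rewrite ler_wpM2l// ler_peMr// (le_trans ler01).
    - apply: (@le_trans _ _ (a A' * f')); first by rewrite ge_min lexx orbT.
      by rewrite ler_wpM2l// ler_peMl// (le_trans ler01).
  rewrite ler_wpM2r ?(le_trans ler01)// le_min ge_min lexx/=.
  by apply: le_trans sq; rewrite ge_min lexx orbT.
have sBig (D s : {set I}) : (s \subset D) && (#|s| <= p)%N -> bigs D (s :&: Big).
  move=> /andP[sD sp]; rewrite /bigs finset.subsetIr/=.
  rewrite (fintype.subset_trans (finset.subsetIl _ _) sD)/=.
  exact: leq_trans (subset_leq_card (finset.subsetIl _ _)) sp.
rewrite [leRHS](partition_big (fun s => s :&: Big) (bigs D0))/=; last exact: sBig.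
apply: ler_sum => A _; rewrite /fiber.
under eq_bigr do rewrite mulrCA mulr_suml.
rewrite exchange_big/=; under [leLHS]eq_bigl do rewrite andbA.
apply: ler_sum => s /andP[_ /eqP sA].
rewrite [leRHS](partition_big (fun s => s :&: Big) (bigs Dk))/=; last exact: sBig.
apply: ler_sum => A' _; rewrite mulr_sumr mulr_sumr.
under [leLHS]eq_bigl do rewrite andbA.
apply: ler_sum => s' /andP[_ /eqP s'A'].
by rewrite /g -sA -s'A' -!prod_B mulrCA.
Qed.

Let V n (rho : {ffun 'I_n -> option bool}) (f : {ffun 'I_n -> I}) : R :=
  pattern_weight x rho (fun r => B (f r)) * \prod_r m (f r) ^+ 2.

Let admissible (D0 Dk : {set I}) n (rho : {ffun 'I_n -> option bool}) (f : {ffun 'I_n -> I}) :=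
  (#|[set r | rho r == None]| <= p)%N &&
  (injectiveb f && [forall r, f r \in role_set D0 Dk (rho r)]).

Let pattern_of_pair (D0 Dk s s' : {set I}) n :
  (s \subset D0) && (#|s| <= p)%N -> (s' \subset Dk) && (#|s'| <= p)%N ->
  #|s :|: s'| = n ->
  exists rho : {ffun 'I_n -> option bool}, exists f : {ffun 'I_n -> I},
  [/\ admissible D0 Dk rho f,
    [set f r | r in [set r | rho r != Some true]] = s,
    [set f r | r in [set r | rho r != Some false]] = s' &
    Num.min 1 (x ^- 2 * ((\prod_(i in s) B i) * \prod_(i in s') B i)) *
      ((\prod_(i in s) m i ^+ 2) * \prod_(i in s') m i ^+ 2) <= V rho f].
Proof.
move=> /andP[/fintype.subsetP sD sp] /andP[/fintype.subsetP s'D s'p] <-.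
set U := s :|: s'.
pose role (i : I) : option bool :=
  if i \in s then (if i \in s' then None else Some false) else Some true.
pose f : {ffun 'I_#|U| -> I} := [ffun r => enum_val r].
pose rho : {ffun 'I_#|U| -> option bool} := [ffun r => role (enum_val r)].
have fU r : f r \in U by rewrite ffunE enum_valP.
have fi : injective f by move=> r1 r2; rewrite !ffunE => /enum_val_inj.
have onto i : i \in U -> exists r, f r = i.
  by move=> iU; exists (enum_rank_in iU i); rewrite ffunE enum_rankK_in.
have rhoE r : rho r = role (f r) by rewrite !ffunE.
have fS : [set f r | r in [set r | rho r != Some true]] = s.
  apply/setP => i; apply/imsetP/idP => [[r]|si].
    by rewrite inE rhoE /role => + ->; case: ifP.
  have [|r ri] := onto i; first by rewrite !inE si.
  by exists r; rewrite // inE rhoE ri /role si; case: ifP.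
have fS' : [set f r | r in [set r | rho r != Some false]] = s'.
  apply/setP => i; apply/imsetP/idP => [[r]|si].
    rewrite inE rhoE /role => + ->; have := fU r; rewrite inE.
    by case: ifP => //= _; case: ifP.
  have [|r ri] := onto i; first by rewrite !inE si orbT.
  by exists r; rewrite // inE rhoE ri /role si; case: ifP.
exists rho, f; split => //.
  apply/andP; split.
    rewrite -(card_imset _ fi); apply: leq_trans sp; apply: subset_leq_card.
    apply/fintype.subsetP => i /imsetP[r]; rewrite inE rhoE /role => + ->.
    by case: ifP.
  apply/andP; split; first exact/injectiveP.
  apply/forallP => r; rewrite rhoE /role; have := fU r; rewrite inE.
  case: ifP => [si _|_ /=]; last exact: s'D.
  case: ifP => [s'i|_] /=; last exact: sD.
  by rewrite inE sD ?s'D.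
have prodU (t : {set I}) (F : I -> R) : t \subset U ->
    \prod_(i in t) F i = \prod_r (if f r \in t then F (f r) else 1).
  move=> /fintype.subsetP tU; rewrite (eq_bigl (fun i => (i \in U) && (i \in t))); last first.
    by move=> i; case: (boolP (i \in t)) => [/tU ->|]; rewrite ?andbF.
  rewrite big_mkcondr big_enum_val; apply: eq_bigr => r _.
  by rewrite ffunE.
have sU : s \subset U by exact: finset.subsetUl.
have s'U : s' \subset U by exact: finset.subsetUr.
rewrite !prodU// -!big_split/= /V /pattern_weight.
have inU r : (f r \in s) || (f r \in s') by have := fU r; rewrite inE.
rewrite (eq_bigr (fun r => B (f r) ^+ role_mult (rho r))); last first.
  move=> r _; rewrite rhoE /role /role_mult; have := inU r.
  by case: ifP => _; case: ifP => _ // _; rewrite ?mulr1 ?mul1r ?expr1 ?expr2.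
have W0 : 0 <= Num.min 1 (x ^- 2 * \prod_r B (f r) ^+ role_mult (rho r)).
  rewrite le_min ler01/= mulr_ge0 ?invr_ge0 ?exprn_ge0 ?(ltW x0)//.
  by rewrite prodr_ge0// => r _; rewrite exprn_ge0.
rewrite ler_wpM2l//; apply: ler_prod => r _.
have m2 : 0 <= m (f r) ^+ 2 <= 1 by rewrite sqr_ge0 exprn_ile1.
move: m2 => /andP[m20 m21]; have := inU r.
case: ifP => _; case: ifP => _ // _; rewrite ?mulr1 ?mul1r ?m20 ?lexx//.
by rewrite mulr_ge0//= ler_piMr.
Qed.

(** Encode a pair of configurations by an enumeration of its union together with
    the role of each point. A pair may arise from several encodings, which is
    harmless for an upper bound. *)
Lemma pattern_bound (D0 Dk : {set I}) :
  Num.min 1 (Num.min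
    (x ^- 2 * \sum_(s : {set I} | (#|s| == p) && (s \subset D0)) \prod_(i in s) y i ^+ 2)
    (x ^- 2 * \sum_(s : {set I} | (#|s| == p) && (s \subset Dk)) \prod_(i in s) y i ^+ 2)) <=
  \sum_(n < (2 * p).+1)
    \sum_(rho : {ffun 'I_n -> option bool} | (#|[set r | rho r == None]| <= p)%N)
      \sum_(f : {ffun 'I_n -> I} |
          injectiveb f && [forall r, f r \in role_set D0 Dk (rho r)])
        pattern_weight x rho (fun r => B (f r)) * \prod_r m (f r) ^+ 2.
Proof.
apply: (le_trans (pair_bound D0 Dk)); rewrite pair_big_dep/=.
pose size_of (ss : {set I} * {set I}) : 'I_(2 * p).+1 := inord #|ss.1 :|: ss.2|.
rewrite (partition_big size_of xpredT)//=; apply: ler_sum => n _.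
have V0 (rho : {ffun 'I_n -> option bool}) f : 0 <= V rho f.
  rewrite mulr_ge0 ?prodr_ge0// => [|r _]; last exact: sqr_ge0.
  rewrite le_min ler01/= mulr_ge0 ?invr_ge0 ?exprn_ge0 ?(ltW x0)//.
  by rewrite prodr_ge0// => r _; rewrite exprn_ge0.
rewrite [leRHS]pair_big_dep/=.
pose decode (rf : {ffun 'I_n -> option bool} * {ffun 'I_n -> I}) : {set I} * {set I} :=
  ([set rf.2 r | r in [set r | rf.1 r != Some true]],
   [set rf.2 r | r in [set r | rf.1 r != Some false]]).
rewrite [leRHS](partition_big decode xpredT)//= [leLHS]big_mkcond/=.
apply: ler_sum => -[s s'] _ /=; case: ifP => [/andP[/andP[sD s'D] /eqP szE]|_]; last first.
  by apply: sumr_ge0 => -[rho f] _; exact: V0.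
have szn : #|s :|: s'| = n.
  rewrite -szE /size_of inordK//= ltnS (leq_trans (leq_card_setU _ _))//.
  by rewrite mul2n -addnn leq_add//; [case/andP: sD|case/andP: s'D].
have [rho [f [adm e1 e2 le_V]]] := pattern_of_pair sD s'D szn.
rewrite (bigD1 (rho, f))/=; last by rewrite -/(admissible D0 Dk rho f) adm /decode/= e1 e2 eqxx.
by rewrite ler_wpDr// sumr_ge0// => -[rho' f'] _; exact: V0.
Qed.

End PatternBound.

Local Open Scope classical_set_scope.

(** * Probability of a pattern *)

Lemma measure_le_sum_finType d (T : measurableType d) (R : realType)
    (mu : {measure set T -> \bar R}) (I : finType) (A : set T) (B : I -> set T) :
  measurable A -> (forall i, measurable (B i)) ->
  (forall w, A w -> exists i, B i w) -> (mu A <= \sum_i mu (B i))%E.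
Proof.
move=> mA mB AB.
pose C (j : nat) := if insub j is Some o then B (enum_val (o : 'I_#|I|)) else set0.
have CE (o : 'I_#|I|) : C o = B (enum_val o) by rewrite /C valK.
have -> : (\sum_i mu (B i) = \sum_(o < #|I|) mu (C o))%E.
  under [RHS]eq_bigr do rewrite CE.
  rewrite -(big_enum_val (A := predT) (fun i => mu (B i))).
  by apply: eq_bigl => i.
apply: content_subadditive => //.
  by move=> j _; rewrite /C; case: insubP => // o _ _; exact: mB.
move=> w /AB [i Biw]; rewrite -(bigcup_mkord _ C).
by exists (enum_rank i); rewrite /= ?ltn_ord// CE enum_rankK.
Qed.

Lemma measurable_renewal_event d (T : measurableType d) (dl : T -> nat)
    (inc : nat -> T -> nat) (k : nat) : measurable_fun setT dl ->
  (forall m, measurable_fun setT (inc m)) ->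
  measurable [set w | renewal_set (dl w) (fun m => inc m w) k].
Proof.
move=> mdl minc.
have -> : [set w | renewal_set (dl w) (fun m => inc m w) k] =
    \bigcup_j [set w | renewal_time (dl w) (fun m => inc m w) j = k].
  by apply/seteqP; split=> w [j _ h]; exists j.
apply: bigcup_measurable => j _.
suff /(_ measurableT [set k] I) : measurable_fun setT
  (fun w => renewal_time (dl w) (fun m => inc m w) j) by rewrite setTI.
rewrite /renewal_time; apply: measurable_fun_addn => //.
elim: j => [|j IH].
  by under eq_fun do rewrite big_ord0; exact: measurable_cst.
under eq_fun do rewrite big_ord_recr/=.
exact: measurable_fun_addn.
Qed.

Section PatternProbability.
Context (R : realType) (alpha beta : R) (F : probability nat R).
Context d (T : measurableType d) (P : probability T R).
Variable S : stable_regenerative_sources P alpha F.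
Hypothesis alpha0 : 0 < alpha.
Hypothesis hF : inter_renewal F beta.

Local Notation u := (renewal_seq (ir_pmf F)).

Definition visits (i k : nat) : set T :=
  [set w | renewal_set (delay S i w) (fun m => incr S i m w) k].

Lemma visits0P i w : visits i 0 w <-> delay S i w = 0%N.
Proof.
split=> [[j _]|d0]; last by exists 0%N => //; rewrite /renewal_time d0 big_ord0.
by rewrite /renewal_time => /eqP; rewrite addn_eq0 => /andP[/eqP].
Qed.

Lemma visits_hits i k w : visits i k w ->
  (delay S i w <= k)%N /\ hits S i 0 (k - delay S i w) w.
Proof.
move=> [j _ <-]; rewrite /renewal_time leq_addr addKn; split=> //.
by exists j; apply: eq_bigr => l _; rewrite add0n.
Qed.

Definition role_visits (k : nat) (rho : option bool) (i : nat) : set T :=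
  match rho with
  | None => visits i 0 `&` visits i k
  | Some false => visits i 0
  | Some true => visits i k
  end.

Let ut k : \sum_(d < k.+1) ir_tail F d%:R * u (k - d) = 1.
Proof.
under eq_bigr do rewrite ir_tailE.
by apply: renewal_tail_conv; exact: ir_pmf0 hF.
Qed.

Let u_ge0 k : 0 <= u k. Proof. by apply: renewal_seq_ge0; exact: ir_pmf_ge0. Qed.

Let tail0 : ir_tail F 0%:R = 1.
Proof. by rewrite ir_tailE big_ord1 (ir_pmf0 hF) subr0. Qed.

(** Conditional probability, given the delay [dl], that a renewal process
    visits the times attached to a role. *)
Let role_prob (k : nat) (rho : option bool) (dl : nat) : R :=
  match rho with
  | None => (dl == 0%N)%:R * u k
  | Some false => (dl == 0%N)%:R
  | Some true => u (k - dl)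
  end.

Let role_prob_ge0 k rho dl : 0 <= role_prob k rho dl.
Proof. by case: rho => [[]|] /=; rewrite ?mulr_ge0. Qed.

Let sum_role_prob k rho :
  \sum_(dl < k.+1) ir_tail F dl%:R * role_prob k rho dl =
  if rho is None then u k else 1.
Proof.
have at0 (G : nat -> R) : \sum_(dl < k.+1) ir_tail F dl%:R * ((dl == 0%N :> nat)%:R * G dl) = G 0%N.
  rewrite big_ord_recl tail0 big1 => [|i _]; last by rewrite mul0r mulr0.
  by rewrite addr0 !mul1r.
case: rho => [[]|] /=; [exact: ut| |exact: (at0 (fun=> u k))].
by rewrite -[RHS](at0 (fun=> 1)); apply: eq_bigr => i _; rewrite mulr1.
Qed.

Context (M N k : nat).

Local Notation cell := (bool * 'I_M.+1)%type.

Let cellset (c : cell * 'I_k.+1) : set (R * nat) := dyadic_cell c.1.1 c.1.2 c.2.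

Definition in_dyadic (c : cell) (i : nat) : set T :=
  [set w | dyadic_lo R c.1 c.2 < jump S i w <= dyadic_hi R c.1 c.2].

Let points_in n (f : {ffun 'I_n -> 'I_N}) (c : {ffun 'I_n -> cell * 'I_k.+1}) : set T :=
  \bigcap_(r in [set: 'I_n]) [set w | cellset (c r) (jump S (f r) w, delay S (f r) w)].

Let points_in_event n f c : source_events S (inl tt) (@points_in n f c).
Proof.
rewrite /points_in -[X in \bigcap_(_ in X) _](_ : [set` enum 'I_n] = setT); last first.
  by apply/seteqP; split=> r // _ /=; rewrite mem_enum.
rewrite bigcap_seq; elim/big_ind : _ => [||r _].
- exact: source_eventsT.
- exact: point_events_setI.
- by apply: point_event; exact: measurable_dyadic_cell.
Qed.

Definition role_event n (f : {ffun 'I_n -> 'I_N}) (c : {ffun 'I_n -> cell})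
    (rho : {ffun 'I_n -> option bool}) : set T :=
  \bigcap_(r in [set: 'I_n]) (in_dyadic (c r) (f r) `&` role_visits k (rho r) (f r)).

Lemma measurable_visits i j : measurable (visits i j).
Proof. exact: measurable_renewal_event. Qed.

Lemma measurable_role_event n f c rho : measurable (@role_event n f c rho).
Proof.
apply: fin_bigcap_measurable => // r _; apply: measurableI.
  rewrite (_ : in_dyadic _ _ = jump S (f r) @^-1` `]dyadic_lo R (c r).1 (c r).2, dyadic_hi R (c r).1 (c r).2]).
    by apply: measurable_funPTI.
  by apply/seteqP; split=> w; rewrite /in_dyadic /= in_itv.
case: (rho r) => [[]|] /=; try exact: measurable_visits.
by apply: measurableI; exact: measurable_visits.
Qed.

Let pairc n (c : {ffun 'I_n -> cell}) (dl : {ffun 'I_n -> 'I_k.+1}) :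
  {ffun 'I_n -> cell * 'I_k.+1} := [ffun r => (c r, dl r)].

Let role_event_delay n (f : {ffun 'I_n -> 'I_N}) (c : {ffun 'I_n -> cell})
    (rho : {ffun 'I_n -> option bool}) (dl : {ffun 'I_n -> 'I_k.+1}) : injective f ->
  (P (role_event f c rho `&` \bigcap_(r in [set: 'I_n]) [set w | delay S (f r) w = dl r]) <=
   P (points_in f (pairc c dl)) * (\prod_r role_prob k (rho r) (dl r))%:E)%E.
Proof.
move=> fi; have [/existsP[r /andP[rT r0]]|] :=
  boolP [exists r, (rho r != Some true) && (dl r != 0%N :> nat)].
  rewrite (_ : role_event f c rho `&` _ = set0).
    by rewrite measure0 mule_ge0// lee_fin prodr_ge0// => r' _; exact: role_prob_ge0.
  apply/seteqP; split=> // w [/(_ r I) [_]].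
  move=> h /(_ r I) /= dr; move: r0; rewrite -dr.
  have -> : delay S (f r) w = 0%N.
    by apply/visits0P; move: rT h; case: (rho r) => [[]|] //= _ [].
  by rewrite eqxx.
rewrite negb_exists => /forallP dl0.
pose l := [seq ((f r : nat), 0%N, (k - dl r)%N) | r <- enum 'I_n & rho r != Some false].
have ul : uniq [seq x.1.1 | x <- l].
  rewrite -map_comp map_inj_uniq; first by rewrite filter_uniq// enum_uniq.
  by move=> r1 r2 /= /val_inj/fi.
have := hits_prob_le (inter_renewal_gt0 hF) ul
  (point_event_incr_free (points_in_event f (pairc c dl))) (fun _ _ _ _ => I).
move=> h; apply: le_trans (_ : _ <= P (points_in f (pairc c dl) `&`
    \big[setI/setT]_(x <- l) hits S x.1.1 x.1.2 x.2))%E _.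
  apply: le_measure; rewrite ?inE.
  - apply: measurableI; first exact: measurable_role_event.
    by apply: fin_bigcap_measurable => // r _; exact: (@measurable_funPTI _ _ _ _ (delay S (f r)) [set (dl r : nat)]).
  - apply: measurableI; first exact: source_events_measurable (points_in_event _ _).
    by apply: bigsetI_measurable => x _; exact: measurable_hits.
  move=> w [wE wd]; split.
    move=> r _; have [wr _] := wE r I; have /= dr := wd r I.
    by rewrite /cellset/= ffunE/=; split.
  rewrite -bigcap_seq => x /= /mapP[r]; rewrite mem_filter => /andP[rF _] -> /=.
  have [_ vr] := wE r I; have /= dr := wd r I.
  have : visits (f r) k w.
    by move: rF vr; case: (rho r) => [[]|] //= _ [].
  by move/visits_hits => [_]; rewrite dr.
apply: (le_trans h); rewrite lee_wpmul2l// lee_fin big_map big_filter big_enum_cond/=.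
rewrite big_mkcond/=; apply: ler_prod => r _.
have := dl0 r; rewrite negb_and !negbK.
case: (rho r) => [[]|] //=.
- by rewrite u_ge0 lexx.
- by move=> /eqP ->; rewrite eqxx lexx ler01.
- by move=> /eqP ->; rewrite eqxx mul1r subn0 u_ge0 lexx.
Qed.

(** Split according to the delays. Given them, the renewal processes of distinct
    points are independent, and the sum over the delays of a point is
    [\sum_d tail d * u (k - d) = 1] for a visit at [k], the single term [d = 0]
    for a visit at [0], and [u k] for both. *)
Lemma pattern_prob_le n (c : {ffun 'I_n -> cell}) (rho : {ffun 'I_n -> option bool}) :
  (\sum_(f : {ffun 'I_n -> 'I_N} | injectiveb f) P (role_event f c rho) <=
   (alpha ^+ n * \prod_r dyadic_weight alpha (c r).1 (c r).2 *
    u k ^+ #|finset (fun r => rho r == None)|)%:E)%E.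
Proof.
have w0 c' : 0 <= dyadic_weight alpha (c' : cell).1 c'.2 by exact: dyadic_weight_ge0.
apply: (@le_trans _ _ (\sum_(f : {ffun 'I_n -> 'I_N} | injectiveb f)
   \sum_(dl : {ffun 'I_n -> 'I_k.+1})
     (P (points_in f (pairc c dl)) * (\prod_r role_prob k (rho r) (dl r))%:E))%E).
  apply: lee_sum => f /injectiveP fi.
  apply: (@le_trans _ _ (\sum_(dl : {ffun 'I_n -> 'I_k.+1})
     P (role_event f c rho `&` \bigcap_(r in [set: 'I_n]) [set w | delay S (f r) w = dl r]))%E).
    apply: measure_le_sum_finType.
    - exact: measurable_role_event.
    - move=> dl; apply: measurableI; first exact: measurable_role_event.
      by apply: fin_bigcap_measurable => // r _; exact: (@measurable_funPTI _ _ _ _ (delay S (f r)) [set (dl r : nat)]).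
    - move=> w wE; exists [ffun r => inord (delay S (f r) w)]; split=> // r _ /=.
      rewrite ffunE inordK// ltnS; have [_] := wE r I.
      case: (rho r) => [[]|] /=.
      + by move=> /visits_hits [].
      + by move=> /visits0P ->.
      + by move=> [/visits0P -> _].
  by apply: lee_sum => dl _; exact: role_event_delay.
rewrite exchange_big/=.
apply: (@le_trans _ _ (\sum_(dl : {ffun 'I_n -> 'I_k.+1})
   (\prod_r (alpha * dyadic_weight alpha (c r).1 (c r).2 *
      (ir_tail F (dl r)%:R * role_prob k (rho r) (dl r))))%:E)%E).
  apply: lee_sum => dl _.
  rewrite -ge0_sume_distrl//.
  apply: le_trans (lee_wpmul2r _ _) _.
  - by rewrite lee_fin prodr_ge0// => r _; exact: role_prob_ge0.
  - apply: (sum_distinct_points_le (points_ppp S)) => //.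
    + by move=> i; exact/measurable_fun_pair.
    + by move=> c'; exact: measurable_dyadic_cell.
    + move=> c'; have := stable_intensity_dyadic_bounds F alpha0 c'.1.1 c'.1.2 c'.2.
      move=> /andP[h1 h2]; rewrite (le_lt_trans h2) ?ltry// andbT (le_trans _ h1)//.
      by rewrite lee_fin !mulr_ge0 ?powR_ge0 ?ir_tail_ge0 ?dyadic_weight_ge0 ?(ltW alpha0).
    + move=> [[b1 j1] k1] [[b2 j2] k2] z /= z1 z2.
      by have [-> /val_inj-> /val_inj->] := dyadic_disjoint z1 z2.
  - rewrite -EFinM lee_fin -big_split/=; apply: ler_prod => r _.
    rewrite ffunE/= /cellset/=.
    have := stable_intensity_dyadic_bounds F alpha0 (c r).1 (c r).2 (dl r).
    set I := stable_intensity _ _ _ => /andP[h1 h2].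
    have h0 : (0 <= I)%E.
      apply: le_trans h1; rewrite lee_fin !mulr_ge0 ?powR_ge0 ?ir_tail_ge0 ?(ltW alpha0)//.
    have Ifin : I \is a fin_num by rewrite ge0_fin_numE// (le_lt_trans h2) ?ltry.
    rewrite mulr_ge0 ?fine_ge0 ?role_prob_ge0//= mulrA ler_wpM2r ?role_prob_ge0//.
    by rewrite -lee_fin fineK.
rewrite sumEFin lee_fin.
rewrite -(bigA_distr_bigA (fun r (x : 'I_k.+1) => alpha * dyadic_weight alpha (c r).1 (c r).2 *
  (ir_tail F x%:R * role_prob k (rho r) x))).
apply: eq_lew.
rewrite (eq_bigr (fun r => alpha * dyadic_weight alpha (c r).1 (c r).2 *
   (if rho r == None then u k else 1))); last first.
  move=> r _; rewrite -mulr_sumr sum_role_prob; congr (_ * _).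
  by case: (rho r).
rewrite !big_split/= prodr_const card_ord -big_mkcond/= prodr_const.
by congr (_ * _ ^+ _); apply: eq_card => r; rewrite inE.
Qed.

End PatternProbability.

(** * Conditioning on everything but the signs *)

Lemma measurable_big_sum d (T : measurableType d) (R : realType) (I : Type) (r : seq I)
    (F : I -> T -> R) : (forall i, measurable_fun setT (F i)) ->
  measurable_fun setT (fun w => \sum_(i <- r) F i w).
Proof.
move=> mF; elim: r => [|i r IH].
  by under eq_fun do rewrite big_nil; exact: measurable_cst.
by under eq_fun do rewrite big_cons; exact: measurable_funD.
Qed.

Lemma measurable_big_prod d (T : measurableType d) (R : realType) (I : Type) (r : seq I)
    (F : I -> T -> R) : (forall i, measurable_fun setT (F i)) ->
  measurable_fun setT (fun w => \prod_(i <- r) F i w).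
Proof.
move=> mF; elim: r => [|i r IH].
  by under eq_fun do rewrite big_nil; exact: measurable_cst.
by under eq_fun do rewrite big_cons; exact: measurable_funM.
Qed.

Lemma measurable_norm_gt (R : realType) (x : R) : measurable [set z : R | x < `|z|].
Proof.
have mn : measurable_fun setT (fun z : R => `|z|) by exact: normr_measurable.
have := mn measurableT `]x, +oo[%classic (measurable_itv _); rewrite setTI.
rewrite (_ : _ @^-1` _ = [set z | x < `|z|])//.
by apply/seteqP; split=> z /=; rewrite in_itv/= andbT.
Qed.

Section SignIndependence.
Context (R : realType) (alpha : R) (F : probability nat R).
Context d (T : measurableType d) (P : probability T R).
Variable S : stable_regenerative_sources P alpha F.
Variable N : nat.

Let sign_keys : seq source_index := [seq inr (inr i) | i <- iota 0 N].

Definition unsigned_gen : set (set T) :=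
  \bigcup_(j in [set j | j \notin sign_keys]) source_events S j.

(** Conditioning on this sigma-algebra leaves only the first [N] signs random. *)
Definition unsigned : set (set T) := <<s unsigned_gen >>.

Definition sign_event (e : {ffun 'I_N -> bool}) : set T :=
  \bigcap_(i in [set: 'I_N]) [set w | sign S i w = sgn R (e i)].

Lemma measurable_sign_event e : measurable (sign_event e).
Proof.
apply: fin_bigcap_measurable => // i _.
exact: (@measurable_funPTI _ _ _ _ (sign S i) [set sgn R (e i)]).
Qed.

Lemma unsigned_measurable A : unsigned A -> measurable A.
Proof.
apply: smallest_sub; first exact: sigma_algebra_measurable.
by move=> B [j _]; exact: source_events_measurable.
Qed.

Lemma sign_prob i b : P [set w | sign S i w = sgn R b] = (2^-1)%:E.
Proof. by have [h1 h2] := sign_law S i; case: b; rewrite /sgn ?expr1 ?expr0. Qed.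

Lemma sign_event_indep A e : unsigned A ->
  P (A `&` sign_event e) = (P A * (2^-1 ^+ N)%:E)%E.
Proof.
move=> hA.
pose e' (i : nat) : bool := if insub i is Some o then e (o : 'I_N) else true.
pose E (j : source_index) : set T :=
  if j is inr (inr i) then [set w | sign S i w = sgn R (e' i)] else setT.
have GE j : source_events S j (E j).
  case: j => [u|[im|i]] /=.
  - exact: (source_eventsT S (inl u)).
  - exact: (source_eventsT S (inr (inl im))).
  - exact: (@sigma_of_preimage _ _ _ _ (sign S i) [set sgn R (e' i)]).
have uk : uniq sign_keys by rewrite map_inj_uniq ?iota_uniq// => x y [].
have EE : \bigcap_(j in [set` sign_keys]) E j = sign_event e.
  apply/seteqP; split=> w h.
    move=> i _; have /= := h (inr (inr (i : nat))); rewrite /e' valK; apply.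
    by apply/mapP; exists (i : nat); rewrite // mem_iota add0n ltn_ord.
  move=> j /= /mapP[i]; rewrite mem_iota add0n => iN -> /=.
  have := h (Ordinal iN) I; rewrite /= /e'; case: insubP => [ o _ oi|]; last by case/negP.
  by have -> : o = Ordinal iN by apply: val_inj.
have h1 := mutually_independent_block (@source_events_indep _ _ _ _ _ _ S) (source_eventsT S)
  (@source_events_setI _ _ _ _ _ _ S) (@source_events_measurable _ _ _ _ _ _ S) uk GE hA.
rewrite -EE h1; congr (_ * _)%E.
rewrite (mutually_independent_seq (@source_events_indep _ _ _ _ _ _ S) uk GE); congr (_%:E).
rewrite big_map (eq_bigr (fun=> 2^-1)); last by move=> i _; rewrite sign_prob.
by rewrite big_const_seq count_predT size_iota iter_mulr_1.
Qed.

Lemma unsignedT : unsigned setT.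
Proof. by apply: sub_sigma_algebra; exists (inl tt); [apply/mapP => -[]|exact: source_eventsT]. Qed.

Lemma sign_event_disjoint e e' w : sign_event e w -> sign_event e' w -> e = e'.
Proof.
move=> h h'; apply/ffunP => i; have /= := h i I; rewrite (h' i I).
by move/esym/signr_inj.
Qed.

(** Up to the null set where some sign is not [1] or [-1], an event that for
    each sign vector [e] is some unsigned event [A e]. *)
Definition signed_event (A : {ffun 'I_N -> bool} -> set T) : set T :=
  \big[setU/set0]_e (A e `&` sign_event e).

Lemma signed_event_prob A : (forall e, unsigned (A e)) ->
  P (signed_event A) = ((2^-1 ^+ N)%:E * \sum_e P (A e))%E.
Proof.
move=> hA; pose I := {ffun 'I_N -> bool}.
have -> : signed_event A =
    \big[setU/set0]_(o < #|I|) (A (enum_val o) `&` sign_event (enum_val o)).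
  rewrite /signed_event -(big_enum_val (A := predT) (fun e => A e `&` sign_event e)).
  by apply: eq_bigl => e.
rewrite measure_bigsetU_ord/=; last first.
- move=> o1 o2 _ _ [w [[_ w1] [_ w2]]].
  by apply: enum_val_inj; exact: sign_event_disjoint w1 w2.
- move=> o; apply: measurableI; last exact: measurable_sign_event.
  exact: unsigned_measurable.
rewrite -(big_enum_val (A := predT) (fun e => P (A e `&` sign_event e))).
rewrite ge0_sume_distrr// [RHS]big_mkcond/= [LHS]big_mkcond/=; apply: eq_bigr => e _.
by rewrite sign_event_indep// muleC.
Qed.

Lemma signed_event_measurable A : (forall e, unsigned (A e)) -> measurable (signed_event A).
Proof.
move=> hA; apply: bigsetU_measurable => e _.
by apply: measurableI; [exact: unsigned_measurable|exact: measurable_sign_event].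
Qed.

Lemma signed_eventP A w : signed_event A w <-> exists e, A e w /\ sign_event e w.
Proof.
rewrite /signed_event; split=> [|[e [Ae se]]].
  elim/big_ind : _ => //; first by move=> X Y IX IY [/IX|/IY].
  by move=> e _ []; exists e.
by rewrite (bigD1 e)//=; left.
Qed.

(** Almost surely the signs form a sign vector, on which a partial sum is a chaos. *)
Lemma sign_event_cover : P (~` signed_event (fun=> setT)) = 0%E.
Proof.
rewrite probability_setC; last by apply: signed_event_measurable => e; exact: unsignedT.
rewrite signed_event_prob => [|e]; last exact: unsignedT.
rewrite probability_setT sumEFin sumr_const card_ffun card_bool card_ord -EFinM.
have -> : 2^-1 ^+ N * (1 *+ 2 ^ N) = 1 :> R by rewrite natrX -exprMn mulVf ?expr1n.
by rewrite subee.
Qed.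

Local Notation BT := (g_sigma_algebraType unsigned_gen).

Lemma unsigned_source j : j \notin sign_keys -> source_events S j `<=` unsigned.
Proof. by move=> hj A hA; apply: sub_sigma_algebra; exists j. Qed.

Let point_key : (inl tt : source_index) \notin sign_keys.
Proof. by apply/mapP => -[]. Qed.

Let incr_key i m : (inr (inl (i, m)) : source_index) \notin sign_keys.
Proof. by apply/mapP => -[]. Qed.

Lemma unsigned_jump i : measurable_fun setT (jump S i : BT -> R).
Proof.
move=> _ Y mY; rewrite setTI; apply: (unsigned_source point_key).
rewrite (_ : _ @^-1` Y = [set w | (Y `*` setT) (jump S i w, delay S i w)]).
  by apply: point_event; exact: measurableX.
by apply/seteqP; split=> w //= -[].
Qed.

Lemma unsigned_delay i : measurable_fun setT (delay S i : BT -> nat).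
Proof.
move=> _ Y mY; rewrite setTI; apply: (unsigned_source point_key).
rewrite (_ : _ @^-1` Y = [set w | (setT `*` Y) (jump S i w, delay S i w)]).
  by apply: point_event; exact: measurableX.
by apply/seteqP; split=> w //= -[].
Qed.

Lemma unsigned_incr i m : measurable_fun setT (incr S i m : BT -> nat).
Proof.
move=> _ Y mY; rewrite setTI; apply: (unsigned_source (incr_key i m)).
exact: (@sigma_of_preimage _ _ _ _ (incr S i m) Y).
Qed.

Lemma unsigned_visits i k : unsigned (visits S i k).
Proof.
apply: (@measurable_renewal_event _ BT (delay S i) (incr S i) k).
- exact: unsigned_delay.
- exact: unsigned_incr.
Qed.

Definition visitors (k : nat) (w : T) : {set 'I_N} :=
  finset (fun i : 'I_N => `[< visits S i k w >]).

Context (n : nat) (s : 'I_n -> {set 'I_N}).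

Lemma unsigned_chaos k e : measurable_fun setT
  ((fun w => chaos s (fun i => jump S i w) (visitors k w) e) : BT -> R).
Proof.
rewrite /chaos; under eq_fun do rewrite big_mkcond/=.
apply: measurable_big_sum => m; apply: measurable_fun_if => //.
- apply: (@measurable_fun_bool _ _ _ _ true); rewrite setTI.
  rewrite (_ : _ @^-1` _ = \bigcap_(i in [set` enum (s m)]) (visits S i k : set BT)).
    by apply: fin_bigcap_measurable => // i _; exact: unsigned_visits.
  apply/seteqP; split=> w /=.
    by move=> /fintype.subsetP h i /=; rewrite mem_enum => /h; rewrite inE => /asboolP.
  move=> h; apply/fintype.subsetP => i im; rewrite inE; apply/asboolP.
  by apply: h; rewrite /= mem_enum.
- apply: measurable_funTS; under eq_fun do rewrite big_mkcond/=.
  apply: measurable_big_prod => i; case: (i \in s m); last exact: measurable_cst.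
  by apply: measurable_funM; [exact: measurable_cst|exact: unsigned_jump].
Qed.

Definition partial_sum (k : nat) (w : T) : R :=
  \sum_(m | s m \subset visitors k w) \prod_(i in s m) (sign S i w * jump S i w).

Lemma partial_sum_chaos k e w : sign_event e w ->
  partial_sum k w = chaos s (fun i => jump S i w) (visitors k w) e.
Proof.
move=> we; apply: eq_bigr => m _; apply: eq_bigr => i _.
by have /= -> := we i I.
Qed.

End SignIndependence.

(** * Joint exceedance of a partial sum *)

Section ExpectationBounds.
Context d (T : measurableType d) (R : realType) (P : probability T R).

Definition expect_le (h : T -> R) (v : R) :=
  [/\ measurable_fun setT h, forall w, 0 <= h w & (\int[P]_w (h w)%:E <= v%:E)%E].

Lemma expect_le_indic (a v : R) (A : set T) : 0 <= a -> measurable A ->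
  (P A <= v%:E)%E -> expect_le (fun w => a * \1_A w) (a * v).
Proof.
move=> a0 mA PAv; split.
- by apply: measurable_funM; [exact: measurable_cst|exact: measurable_indic].
- by move=> w; rewrite mulr_ge0.
- under eq_integral do rewrite EFinM.
  rewrite ge0_integralZl//; last by apply/measurable_EFinP; exact: measurable_indic.
  by rewrite integral_indic// setIT EFinM lee_wpmul2l.
Qed.

Lemma expect_le_sum (I : finType) (Q : pred I) (h : I -> T -> R) (v : I -> R) :
  (forall i, Q i -> expect_le (h i) (v i)) ->
  expect_le (fun w => \sum_(i | Q i) h i w) (\sum_(i | Q i) v i).
Proof.
move=> H; have -> : (fun w => \sum_(i | Q i) h i w) =
    (fun w => \sum_(i <- [seq i <- index_enum I | Q i]) h i w).
  by apply/funext => w; rewrite big_filter.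
rewrite -[\sum_(i | Q i) v i]big_filter.
have : forall i, i \in [seq i <- index_enum I | Q i] -> expect_le (h i) (v i).
  by move=> i; rewrite mem_filter => /andP[/H].
elim: [seq i <- index_enum I | Q i] => [|i r IH] Hr.
  split.
  - by under eq_fun do rewrite big_nil; exact: measurable_cst.
  - by move=> w; rewrite big_nil.
  - by under eq_integral do rewrite big_nil; rewrite integral0 big_nil.
have [m1 p1 i1] := Hr i (mem_head _ _).
have [m2 p2 i2] : expect_le (fun w => \sum_(i <- r) h i w) (\sum_(i <- r) v i).
  by apply: IH => j jr; apply: Hr; rewrite inE jr orbT.
split.
- by under eq_fun do rewrite big_cons; exact: measurable_funD.
- by move=> w; rewrite big_cons addr_ge0.
- under eq_integral do rewrite big_cons EFinD.
  rewrite ge0_integralD//; try exact/measurable_EFinP; try by move=> w _; rewrite lee_fin.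
  by rewrite big_cons EFinD leeD.
Qed.

Lemma expect_leD h1 v1 h2 v2 : expect_le h1 v1 -> expect_le h2 v2 ->
  expect_le (fun w => h1 w + h2 w) (v1 + v2).
Proof.
move=> [m1 p1 i1] [m2 p2 i2]; split.
- exact: measurable_funD.
- by move=> w; rewrite addr_ge0.
- under eq_integral do rewrite EFinD.
  rewrite ge0_integralD//; try exact/measurable_EFinP; try by move=> w _; rewrite lee_fin.
  by rewrite EFinD leeD.
Qed.

Lemma expect_le_trans h v v' : v <= v' -> expect_le h v -> expect_le h v'.
Proof. by move=> vv' [? ? h1]; split=> //; rewrite (le_trans h1)// lee_fin. Qed.

(** The inequality is checked inside the integral, where the sum of the
    indicators counts the events that occur. *)
Lemma sum_prob_le_expect (I : finType) (a : R) (A : I -> set T) h v :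
  0 <= a -> (forall i, measurable (A i)) -> expect_le h v ->
  (forall w, a * #|finset (fun i => `[< A i w >])|%:R <= h w) ->
  (a%:E * \sum_i P (A i) <= v%:E)%E.
Proof.
move=> a0 mA [mh ph ih] ah.
have -> : (a%:E * \sum_i P (A i) = \int[P]_w (\sum_i a * \1_(A i) w)%:E)%E.
  under eq_integral do rewrite -sumEFin.
  rewrite ge0_integral_sum//; last 2 first.
  - move=> i; apply/measurable_EFinP.
    by apply: measurable_funM; [exact: measurable_cst|exact: measurable_indic].
  - by move=> i w _; rewrite lee_fin mulr_ge0.
  rewrite ge0_sume_distrr//; apply: eq_bigr => i _.
  under eq_integral do rewrite EFinM.
  rewrite ge0_integralZl//; last by apply/measurable_EFinP; exact: measurable_indic.
  by rewrite integral_indic// setIT.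
apply: le_trans ih; apply: ge0_le_integral => //.
- by move=> w _; rewrite lee_fin sumr_ge0// => i _; rewrite mulr_ge0.
- apply/measurable_EFinP; apply: measurable_big_sum => i.
  by apply: measurable_funM; [exact: measurable_cst|exact: measurable_indic].
- exact/measurable_EFinP.
- move=> w _; rewrite lee_fin; apply: le_trans (ah w).
  rewrite -mulr_sumr ler_wpM2l// -sum1_card natr_sum [leRHS]big_mkcond/=.
  apply: ler_sum => i _; rewrite inE indicE.
  by case: ifPn => /asboolP hA; [rewrite mem_set|rewrite memNset].
Qed.

End ExpectationBounds.

Lemma dyadic_cover (R : realType) (y : R) : 0 < y ->
  exists b j, dyadic_lo R b j < y <= dyadic_hi R b j.
Proof.
move=> y0; have two1 : 1 < 2 :> R by rewrite ltr1n.
have [y1|y1] := ltP 1 y.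
  have ex : exists j, y <= 2 ^+ j.+1.
    have [J [yJ _]] := first_power_above y two1; exists J.
    by rewrite (le_trans (ltW yJ))// exprS ler_peMl// ?exprn_ge0// ltW.
  exists false, (ex_minn ex); rewrite /dyadic_hi /= -exprS.
  case: ex_minnP => j -> minj; rewrite andbT.
  case: j minj => [|j] minj; first by rewrite expr0.
  by rewrite ltNge; apply/negP => /minj; rewrite ltnn.
have ex : exists j, 2^-1 ^+ j.+1 < y.
  have [J [yJ _]] := first_power_above y^-1 two1; exists J.
  rewrite -[ltRHS]invrK exprVn ltf_pV2 ?posrE ?invr_gt0 ?exprn_gt0//.
  by rewrite (lt_le_trans yJ)// exprS ler_peMl// ?exprn_ge0// ltW.
exists true, (ex_minn ex); rewrite /dyadic_hi /=.
case: ex_minnP => j -> minj; rewrite exprS mulrA mulfV// mul1r /=.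
case: j minj => [|j] minj; first by rewrite expr0.
by rewrite leNgt; apply/negP => /minj; rewrite ltnn.
Qed.

Section FiniteStage.
Context (R : realType) (alpha beta : R) (F : probability nat R).
Context d (T : measurableType d) (P : probability T R).
Variable S : stable_regenerative_sources P alpha F.
Hypothesis alpha02 : 0 < alpha < 2.
Hypothesis hF : inter_renewal F beta.
Variable p : nat.

Local Notation u := (renewal_seq (ir_pmf F)).

Let alpha0 : 0 < alpha. Proof. by case/andP: alpha02. Qed.

(** Only finitely many cells can be summed over, so the event that a point lies
    outside of them is treated apart. *)
Definition escaping (N M : nat) : set T :=
  [set w | exists i : 'I_N, forall c : bool * 'I_M.+1, ~ in_dyadic S c i w].

Let measurable_in_dyadic M (c : bool * 'I_M.+1) i : measurable (in_dyadic S c i).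
Proof.
rewrite (_ : in_dyadic _ _ _ = jump S i @^-1` `]dyadic_lo R c.1 c.2, dyadic_hi R c.1 c.2]).
  exact: measurable_funPTI.
by apply/seteqP; split=> w; rewrite /in_dyadic /= in_itv.
Qed.

Lemma measurable_escaping N M : measurable (escaping N M).
Proof.
rewrite (_ : escaping N M = \bigcup_(i in [set: 'I_N])
   \bigcap_(c in [set: bool * 'I_M.+1]) ~` in_dyadic S c i).
  apply: fin_bigcup_measurable => // i _; apply: fin_bigcap_measurable => // c _.
  exact: measurableC.
by apply/seteqP; split=> w [i] => [h|_ h]; exists i => // c; [move=> _|]; exact: h.
Qed.

Lemma escaping_small N (e : R) : 0 < e -> exists M, (P (escaping N M) <= e%:E)%E.
Proof.
move=> e0.
have cv : P \o escaping N @ \oo --> P (\bigcap_M escaping N M).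
  apply: nonincreasing_cvg_mu.
  - by rewrite (le_lt_trans (probability_le1 _ _)) ?ltry//; exact: measurable_escaping.
  - exact: measurable_escaping.
  - by apply: bigcapT_measurable => M; exact: measurable_escaping.
  - move=> M M' MM'; apply/subsetPset => w [i hi]; exists i => -[b j].
    exact: (hi (b, widen_ord (_ : (M.+1 <= M'.+1)%N) j)).
have emp : \bigcap_M escaping N M = set0.
  apply/seteqP; split=> // w h.
  have ex (i : 'I_N) : exists bj : bool * nat,
      dyadic_lo R bj.1 bj.2 < jump S i w <= dyadic_hi R bj.1 bj.2.
    by have [b [j h']] := dyadic_cover (jump_gt0 S i w); exists (b, j).
  pose M := \max_(i < N) (xchoose (ex i)).2.
  have [i hi] := h M I; apply: (hi ((xchoose (ex i)).1, inord (xchoose (ex i)).2)).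
  rewrite /in_dyadic/= inordK; first exact: (xchooseP (ex i)).
  by rewrite ltnS (leq_bigmax i).
rewrite emp measure0 in cv.
have /fine_cvgP[_ /cvgrPdist_lt/(_ e e0) [M _ /(_ M (leqnn M))]] := cv.
rewrite sub0r normrN /= => h; exists M.
rewrite -[P _]fineK ?fin_num_measure//; last exact: measurable_escaping.
by rewrite lee_fin (le_trans (ler_norm _))// ltW.
Qed.

Definition joint_exceedance N n (s : 'I_n -> {set 'I_N}) (k : nat) (x : R)
    (e : {ffun 'I_N -> bool}) : set T :=
  [set w | x < `|chaos s (fun i => jump S i w) (visitors S N 0 w) e| /\
           x < `|chaos s (fun i => jump S i w) (visitors S N k w) e|].

Lemma unsigned_exceedance N n (s : 'I_n -> {set 'I_N}) (k : nat) (x : R) e :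
  unsigned S N [set w | x < `|chaos s (fun i => jump S i w) (visitors S N k w) e|].
Proof.
pose g : g_sigma_algebraType (unsigned_gen S N) -> R :=
  fun w => `|chaos s (fun i => jump S i w) (visitors S N k w) e|.
have mg : measurable_fun setT g.
  by apply: measurableT_comp => //; exact: unsigned_chaos.
have := mg measurableT `]x, +oo[%classic (measurable_itv _); rewrite setTI.
rewrite (_ : g @^-1` _ = [set w | x < g w])//.
by apply/seteqP; split=> w /=; rewrite in_itv/= andbT.
Qed.

Lemma unsigned_joint_exceedance N n (s : 'I_n -> {set 'I_N}) (k : nat) (x : R) e :
  unsigned S N (joint_exceedance s k x e).
Proof.
have h0 := unsigned_exceedance s 0 x e; have hk := unsigned_exceedance s k x e.
exact: (@measurableI _ (g_sigma_algebraType (unsigned_gen S N)) _ _ h0 hk).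
Qed.

Let square_sum_injective N n (s : 'I_n -> {set 'I_N}) (y : 'I_N -> R) (D : {set 'I_N}) :
  injective s -> (forall m, #|s m| = p) ->
  \sum_(m | s m \subset D) \prod_(i in s m) y i ^+ 2 <=
  \sum_(A : {set 'I_N} | (#|A| == p) && (A \subset D)) \prod_(i in A) y i ^+ 2.
Proof.
move=> s_inj s_card.
rewrite -(@big_imset _ _ _ _ _ s _ (fun A : {set 'I_N} => \prod_(i in A) y i ^+ 2))/=; last first.
  by move=> m m' _ _; exact: s_inj.
rewrite [leRHS]big_mkcond/= [leLHS]big_mkcond/=; apply: ler_sum => A _.
have A0 : 0 <= \prod_(i in A) y i ^+ 2 by rewrite prodr_ge0// => i _; exact: sqr_ge0.
case: ifP => [/imsetP[m mD ->]|_]; last by case: ifP.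
by rewrite s_card eqxx/= ifT.
Qed.

Let sign_average_le N n (s : 'I_n -> {set 'I_N}) (k : nat) (x : R) w :
  injective s -> (forall m, #|s m| = p) -> 0 < x ->
  2^-1 ^+ N * #|finset (fun e => `[< joint_exceedance s k x e w >])|%:R <=
  Num.min 1 (Num.min
    (x ^- 2 * \sum_(A : {set 'I_N} | (#|A| == p) && (A \subset visitors S N 0 w))
                \prod_(i in A) jump S i w ^+ 2)
    (x ^- 2 * \sum_(A : {set 'I_N} | (#|A| == p) && (A \subset visitors S N k w))
                \prod_(i in A) jump S i w ^+ 2)).
Proof.
move=> s_inj s_card x0; set Z := finset _.
have twoN : 0 < 2 ^+ N :> R by rewrite exprn_gt0.
have key (D : {set 'I_N}) (Y : {set {ffun 'I_N -> bool}}) :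
    Z \subset Y -> Y = finset (fun e => x < `|chaos s (fun i => jump S i w) D e|) ->
    2^-1 ^+ N * #|Z|%:R <= x ^- 2 * \sum_(A : {set 'I_N} | (#|A| == p) && (A \subset D))
                \prod_(i in A) jump S i w ^+ 2.
  move=> ZY YE; apply: le_trans (ler_wpM2l _ (square_sum_injective _ _ s_inj s_card)); last first.
    by rewrite invr_ge0 exprn_ge0// ltW.
  have := chaos_tail_le s_inj s_card (fun i => jump S i w) D x0; rewrite card_ord => h.
  rewrite exprVn ler_pdivrMl// mulrCA ler_pdivlMl ?exprn_gt0// mulrC.
  apply: le_trans h; rewrite ler_wpM2r ?exprn_ge0 ?(ltW x0)// ler_nat -YE.
  exact: subset_leq_card.
rewrite !le_min; apply/and3P; split.
- rewrite exprVn ler_pdivrMl// mulr1 -natrX ler_nat.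
  by apply: leq_trans (max_card _) _; rewrite card_ffun card_bool card_ord.
- apply: key (erefl _); apply/fintype.subsetP => e.
  by rewrite /Z !inE => -[].
- apply: key (erefl _); apply/fintype.subsetP => e.
  by rewrite /Z !inE => -[].
Qed.

Let cell_weight M n (x : R) (rho : {ffun 'I_n -> option bool})
    (c : {ffun 'I_n -> bool * 'I_M.+1}) : R :=
  pattern_weight x rho (fun r => dyadic_big R (cell_val (c r))) *
  \prod_r dyadic_small R (cell_val (c r)) ^+ 2.

Let cell_weight_ge0 M n x rho c : 0 < x -> 0 <= @cell_weight M n x rho c.
Proof.
move=> x0; rewrite mulr_ge0//; last by rewrite prodr_ge0// => r _; exact: sqr_ge0.
rewrite le_min ler01/= mulr_ge0 ?invr_ge0 ?exprn_ge0 ?(ltW x0)//.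
rewrite prodr_ge0// => r _; rewrite exprn_ge0// (le_trans ler01)//.
exact: dyadic_big_ge1.
Qed.

(** Each jump is at most the upper end of its dyadic interval, and the weights are
    nondecreasing in the jumps. *)
Let pattern_le_cells N M n (x : R) (rho : {ffun 'I_n -> option bool}) k
    (f : {ffun 'I_n -> 'I_N}) w : 0 < x -> ~ escaping N M w ->
  [forall r, f r \in role_set (visitors S N 0 w) (visitors S N k w) (rho r)] ->
  pattern_weight x rho (fun r => Num.max 1 (jump S (f r) w)) *
    \prod_r Num.min 1 (jump S (f r) w) ^+ 2 <=
  \sum_(c : {ffun 'I_n -> bool * 'I_M.+1})
     cell_weight x rho c * \1_(role_event S k f c rho) w.
Proof.
move=> x0 nesc /forallP marks.
have ex (i : 'I_N) : exists c : bool * 'I_M.+1, in_dyadic S c i w.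
  by apply: contrapT => h; apply: nesc; exists i => c hc; apply: h; exists c.
have [cc hcc] := choice ex.
pose c : {ffun 'I_n -> bool * 'I_M.+1} := [ffun r => cc (f r)].
have cE : role_event S k f c rho w.
  move=> r _; split; first by rewrite ffunE; exact: hcc.
  have := marks r; case: (rho r) => [[]|] /=; rewrite ?inE.
  - by [].
  - by [].
  - by move=> /andP[/asboolP ? /asboolP].
rewrite (bigD1 c)//= indicE mem_set// mulr1.
apply: ler_wpDr; first by apply: sumr_ge0 => c' _; rewrite mulr_ge0// cell_weight_ge0.
have jle r : jump S (f r) w <= dyadic_hi R (c r).1 (c r).2.
  by rewrite ffunE; have /andP[] := hcc (f r).
have j0 r : 0 <= jump S (f r) w by rewrite ltW// jump_gt0.
have big_le r : Num.max 1 (jump S (f r) w) <= dyadic_big R (cell_val (c r)).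
  by rewrite ge_max /dyadic_big !le_max lexx/= jle orbT.
have small_le r : Num.min 1 (jump S (f r) w) <= dyadic_small R (cell_val (c r)).
  by rewrite le_min /dyadic_small !ge_min lexx/= jle orbT.
have xx0 : 0 <= x ^- 2 by rewrite invr_ge0 exprn_ge0// ltW.
apply: ler_pM.
- rewrite le_min ler01/= mulr_ge0// prodr_ge0// => r _.
  by rewrite exprn_ge0// le_max ler01.
- by rewrite prodr_ge0// => r _; exact: sqr_ge0.
- rewrite /pattern_weight le_min ge_min lexx/= ge_min ler_wpM2l ?orbT//.
  apply: ler_prod => r _; rewrite exprn_ge0 ?le_max ?ler01//=.
  have b0 : 0 <= Num.max 1 (jump S (f r) w) by rewrite le_max ler01.
  by rewrite lerXn2r ?nnegrE ?(le_trans b0 (big_le r)) ?big_le.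
- apply: ler_prod => r _; rewrite sqr_ge0/=.
  have b0 : 0 <= Num.min 1 (jump S (f r) w) by rewrite le_min ler01 j0.
  by rewrite lerXn2r ?nnegrE ?(le_trans b0 (small_le r)) ?small_le.
Qed.

Let measurable_role N M k n (f : {ffun 'I_n -> 'I_N}) (c : {ffun 'I_n -> bool * 'I_M.+1})
    (rho : {ffun 'I_n -> option bool}) : measurable (role_event S k f c rho) :=
  measurable_role_event S k f c rho.

(** The number of points [N] and of terms [n] may be arbitrary because the
    bound comes from expected numbers of patterns. Escaping points prevent the
    use of finitely many cells only on an event of arbitrarily small
    probability. *)
Lemma finite_stage_upper : exists2 C : R, 0 <= C &
  forall N n (s : 'I_n -> {set 'I_N}) k x, injective s -> (forall m, #|s m| = p) ->
  1 <= x -> (P (signed_event S (joint_exceedance s k x)) <=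
    (C * (x `^ (- alpha) * (u k ^+ p * (1 + ln x) ^+ p.-1 + (1 + ln x) ^+ p.-2)))%:E)%E.
Proof.
(* the constants for patterns of different sizes are added up *)
pose Q n' (C : R) := 0 <= C /\
    forall (rho : {ffun 'I_n' -> option bool}) (x : R) M, 1 <= x ->
      \sum_(c : {ffun 'I_n' -> bool * 'I_M.+1})
        pattern_weight x rho (fun r => dyadic_big R (cell_val (c r))) *
        \prod_r dyadic_mass alpha (cell_val (c r)) <=
      C * (x `^ (- alpha) * (1 + ln x) ^+ #|finset (fun r => rho r == None)|.-1).
have exQ n' : exists C, Q n' C.
  by have [C C0 hC] := pattern_sum_le alpha02 n'; exists C.
have [Cf hCf] := choice exQ.
pose C := \sum_(n' < (2 * p).+1) \sum_(rho : {ffun 'I_n' -> option bool} |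
  (#|finset (fun r => rho r == None)| <= p)%N) alpha ^+ n' * Cf n'.
exists C.
  apply: sumr_ge0 => n' _; apply: sumr_ge0 => rho _.
  by rewrite mulr_ge0 ?exprn_ge0 ?(ltW alpha0)//; have [] := hCf n'.
move=> N n s k x s_inj s_card x1.
have x0 : 0 < x by exact: lt_le_trans x1.
have L1 : 1 <= 1 + ln x by rewrite lerDl ln_ge0.
have L0 : 0 <= 1 + ln x by exact: le_trans L1.
have xa0 : 0 <= x `^ (- alpha) by exact: powR_ge0.
have u0 : 0 <= u k by apply: renewal_seq_ge0; exact: ir_pmf_ge0.
have u1 : u k <= 1.
  apply: renewal_seq_le1; [exact: ir_pmf_ge0|exact: ir_pmf0 hF|].
  by move=> m; rewrite -ir_tailE; exact: ir_tail_ge0.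
rewrite signed_event_prob; last by move=> e; exact: unsigned_joint_exceedance.
set Bd := C * _.
apply/lee_addgt0Pr => e e0; rewrite -EFinD addrC.
have [M PM] := escaping_small N e0.
pose mass n' (c : {ffun 'I_n' -> bool * 'I_M.+1}) : R :=
  alpha ^+ n' * \prod_r dyadic_weight alpha (c r).1 (c r).2.
pose h (w : T) : R := 1 * \1_(escaping N M) w +
  \sum_(n' < (2 * p).+1)
    \sum_(rho : {ffun 'I_n' -> option bool} | (#|finset (fun r => rho r == None)| <= p)%N)
      \sum_(c : {ffun 'I_n' -> bool * 'I_M.+1})
        \sum_(f : {ffun 'I_n' -> 'I_N} | injectiveb f)
          cell_weight x rho c * \1_(role_event S k f c rho) w.
have hE : expect_le P h (e + Bd).
  rewrite -[e]mul1r; apply: expect_leD.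
    by apply: expect_le_indic => //; exact: measurable_escaping.
  rewrite /Bd /C mulr_suml; apply: expect_le_sum => n' _.
  rewrite mulr_suml; apply: expect_le_sum => rho Kp.
  set K := #|_| in Kp.
  have [Cf0 hC] := hCf n'.
  apply: (@expect_le_trans _ _ _ _ _ (\sum_(c : {ffun 'I_n' -> bool * 'I_M.+1})
     cell_weight x rho c * (mass n' c * u k ^+ K))); last first.
    apply: expect_le_sum => c _.
    apply: (@expect_le_trans _ _ _ _ _ (\sum_(f : {ffun 'I_n' -> 'I_N} | injectiveb f)
       cell_weight x rho c * fine (P (role_event S k f c rho)))); last first.
      apply: expect_le_sum => f _; apply: expect_le_indic.
      - exact: cell_weight_ge0.
      - exact: measurable_role.
      - by rewrite fineK ?fin_num_measure//; exact: measurable_role.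
    rewrite -mulr_sumr ler_wpM2l ?cell_weight_ge0//.
    have := pattern_prob_le S alpha0 hF N k c rho; rewrite -lee_fin -sumEFin.
    apply: le_trans; apply: lee_sum => f _.
    by rewrite fineK ?fin_num_measure//; exact: measurable_role.
  have -> : \sum_(c : {ffun 'I_n' -> bool * 'I_M.+1})
     cell_weight x rho c * (mass n' c * u k ^+ K) = alpha ^+ n' * u k ^+ K *
     \sum_(c : {ffun 'I_n' -> bool * 'I_M.+1})
        pattern_weight x rho (fun r => dyadic_big R (cell_val (c r))) *
        \prod_r dyadic_mass alpha (cell_val (c r)).
    rewrite mulr_sumr; apply: eq_bigr => c _.
    by rewrite /cell_weight /mass /dyadic_mass [X in _ = _ * (_ * X)]big_split/=; ring.
  apply: le_trans (_ : alpha ^+ n' * u k ^+ K * (Cf n' * (x `^ (- alpha) * (1 + ln x) ^+ K.-1)) <= _).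
    by rewrite ler_wpM2l ?hC// mulr_ge0 ?exprn_ge0 ?(ltW alpha0).
  have hK : u k ^+ K * (1 + ln x) ^+ K.-1 <=
      u k ^+ p * (1 + ln x) ^+ p.-1 + (1 + ln x) ^+ p.-2.
    move: Kp; rewrite leq_eqVlt => /orP[/eqP ->|Kp].
      by rewrite lerDl exprn_ge0.
    apply: ler_wpDl; first by rewrite mulr_ge0 ?exprn_ge0.
    apply: le_trans (_ : 1 * (1 + ln x) ^+ K.-1 <= _).
      by rewrite ler_wpM2r ?exprn_ge0// exprn_ile1.
    rewrite mul1r ler_weXn2l// -!subn1 leq_sub2r// subn1 -ltnS prednK//.
    by rewrite (leq_ltn_trans _ Kp).
  have a0 : 0 <= alpha ^+ n' * Cf n' * x `^ (- alpha).
    by rewrite !mulr_ge0 ?exprn_ge0 ?(ltW alpha0).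
  apply: (@le_trans _ _ (alpha ^+ n' * Cf n' * x `^ (- alpha) * (u k ^+ K * (1 + ln x) ^+ K.-1))).
    by apply: eq_lew; ring.
  apply: (le_trans (ler_wpM2l a0 hK)).
  by apply: eq_lew; rewrite !mulrA.
apply: (sum_prob_le_expect _ _ hE).
- by rewrite exprn_ge0.
- move=> e'; exact: (unsigned_measurable (unsigned_joint_exceedance s k x e')).
move=> w.
have sum0 : 0 <= \sum_(n' < (2 * p).+1)
    \sum_(rho : {ffun 'I_n' -> option bool} | (#|finset (fun r => rho r == None)| <= p)%N)
      \sum_(c : {ffun 'I_n' -> bool * 'I_M.+1})
        \sum_(f : {ffun 'I_n' -> 'I_N} | injectiveb f)
          cell_weight x rho c * \1_(role_event S k f c rho) w.
  apply: sumr_ge0 => n' _; apply: sumr_ge0 => rho _; apply: sumr_ge0 => c _.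
  by apply: sumr_ge0 => f _; rewrite mulr_ge0// cell_weight_ge0.
apply: le_trans (sign_average_le k w s_inj s_card x0) _.
rewrite /h mul1r indicE; have [wE|wE] := boolP (w \in escaping N M).
  by apply: ler_wpDr => //; rewrite ge_min lexx.
rewrite add0r; apply: le_trans (@pattern_bound R _ p (fun i : 'I_N => jump S i w) x
  (fun i => jump_gt0 S i w) x0 (visitors S N 0 w) (visitors S N k w)) _.
apply: ler_sum => n' _; apply: ler_sum => rho _.
rewrite exchange_big/= [leLHS]big_mkcondr/=; apply: ler_sum => f _.
have wE' : ~ escaping N M w by move=> h'; move/negP: wE; apply; rewrite inE.
case: ifP => marks; first exact: pattern_le_cells.
by apply: sumr_ge0 => c _; rewrite mulr_ge0// cell_weight_ge0.
Qed.

End FiniteStage.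

(** * From partial sums to the series *)

Lemma increasing_tuples_enum (p : nat) : (0 < p)%N ->
  exists e : nat -> p.-tuple nat, set_bij setT [set s : p.-tuple nat | sorted ltn s] e.
Proof.
move=> p0; set D := [set s | _].
have infD : infinite_set D.
  move=> finD; apply: infinite_nat.
  have := finite_image (fun s : p.-tuple nat => nth 0%N s 0) finD.
  apply: sub_finite_set => m _; exists [tuple of iota m p]; last first.
    by rewrite /= nth_iota// addn0.
  by rewrite /D/= iota_ltn_sorted.
have cD : card_eq D [set: nat] by apply: eq_card_nat => //; exact: countableP.
have t0 : p.-tuple nat by exact: [tuple of nseq p 0%N].
have /card_set_bijP[g [gm gi gs]] := cD.
have ex n : exists s, D s /\ g s = n by have [s Ds gn] := gs n I; exists s.
have [e he] := choice ex.
exists e; split.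
- by move=> n _; exact: (he n).1.
- by move=> n m _ _ enm; rewrite -(he n).2 enm (he m).2.
- move=> s Ds; exists (g s) => //.
  apply: gi; rewrite ?inE; [exact: (he _).1|exact: Ds|exact: (he _).2].
Qed.

Section FatouEvents.
Context d (T : measurableType d) (R : realType) (P : probability T R).

(** Fatou's lemma for indicator functions. *)
Lemma eventual_prob_le (E : set T) (En : nat -> set T) (n0 : nat) (B : \bar R) :
  measurable E -> (forall n, measurable (En n)) ->
  (forall n, (n0 <= n)%N -> (P (En n) <= B)%E) ->
  {ae P, forall w, E w -> exists m, forall n, (m <= n)%N -> En n w} ->
  (P E <= B)%E.
Proof.
move=> mE mEn hB [Z [mZ PZ hZ]].
pose Fm m := \bigcap_(n in [set n | (m + n0 <= n)%N]) En n.
have mF m : measurable (Fm m) by apply: bigcap_measurable => //; exists (m + n0)%N => /=.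
have mU : measurable (\bigcup_m Fm m) by exact: bigcupT_measurable.
have ndF : nondecreasing_seq Fm.
  move=> m m' mm'; apply/subsetPset => w h n /= m'n; apply: h => /=.
  by rewrite (leq_trans _ m'n)// leq_add2r.
have PU : (P (\bigcup_m Fm m) <= B)%E.
  have cv := nondecreasing_cvg_mu (mu := P) mF mU ndF.
  rewrite -(cvg_lim _ cv)//; apply: lime_le; first by apply/cvg_ex; eexists; exact: cv.
  near=> m => /=; apply: le_trans (hB (m + n0)%N (leq_addl _ _)).
  by apply: le_measure; rewrite ?inE// => w; apply => /=.
apply: le_trans PU; have sub : E `<=` (\bigcup_m Fm m) `|` Z.
  move=> w Ew; have [wZ|wZ] := pselect (Z w); [by right|left].
  have [m hm] : exists m, forall n, (m <= n)%N -> En n w.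
    apply: contrapT => h; apply: wZ; apply: hZ => /=.
    by move=> h'; apply: h; exact: h'.
  by exists m => // n /= mn; apply: hm; rewrite (leq_trans _ mn)// leq_addr.
apply: (@le_trans _ _ (P ((\bigcup_m Fm m) `|` Z))).
  by apply: le_measure; rewrite ?inE//; exact: measurableU.
apply: (le_trans (measureU2 _ mU mZ)).
by rewrite -[leRHS]adde0; apply: leeD => //; apply: eq_lew.
Unshelve. all: by end_near. Qed.

End FatouEvents.

Section FiniteSections.
Context (p : nat) (e : nat -> p.-tuple nat).
Hypothesis e_bij : set_bij setT [set s : p.-tuple nat | sorted ltn s] e.

Lemma perm_ord_preimage N (t : seq nat) : uniq t -> (forall i, i \in t -> (i < N)%N) ->
  perm_eq [seq val i | i <- enum (finset (fun i : 'I_N => val i \in t))] t.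
Proof.
move=> ut tN; apply: uniq_perm => //.
  by rewrite map_inj_uniq ?enum_uniq//; exact: val_inj.
move=> i; apply/mapP/idP => [[j]|it].
  by rewrite mem_enum inE => jt ->.
by exists (Ordinal (tN i it)); rewrite ?mem_enum ?inE.
Qed.

Definition section_dim (n : nat) : nat := (\max_(m < n) \max_(i <- e m) i).+1.

Definition section_sets (n : nat) (m : 'I_n) : {set 'I_(section_dim n)} :=
  finset (fun i : 'I_(section_dim n) => val i \in (e m : seq nat)).

Lemma section_dim_gt n (m : 'I_n) i : i \in (e m : seq nat) -> (i < section_dim n)%N.
Proof.
move=> im; rewrite ltnS; apply: (@leq_trans (\max_(i <- e m) i)).
  exact: (@leq_bigmax_seq _ (e m : seq nat) xpredT (fun i => i)%N).
exact: (@leq_bigmax _ (fun m : 'I_n => \max_(i <- e m) i)%N m).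
Qed.

Let e_sorted m : sorted ltn (e m).
Proof. by have [h _ _] := e_bij; exact: (h m I). Qed.

Let e_uniq m : uniq (e m).
Proof. exact: (sorted_uniq ltn_trans ltnn (e_sorted m)). Qed.

Let section_perm n (m : 'I_n) :
  perm_eq [seq val i | i <- enum (section_sets m)] (e m).
Proof. by apply: perm_ord_preimage => // i; exact: section_dim_gt. Qed.

Lemma section_card n (m : 'I_n) : #|section_sets m| = p.
Proof. by rewrite cardE -(size_map val) (perm_size (section_perm m)) size_tuple. Qed.

Lemma section_inj n : injective (@section_sets n).
Proof.
move=> m m' mm'; apply: val_inj; have [_ inj _] := e_bij.
apply: inj; rewrite ?inE//; apply: val_inj => /=.
apply: (irr_sorted_eq ltn_trans ltnn (e_sorted m) (e_sorted m')) => i.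
rewrite -(perm_mem (section_perm m)) -(perm_mem (section_perm m')).
by rewrite mm'.
Qed.

Context (R : realType) (alpha : R) (F : probability nat R).
Context d (T : measurableType d) (P : probability T R).
Variable S : stable_regenerative_sources P alpha F.

Lemma section_prod n (m : 'I_n) (g : nat -> R) :
  \prod_(i in section_sets m) g i = \prod_(i <- e m) g i.
Proof. by rewrite -(perm_big _ (section_perm m))/= big_map big_enum. Qed.

Lemma section_visits n (m : 'I_n) k w :
  (section_sets m \subset visitors S _ k w) <->
  (forall i, i \in (e m : seq nat) -> visits S i k w).
Proof.
split=> [/fintype.subsetP h i im|h].
  by have := h (Ordinal (section_dim_gt im)); rewrite !inE /= im => /(_ isT).
by apply/fintype.subsetP => i; rewrite !inE => im; apply: h.
Qed.

(** The first [n] terms involve finitely many sources only, which makes the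
    partial sum of the series an instance of [partial_sum]. *)
Lemma series_partial_sum n k w :
  series (fun m => multistable_term S k (e m) w) n = partial_sum S (@section_sets n) k w.
Proof.
rewrite /series/= big_mkord /partial_sum [RHS]big_mkcond/=; apply: eq_bigr => m _.
rewrite /multistable_term indicE big_split/= (section_prod m (fun i => sign S i w)) (section_prod m (fun i => jump S i w)).
case: ifP => [|h].
  by move=> /section_visits h; rewrite mem_set ?mulr1// => i /=; exact: h.
rewrite memNset ?mulr0// => h'; move/negP: h; apply; apply/section_visits => i im.
exact: h'.
Qed.

End FiniteSections.

Section TransferToLimit.
Context (R : realType) (alpha beta : R) (F : probability nat R).
Context d (T : measurableType d) (P : probability T R).
Variable S : stable_regenerative_sources P alpha F.
Hypothesis alpha02 : 0 < alpha < 2.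
Hypothesis hF : inter_renewal F beta.
Variable p : nat.
Hypothesis p_gt0 : (0 < p)%N.
Variable X0 : nat -> {RV P >-> R}.
Hypothesis hX0 : multistable_process S p X0.

Local Notation u := (renewal_seq (ir_pmf F)).

Lemma measurable_exceedance d' (T' : measurableType d') (P' : probability T' R)
    (Y : {RV P' >-> R}) x : measurable [set w | x < `|Y w|].
Proof.
exact: (measurable_funPTI Y (measurable_norm_gt x)).
Qed.

Lemma all_signed : {ae P, forall w, forall N, signed_event S (fun _ : {ffun 'I_N -> bool} => setT) w}.
Proof.
apply/ae_foralln => N; exists (~` signed_event S (fun _ : {ffun 'I_N -> bool} => setT)); split => //.
- by apply: measurableC; apply: signed_event_measurable => e; exact: unsignedT.
- exact: sign_event_cover.
Qed.

Lemma limit_upper : exists2 C : R, 0 <= C & forall k x, 1 <= x ->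
  (P [set w | (x < `|X0 0%N w|)%R /\ (x < `|X0 k w|)%R] <=
    (C * (x `^ (- alpha) * (u k ^+ p * (1 + ln x) ^+ p.-1 + (1 + ln x) ^+ p.-2)))%:E)%E.
Proof.
have [C C0 hC] := finite_stage_upper S alpha02 hF p; exists C => // k x x1.
have [e e_bij] := increasing_tuples_enum p_gt0.
apply: (@eventual_prob_le _ _ _ _ _
  (fun n => signed_event S (joint_exceedance S (@section_sets _ e n) k x)) 0%N).
- by apply: measurableI; exact: measurable_exceedance.
- by move=> n; apply: signed_event_measurable => c; exact: unsigned_joint_exceedance.
- by move=> n _; apply: hC => //; [exact: section_inj|exact: section_card].
have c0 := hX0 0 e_bij; have ck := hX0 k e_bij.
apply: filterS3 c0 ck all_signed => w c0 ck sg [x0 xk].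
have e0 : \forall n \near \oo, x < `|series (fun m => multistable_term S 0 (e m) w) n|.
  by apply: (cvgr_gt (`|X0 0%N w|)) => //; exact: cvg_norm.
have ek : \forall n \near \oo, x < `|series (fun m => multistable_term S k (e m) w) n|.
  by apply: (cvgr_gt (`|X0 k w|)) => //; exact: cvg_norm.
have [m _ hm] := filterI e0 ek; exists m => n mn.
have [h0 hk] := hm n mn; apply/signed_eventP.
have /signed_eventP[c [_ hc]] := sg (section_dim e n); exists c; split => //; split.
- by rewrite -(partial_sum_chaos _ _ hc) -series_partial_sum.
- by rewrite -(partial_sum_chaos _ _ hc) -series_partial_sum.
Qed.

Lemma count_prob_ge (I : finType) (c : R) (H : set T) (A : I -> set T) :
  0 <= c -> measurable H -> (forall i, measurable (A i)) ->
  (forall w, H w -> c <= #|finset (fun i => `[< A i w >])|%:R) ->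
  (c%:E * P H <= \sum_i P (A i))%E.
Proof.
move=> c0 mH mA hc.
have -> : (c%:E * P H = \int[P]_w (c * \1_H w)%:E)%E.
  under eq_integral do rewrite EFinM.
  rewrite ge0_integralZl//; last by apply/measurable_EFinP; exact: measurable_indic.
  by rewrite integral_indic// setIT.
have -> : (\sum_i P (A i) = \int[P]_w (\sum_i \1_(A i) w)%:E)%E.
  under eq_integral do rewrite -sumEFin.
  rewrite ge0_integral_sum//; last first.
    by move=> i; apply/measurable_EFinP; exact: measurable_indic.
  by apply: eq_bigr => i _; rewrite integral_indic// setIT.
apply: ge0_le_integral => //.
- by move=> w _; rewrite lee_fin mulr_ge0.
- by apply/measurable_EFinP; apply: measurable_funM; [exact: measurable_cst|exact: measurable_indic].
- by apply/measurable_EFinP; apply: measurable_big_sum => i; exact: measurable_indic.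
- move=> w _; rewrite lee_fin.
  have -> : \sum_i \1_(A i) w = #|finset (fun i => `[< A i w >])|%:R :> R.
    rewrite -[in RHS]sum1_card natr_sum [RHS]big_mkcond/=; apply: eq_bigr => i _.
    rewrite inE indicE.
    by case: ifPn => /asboolP hA; [rewrite mem_set|rewrite memNset].
  have [Hw|Hw] := pselect (H w); first by rewrite indicE mem_set// mulr1 hc.
  by rewrite indicE memNset// mulr0.
Qed.

(** A term of the series at time [0] is nonzero when all its points visit [0],
    that is when they are undelayed. *)
Definition large_product (y : R) : set T :=
  [set w | exists s : p.-tuple nat, [/\ sorted ltn s,
     forall i, i \in (s : seq nat) -> delay S i w = 0%N & y <= \prod_(i <- s) jump S i w]].

Let section_product e n y : set T :=
  [set w | exists m : 'I_n, section_sets e m \subset visitors S (section_dim e n) 0 w /\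
     y <= \prod_(i in @section_sets p e n m) jump S i w].

Let measurable_section_product e n y : measurable (section_product e n y).
Proof.
rewrite (_ : section_product e n y = \bigcup_(m in [set: 'I_n])
  ((\bigcap_(i in [set` enum (@section_sets p e n m)]) visits S i 0) `&`
   [set w | y <= \prod_(i in @section_sets p e n m) jump S i w])); last first.
  apply/seteqP; split=> w [m].
    move=> [/fintype.subsetP h hy]; exists m => //; split => // i /=.
    by rewrite mem_enum => /h; rewrite inE => /asboolP.
  move=> _ [h hy]; exists m; split => //; apply/fintype.subsetP => i im; rewrite inE.
  by apply/asboolP; apply: h; rewrite /= mem_enum.
apply: fin_bigcup_measurable => // m _; apply: measurableI.
  by apply: fin_bigcap_measurable => // i _; exact: measurable_visits.
have mf : measurable_fun setT (fun w => \prod_(i in @section_sets p e n m) jump S i w).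
  under eq_fun do rewrite big_mkcond/=.
  by apply: measurable_big_prod => i; case: (i \in _); [exact: measurable_funPT|exact: measurable_cst].
have := mf measurableT `[y, +oo[%classic (measurable_itv _); rewrite setTI.
rewrite (_ : _ @^-1` _ = [set w | y <= \prod_(i in @section_sets p e n m) jump S i w])//.
by apply/seteqP; split=> w /=; rewrite in_itv/= andbT.
Qed.

Lemma finite_stage_lower N n (s : 'I_n -> {set 'I_N}) x y (H : set T) :
  injective s -> (forall m, #|s m| = p) -> x < y -> measurable H ->
  (forall w, H w -> exists m, s m \subset visitors S N 0 w /\ y <= \prod_(i in s m) jump S i w) ->
  ((2^-1 ^+ p)%:E * P H <= P (signed_event S (fun e =>
    [set w | x < `|chaos s (fun i => jump S i w) (visitors S N 0 w) e|]%R)))%E.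
Proof.
move=> s_inj s_card xy mH hH.
rewrite signed_event_prob; last by move=> e; exact: unsigned_exceedance.
have h : ((2 ^+ N * 2^-1 ^+ p)%:E * P H <= \sum_e P [set w | x < `|chaos s (fun i => jump S i w) (visitors S N 0 w) e|]%R)%E.
  apply: count_prob_ge => //.
    by move=> e; apply: unsigned_measurable; exact: unsigned_exceedance.
  move=> w /hH[m [mv ym]].
  rewrite exprVn ler_pdivrMr ?exprn_gt0// -!natrX -natrM ler_nat mulnC.
  have := chaos_tail_ge s_inj s_card mv ym; rewrite card_ord => /leq_trans; apply.
  rewrite leq_mul2l; apply/orP; right; apply: subset_leq_card.
  by apply/fintype.subsetP => e; rewrite !inE => /(lt_le_trans xy).
apply: (@le_trans _ _ ((2^-1 ^+ N)%:E * ((2 ^+ N * 2^-1 ^+ p)%:E * P H))%E); last first.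
  by rewrite lee_wpmul2l// lee_fin exprn_ge0.
rewrite muleA -EFinM mulrA -exprMn mulVf// expr1n mul1r//.
Qed.

(** Fatou's lemma is used twice: on the complements of the exceedances of the
    partial sums, and on the events that a large product occurs among the
    first [n] tuples. The gap between [x] and [y] leaves room for the limit. *)
Lemma limit_lower x y (A : set T) : x < y -> measurable A -> A `<=` large_product y ->
  (P A <= (2 ^+ p)%:E * P [set w | (x < `|X0 0%N w|)%R])%E.
Proof.
move=> xy mA hA; have [e e_bij] := increasing_tuples_enum p_gt0.
(* partial sums above [z] have a limit above [x] *)
pose z := (x + y) / 2.
have [xz zy] : x < z /\ z < y by rewrite /z; split; lra.
apply: (@eventual_prob_le _ _ _ _ _ (fun n => section_product e n y) 0%N) => //; last first.
  apply: aeW => w /hA[s [ss ds ys]].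
  have [_ _ /(_ s ss)[m0 _ em0]] := e_bij; exists m0.+1 => n mn.
  exists (Ordinal mn); split; first last.
    by rewrite (section_prod e_bij (Ordinal mn) (fun i => jump S i w))/= em0.
  apply/section_visits => i /=; rewrite em0 => /ds di; exact/visits0P.
move=> n _; set H := section_product e n y.
have mX := measurable_exceedance (X0 0%N) x.
set E := [set w | _ < `|X0 _ w|] in mX *.
have mH : measurable H by exact: measurable_section_product.
have PH1 : (P H <= 1)%E by exact: probability_le1.
have hC : (P (~` E) <= (1 - 2^-1 ^+ p * fine (P H))%:E)%E.
  pose G m := signed_event S (fun c => [set w | z < `|chaos (@section_sets p e m)
       (fun i => jump S i w) (visitors S (section_dim e m) 0 w) c|]).
  have mG m : measurable (G m).
    by apply: signed_event_measurable => c; exact: unsigned_exceedance.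
  apply: (@eventual_prob_le _ _ _ _ _ (fun m => ~` G m) n) => //.
  - exact: measurableC.
  - by move=> m; exact: measurableC.
  - move=> m nm; rewrite probability_setC// -[P (G m)]fineK ?fin_num_measure//.
    rewrite -EFinB lee_fin lerD2l lerN2.
    rewrite -lee_fin EFinM !fineK ?fin_num_measure//.
    apply: (finite_stage_lower _ _ zy mH); [exact: section_inj|exact: section_card|].
    move=> w [i [iv iy]]; exists (widen_ord nm i); split.
      apply/section_visits => j ji; move/section_visits : iv; exact.
    move: iy; rewrite (section_prod e_bij i (fun i => jump S i w)).
    by rewrite (section_prod e_bij (widen_ord nm i) (fun i => jump S i w)).
  - have c0 := hX0 0 e_bij; apply: filterS c0 => w c0 /negP; rewrite -leNgt => Xx.
    have e0 : \forall n \near \oo, `|series (fun m => multistable_term S 0 (e m) w) n| < z.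
      by apply: (cvgr_lt (`|X0 0%N w|)); [exact: cvg_norm|exact: le_lt_trans xz].
    have [m _ hm] := e0.
    exists m => k mk /signed_eventP[c [/= zc hc]].
    have := hm k mk; rewrite /= series_partial_sum// (partial_sum_chaos _ _ hc).
    by rewrite ltNge (ltW zc).
move: hC; rewrite probability_setC//.
rewrite -[P E]fineK ?fin_num_measure// -[P H]fineK ?fin_num_measure//=.
rewrite -EFinB -EFinM !lee_fin lerD2l lerN2 exprVn ler_pdivrMl// ?exprn_gt0//.
Qed.

End TransferToLimit.

(** * Large products of undelayed jumps *)

Section LargeProducts.
Context (R : realType) (alpha beta : R) (F : probability nat R).
Context d (T : measurableType d) (P : probability T R).
Variable S : stable_regenerative_sources P alpha F.
Hypothesis alpha0 : 0 < alpha.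
Hypothesis hF : inter_renewal F beta.

Local Notation theta := ((2 `^ alpha)^-1).
Local Notation kappa := (alpha * 2 `^ (- alpha - 1)).
Local Notation pt := (fun i w => (jump S i w, delay S i w)).

Let theta01 : 0 < theta < 1.
Proof. have : 1 `^ alpha < 2 `^ alpha :> R by apply: gt0_ltr_powR; rewrite ?nnegrE ?ltr1n.
by rewrite powR1 invr_gt0 powR_gt0// invf_lt1 ?powR_gt0. Qed.

Let tail0 : ir_tail F 0%:R = 1.
Proof. by rewrite ir_tailE big_ord1 (ir_pmf0 hF) subr0. Qed.

Section Cells.
Variables (q n M : nat).
Hypothesis qMn : (q.+1 * M <= n)%N.

Local Notation C := ('I_n.+1).

(** Undelayed points on the dyadic levels up to [n]; such points visit [0]. *)
Let cells (c : C) : set (R * nat) := dyadic_cell false c 0.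
Let lam (c : C) : R := fine (stable_intensity alpha F (cells c)).

Let cells_bounds (c : C) : (kappa * theta ^+ c <= lam c <= alpha * theta ^+ c) /\
  (0 <= stable_intensity alpha F (cells c) < +oo)%E.
Proof.
have /andP[h1 h2] := stable_intensity_dyadic_bounds F alpha0 false c 0.
have k0 : 0 <= kappa * theta ^+ c.
  by rewrite !mulr_ge0 ?powR_ge0 ?(ltW alpha0)// exprn_ge0// ltW//; case/andP: theta01.
rewrite /dyadic_weight tail0 mulr1 in h1; rewrite /dyadic_weight tail0 mulr1 in h2.
have h3 : (0 <= stable_intensity alpha F (cells c) < +oo)%E.
  by rewrite (le_trans _ h1)//= (le_lt_trans h2)// ltry.
split => //; rewrite /lam -!lee_fin fineK; first by rewrite h1.
by apply/fin_numPlt; case/andP: h3 => h4 ->; rewrite (lt_le_trans _ h4).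
Qed.

Let low : {set C} := finset (fun c : C => (c < M)%N).

Let card_low : #|low| = M.
Proof.
have Mn : (M <= n.+1)%N by rewrite leqW// (leq_trans _ qMn)// leq_pmull.
have winj : injective (widen_ord Mn) by move=> x y /(congr1 val)/= /val_inj.
rewrite -[RHS]card_ord -(card_imset _ winj).
apply: eq_card => c; rewrite inE; apply/idP/imsetP => [cM|[i _ ->]]; last exact: (ltn_ord i).
by exists (Ordinal cM) => //; apply: val_inj.
Qed.

(** The level completing [J] to a total of [n]. As [M] is at most [n / (q + 1)],
    it is at least [M], hence different from the levels of [J]. *)
Let final (J : {set C}) : C := inord (n - \sum_(c in J) c).

Let mult (J : {set C}) (c : C) : nat := ((c \in J) + (c == final J))%N.

Let config (J : {set C}) : set T := \big[setI/setT]_(c <- enum (final J |: low))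
  cell_level R pt cells c (mult J c).

Let admissible : {set {set C}} :=
  finset (fun J : {set C} => (J \subset low) && (#|J| == q)).

Let sum_low J : J \in admissible -> (\sum_(c in J) c <= q * M)%N.
Proof.
rewrite inE => /andP[Jl /eqP <-]; rewrite -sum_nat_const; apply: leq_sum => c cJ.
by have := fintype.subsetP Jl c cJ; rewrite inE => /ltnW.
Qed.

Let finalE J : J \in admissible -> (\sum_(c in J) c + final J)%N = n.
Proof.
move=> hJ; have := sum_low hJ => h.
have le : (\sum_(c in J) c <= n)%N.
  by rewrite (leq_trans h)// (leq_trans _ qMn)// leq_mul2r leqnSn orbT.
by rewrite inordK ?subnKC// ltnS leq_subr.
Qed.

Let final_high J : J \in admissible -> (M <= final J)%N.
Proof.
move=> hJ; rewrite -(leq_add2l (\sum_(c in J) c)) finalE//.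
by rewrite (leq_trans _ qMn)// mulSn addnC leq_add2l sum_low.
Qed.

Let final_notin J : J \in admissible -> final J \notin J.
Proof.
move=> hJ; apply/negP => fJ; have := hJ; rewrite inE => /andP[/fintype.subsetP/(_ _ fJ)].
by rewrite inE ltnNge final_high.
Qed.

Let mpt i : measurable_fun setT (pt i).
Proof. by apply: measurable_fun_pair; exact: measurable_funPT. Qed.

Let mcells c : measurable (cells c).
Proof. exact: measurable_dyadic_cell. Qed.

Let cells_disjoint c c' x : cells c x -> cells c' x -> c = c'.
Proof. by move=> h h'; have [/val_inj] := dyadic_disjoint h h'. Qed.

Let measurable_config J : measurable (config J).
Proof.
apply: bigsetI_measurable => c _; apply: measurable_cell_level => //.
Qed.

Let config_disjoint J J' w : J \in admissible -> J' \in admissible ->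
  config J w -> config J' w -> J = J'.
Proof.
move=> hJ hJ' wJ wJ'; apply/eqP; rewrite eqEcard.
have /andP[Jl /eqP cJ] : (J \subset low) && (#|J| == q) by move: hJ; rewrite inE.
have /andP[Jl' /eqP cJ'] : (J' \subset low) && (#|J'| == q) by move: hJ'; rewrite inE.
rewrite cJ cJ' leqnn andbT; apply/fintype.subsetP => c cin.
apply: contraT => cnin; have cl := fintype.subsetP Jl c cin.
have nf J0 : J0 \in admissible -> (c == final J0) = false.
  move=> h0; apply/negP => /eqP cE; move: cl; rewrite cE inE ltnNge.
  by rewrite final_high.
have get J0 : config J0 w -> cell_level R pt cells c (mult J0 c) w.
  rewrite /config -bigcap_seq => h; apply: (h c).
  by rewrite /= mem_enum !inE; move: cl; rewrite inE => ->; rewrite orbT.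
have := get _ wJ; have := get _ wJ'; rewrite /cell_level/= => -> [] /eqP.
by rewrite eqr_nat /mult cin (negbTE cnin) !nf.
Qed.

Let config_prob_ge J : J \in admissible ->
  ((kappa ^+ q.+1 * expR (- (alpha / (1 - theta))) * theta ^+ n)%:E <= P (config J))%E.
Proof.
move=> hJ; have /andP[t0 t1] := theta01.
have nuB c : (0 <= stable_intensity alpha F (cells c) < +oo)%E by have [] := cells_bounds c.
have [_ /(_ (enum (final J |: low)) (mult J) (enum_uniq _))] :=
  cell_level_indep (points_ppp S) mcells nuB cells_disjoint.
rewrite setTI probability_setT mul1e -/(config J) => -> //; rewrite lee_fin big_enum/=.
have lam0 c : 0 <= lam c by rewrite fine_ge0//; case/andP: (nuB c).
have lamb (c : C) : kappa * theta ^+ c <= lam c <= alpha * theta ^+ c by have [] := cells_bounds c.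
have k0 : 0 <= kappa by rewrite mulr_ge0 ?powR_ge0 ?ltW.
have mult1 c : (mult J c <= 1)%N.
  rewrite /mult; case: eqP => [->|_]; first by rewrite (negbTE (final_notin hJ)).
  by rewrite addn0 leq_b1.
rewrite (eq_bigr (fun c => lam c ^+ mult J c * expR (- lam c))); last first.
  move=> c _; rewrite (poisson_prob1E (lam0 c))/=.
  by have := mult1 c; case: (mult J c) => [|[|]]// _; rewrite invr1 mulr1.
rewrite big_split/= -expR_sum mulrAC; apply: ler_pM.
- by rewrite mulr_ge0 ?exprn_ge0// ltW.
- exact: expR_ge0.
- rewrite big_mkcond/= (eq_bigr (fun c => (if c \in J then lam c else 1) *
     (if c == final J then lam c else 1))); last first.
    move=> c _; rewrite !inE /mult; case: ifPn => h.
      by case: (c \in J); case: (c == _); rewrite /= ?expr0 ?expr1 ?mulr1 ?mul1r// expr2.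
    move: h; rewrite negb_or => /andP[/negbTE -> cM]; rewrite mulr1 ifF//.
    apply/negP => cJ; move: hJ; rewrite inE => /andP[/fintype.subsetP/(_ c cJ)].
    by rewrite inE (negbTE cM).
  rewrite big_split/= -!big_mkcond/= big_pred1_eq.
  have -> : kappa ^+ q.+1 * theta ^+ n =
      (\prod_(c in J) (kappa * theta ^+ c)) * (kappa * theta ^+ final J).
    have cJ : #|J| = q by move: hJ; rewrite inE => /andP[_ /eqP].
    rewrite -[in LHS](finalE hJ) exprD -prodrXr big_split/= prodr_const cJ exprSr.
    by rewrite -!mulrA; congr (_ * _); rewrite [RHS]mulrCA; congr (_ * _); rewrite mulrCA.
  apply: ler_pM.
  + by rewrite prodr_ge0// => c _; rewrite mulr_ge0// exprn_ge0// ltW.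
  + by rewrite mulr_ge0// exprn_ge0// ltW.
  + apply: ler_prod => c _; have /andP[-> _] := lamb c.
    by rewrite mulr_ge0// exprn_ge0// ltW.
  + by have /andP[] := lamb (final J).
- rewrite ler_expR sumrN lerN2.
  apply: (@le_trans _ _ (\sum_(c : C) lam c)).
    by rewrite [leRHS](bigID (mem (final J |: low)))/= lerDl sumr_ge0.
  apply: le_trans (_ : \sum_(c : C) alpha * theta ^+ c <= _).
    by apply: ler_sum => c _; have /andP[] := lamb c.
  by rewrite -mulr_sumr ler_wpM2l ?(ltW alpha0)// geometric_sum_lt// ltW.
Qed.

Let config_large J : J \in admissible -> config J `<=` large_product S q.+1 (2 ^+ n).
Proof.
move=> hJ w wJ; pose Js := final J |: J.
have ex c : exists i, c \in Js -> cells c (pt i w).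
  have [cJ|cJ] := boolP (c \in Js); last by exists 0%N.
  have cQ : c \in final J |: low.
    move: cJ; rewrite !inE => /orP[->//|cJ].
    by move: hJ; rewrite inE => /andP[/fintype.subsetP/(_ c cJ)]; rewrite inE => ->; rewrite orbT.
  have lev : cell_level R pt cells c (mult J c) w.
    by move: wJ; rewrite /config -bigcap_seq; apply; rewrite /= mem_enum.
  apply: contrapT => h; have : mult J c = 0%N.
    apply/eqP; rewrite -(eqr_nat R); apply/eqP/EFin_inj; rewrite -lev /point_count.
    apply: eseries0 => i _ _; rewrite indicE memNset// => hi.
    by apply: h; exists i.
  by move: cJ; rewrite !inE /mult => /orP[->|->]; rewrite ?addn1 ?add1n.
have [f hf] := choice ex.
have finj : {in Js &, injective f}.
  move=> c c' cJ cJ' ff; apply: (@cells_disjoint _ _ (pt (f c) w)); first exact: hf.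
  by rewrite ff; exact: hf.
pose s := sort leq [seq f c | c <- enum Js].
have cJs : #|Js| = q.+1.
  by rewrite cardsU1 (final_notin hJ) add1n; move: hJ; rewrite inE => /andP[_ /eqP ->].
have ssz : size s == q.+1 by rewrite size_sort size_map -cardE cJs.
exists (Tuple ssz); split => /=.
- rewrite ltn_sorted_uniq_leq sort_uniq (sort_sorted leq_total) andbT map_inj_in_uniq ?enum_uniq//.
  by move=> c c'; rewrite !mem_enum; exact: finj.
- move=> i; rewrite mem_sort => /mapP[c]; rewrite mem_enum => cJ ->.
  by have [_] := hf c cJ.
- rewrite (perm_big _ (permEl (perm_sort _ _)))/= big_map big_enum/=.
  have -> : 2 ^+ n = \prod_(c in Js) 2 ^+ c :> R.
    rewrite big_setU1 ?(final_notin hJ)//= -[in LHS](finalE hJ) exprD prodrXr mulrC.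
    by [].
  apply: ler_prod => c cJ; rewrite exprn_ge0//=.
  by have [/andP[/ltW]] := hf c cJ.
Qed.

(** The events [config J] are disjoint: for two sets of levels of the same size,
    some level belongs to the first only, and the two events prescribe different
    counts there. *)
Lemma large_product_prob : exists2 A : set T, measurable A /\ A `<=` large_product S q.+1 (2 ^+ n) &
  (('C(M, q)%:R * (kappa ^+ q.+1 * expR (- (alpha / (1 - theta))) * theta ^+ n))%:E <= P A)%E.
Proof.
pose v := kappa ^+ q.+1 * expR (- (alpha / (1 - theta))) * theta ^+ n.
have adm (o : 'I_#|admissible|) : enum_val o \in admissible by exact: enum_valP.
exists (\big[setU/set0]_(o < #|admissible|) config (enum_val o)).
  split; first by apply: bigsetU_measurable => o _; exact: measurable_config.
  move=> w; rewrite -bigcup_seq => -[ j _]; exact: config_large.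
rewrite measure_bigsetU_ord/=; last 2 first.
- by move=> o; exact: measurable_config.
- move=> o o' _ _ [w [wo wo']]; apply: enum_val_inj.
  exact: config_disjoint wo wo'.
have -> : ('C(M, q) = #|admissible|)%N by rewrite -card_low -cards_draws.
rewrite -[X in X%:R]card_ord mulr_natl -sumr_const -sumEFin.
by apply: lee_sum => o _; exact: config_prob_ge.
Qed.

End Cells.

End LargeProducts.

(** * Lower bound for the marginal tail *)

Lemma ffact_ge M q : ((M - q) ^ q <= M ^_ q)%N.
Proof.
elim: q => [|q IH]; first by rewrite ffactn0 expn0.
rewrite ffactnSr expnSr leq_mul ?leq_sub2l//.
apply: leq_trans IH; have [->|q0] := posnP q; first by rewrite !expn0.
by rewrite leq_exp2r// leq_sub2l.
Qed.

Lemma bin_div_ge (R : realType) (q n : nat) : (2 * q.+1 ^ 2 <= n)%N ->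
  ((n%:R / (2 * q.+1%:R)) ^+ q / q`!%:R <= 'C(n %/ q.+1, q)%:R :> R).
Proof.
move=> hn; set M := (n %/ q.+1)%N.
have h1 : n%:R <= q.+1%:R * (M%:R + 1) :> R.
  by rewrite natr1 -natrM ler_nat mulnC ltnW// ltn_ceil.
have h2 : 2 * q.+1%:R ^+ 2 <= n%:R :> R by rewrite -natrX -natrM ler_nat.
have qM : (q <= M)%N.
  rewrite leq_divRL// (leq_trans _ hn)// expnS expn1 mulnA leq_mul2r mul2n -addnn.
  by rewrite /= (leq_trans (leqnSn _))// leq_addr.
rewrite ler_pdivrMr ?ltr0n ?fact_gt0// -[leRHS]natrM bin_ffact.
apply: (@le_trans _ _ ((M - q) ^ q)%:R); last by rewrite ler_nat ffact_ge.
rewrite natrX; apply: lerXn2r; rewrite ?nnegrE ?divr_ge0 ?mulr_ge0 ?ler0n//.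
rewrite ler_pdivrMr ?mulr_gt0 ?ltr0n// natrB//.
have : q.+1%:R = q%:R + 1 :> R by rewrite natr1.
nra.
Qed.

Section MarginalTail.
Context (R : realType) (alpha beta : R) (F : probability nat R).
Context d (T : measurableType d) (P : probability T R).
Variable S : stable_regenerative_sources P alpha F.
Hypothesis alpha0 : 0 < alpha.
Hypothesis hF : inter_renewal F beta.
Variable p : nat.
Hypothesis p_gt0 : (0 < p)%N.
Variable X0 : nat -> {RV P >-> R}.
Hypothesis hX0 : multistable_process S p X0.

(** Apply the previous estimates at the first power of two above [x], whose
    exponent is of order [ln x]. *)
Lemma exceedance_lower : exists c x1 : R, [/\ 0 < c, 1 <= x1 &
  forall x, x1 <= x -> ((c * (x `^ (- alpha) * (1 + ln x) ^+ p.-1))%:E <=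
    P [set w | (x < `|X0 0%N w|)%R])%E].
Proof.
case: p p_gt0 X0 hX0 => // q _ X hX /=.
pose v0 := (alpha * 2 `^ (- alpha - 1)) ^+ q.+1 * expR (- (alpha / (1 - (2 `^ alpha)^-1))).
have v00 : 0 < v0 by rewrite mulr_gt0 ?expR_gt0// exprn_gt0// mulr_gt0// powR_gt0.
pose c1 : R := (4 * q.+1%:R)^-1 ^+ q / q`!%:R.
have c10 : 0 < c1.
  by rewrite divr_gt0 ?ltr0n ?fact_gt0// exprn_gt0// invr_gt0 mulr_gt0.
pose c := 2^-1 ^+ q.+1 * (c1 * v0 * 2 `^ (- alpha)).
(* beyond this threshold [n / p - q] is at least [n / (2 * p)] *)
exists c, (2 ^+ (2 * q.+1 ^ 2)); split.
- by rewrite mulr_gt0 ?exprn_gt0// mulr_gt0 ?powR_gt0// mulr_gt0.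
- by rewrite exprn_ege1// ler1n.
move=> x xx1; have x1 : 1 <= x by apply: le_trans xx1; rewrite exprn_ege1// ler1n.
have x0 : 0 < x by exact: lt_le_trans x1.
have two1 : 1 < 2 :> R by rewrite ltr1n.
have [n [xn hn]] := first_power_above x two1.
have nq : (2 * q.+1 ^ 2 <= n)%N.
  by apply: ltnW; rewrite -(ltr_eXn2l two1) (le_lt_trans xx1).
have n0 : (0 < n)%N by rewrite (leq_trans _ nq)// muln_gt0 expn_gt0.
have [A [mA AL] PA] := @large_product_prob _ _ _ _ _ _ _ S alpha0 hF q n (n %/ q.+1)
  (leq_trans (eq_leq (mulnC _ _)) (leq_divM _ _)).
have h := le_trans PA (limit_lower (ltn0Sn q) hX xn mA AL).
have mE := measurable_exceedance (X 0%N) x.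
rewrite -[P _]fineK ?fin_num_measure// -EFinM lee_fin in h.
rewrite -[P _]fineK ?fin_num_measure// lee_fin.
have t0 : 0 < 2 ^+ q.+1 :> R by rewrite exprn_gt0.
rewrite -(ler_pdivrMl _ _ t0) in h; apply: le_trans h.
rewrite /c exprVn -[leLHS]mulrA ler_wpM2l ?invr_ge0 ?exprn_ge0//.
have L0 : 0 <= ln x by rewrite ln_ge0.
have ln2 : ln 2 <= 1 :> R by have := @le_ln1Dx R 1; rewrite -[1 + 1]/2; apply; lra.
have Ln : ln x <= n%:R.
  apply: (@le_trans _ _ (ln (2 ^+ n))); first by rewrite ler_ln ?posrE ?exprn_gt0// ltW.
  by rewrite lnXn// -[ln 2 *+ n]mulr_natl ler_piMr.
have binb : c1 * (1 + ln x) ^+ q <= 'C(n %/ q.+1, q)%:R.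
  apply: le_trans (bin_div_ge R nq); rewrite /c1 mulrAC ler_wpM2r ?invr_ge0//.
  rewrite -exprMn lerXn2r ?nnegrE ?divr_ge0 ?mulr_ge0 ?invr_ge0 ?addr_ge0//.
  rewrite ler_pdivlMr ?mulr_gt0//.
  have -> : (4 * q.+1%:R)^-1 * (1 + ln x) * (2 * q.+1%:R) = (1 + ln x) / 2.
    have q0 : q.+1%:R != 0 :> R by rewrite pnatr_eq0.
    by move: (q.+1%:R : R) q0 => t t_neq0; field.
  have : 1 <= n%:R :> R by rewrite ler1n.
  lra.
have thb : 2 `^ (- alpha) * x `^ (- alpha) <= (2 `^ alpha)^-1 ^+ n.
  have := @dyadic_weightE R alpha false n; rewrite /dyadic_weight /dyadic_lo => ->.
  have n2 : 0 < 2 ^+ n :> R by rewrite exprn_gt0.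
  rewrite -powRM ?(ltW x0)// !powRN lef_pV2 ?posrE ?powR_gt0 ?mulr_gt0//.
  rewrite ge0_ler_powR ?nnegrE ?(ltW alpha0) ?(ltW n2) ?mulr_ge0 ?(ltW x0)//.
  by rewrite -(prednK n0) exprS ler_pM2l// hn// prednK.
have L1 : 0 <= 1 + ln x by rewrite addr_ge0.
rewrite -/v0; clearbody v0; apply: le_trans (ler_pM _ _ binb (ler_wpM2l (ltW v00) thb)).
- by rewrite -/c1; apply: eq_lew; move: (c1) => t; ring.
- by rewrite mulr_ge0 ?exprn_ge0// ltW.
- by rewrite !mulr_ge0 ?powR_ge0// ltW.
Qed.

End MarginalTail.

(** * Conditional maximum and limit superior *)

Section ConditionalMaximum.
Context (R : realType) d (T : measurableType d) (P : probability T R).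
Variable X : int -> {RV P >-> R}.
Hypothesis statX : stationary P X.

Local Notation exceed i x := [set w | (x < `|X i w|)%R].

(** Shift by [k] the pair of times [0] and [- k]. *)
Lemma stationary_pair (k : nat) (x : R) :
  P (exceed 0 x `&` exceed (- k%:Z) x) = P (exceed 0 x `&` exceed k%:Z x).
Proof.
pose B (i : int) := [set z : R | x < `|z|].
have mB i : measurable (B i) by exact: measurable_norm_gt.
have := statX k%:Z [fset (0 : int); - k%:Z]%fset mB.
rewrite (_ : \bigcap_(i in _) _ = exceed 0 x `&` exceed k%:Z x); last first.
  apply/seteqP; split=> w.
    move=> h; split.
      by have := h (- k%:Z); rewrite /= !inE eqxx orbT addNr; apply.
    by have := h 0; rewrite /= !inE eqxx add0r; apply.
  move=> [h0 hk] i /=; rewrite !inE => /orP[/eqP ->|/eqP ->]; first by rewrite add0r.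
  by rewrite /B/= addNr.
move=> ->; congr (P _); apply/seteqP; split=> w.
  move=> [h0 hk] i /=; rewrite !inE => /orP[/eqP ->|/eqP ->]//.
move=> h; split; first by have := h 0; rewrite /= !inE eqxx; apply.
by have := h (- k%:Z); rewrite /= !inE eqxx orbT; apply.
Qed.

Lemma two_sided_max_gt (l m : nat) (x : R) w : 0 < x ->
  (x < two_sided_max X l m w) =
  has (fun k : nat => (x < `|X k%:Z w|) || (x < `|X (- k%:Z) w|)) (index_iota l m.+1).
Proof.
move=> x0; rewrite /two_sided_max; elim: (index_iota _ _) => [|k s IH].
  by rewrite big_nil ltNge ltW.
by rewrite big_cons/= !lt_max IH.
Qed.

Lemma cond_max_le (l m : nat) (x : R) : 0 < x ->
  cond_Pr P [set w | x < two_sided_max X l m w] (exceed 0 x) <=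
  2 / Pr P (exceed 0 x) *
    \sum_(l <= k < m.+1) Pr P [set w | x < `|X 0 w| /\ x < `|X k%:Z w|].
Proof.
move=> x0; pose E (k : nat) := exceed 0 x `&` exceed k%:Z x.
pose E' (k : nat) := exceed 0 x `&` exceed (- k%:Z) x.
have mE k : measurable (E k) by apply: measurableI; exact: measurable_exceedance.
have mE' k : measurable (E' k) by apply: measurableI; exact: measurable_exceedance.
have union (s : seq nat) : (P (\big[setU/set0]_(k <- s) (E k `|` E' k)) <=
    (2 * \sum_(k <- s) Pr P (E k))%:E)%E.
  elim: s => [|k s IH]; first by rewrite !big_nil measure0 mulr0.
  rewrite !big_cons; apply: le_trans (measureU2 _ _ _) _.
  - exact: measurableU.
  - by apply: bigsetU_measurable => j _; exact: measurableU.
  rewrite mulrDr EFinD; apply: leeD => //; apply: le_trans (measureU2 _ _ _) _ => //.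
  rewrite [X in (_ + X <= _)%E]stationary_pair mulr_natl mulr2n EFinD.
  by rewrite fineK ?fin_num_measure.
have eqU : [set w | x < two_sided_max X l m w] `&` exceed 0 x =
    \big[setU/set0]_(k <- index_iota l m.+1) (E k `|` E' k).
  apply/seteqP; split=> w; rewrite -bigcup_seq.
    move=> [/=]; rewrite two_sided_max_gt// => /hasP[k kl /orP[hk|hk]] h0; exists k => //.
      by left; split.
    by right; split.
  move=> [k /= kl hk]; have h0 : exceed 0 x w by case: hk => -[].
  split => //=; rewrite two_sided_max_gt//; apply/hasP; exists k => //.
  by case: hk => -[_ /= ->]; rewrite ?orbT.
rewrite /cond_Pr -[X in _ <= X]mulrAC; apply: ler_wpM2r; first by rewrite invr_ge0 fine_ge0.
have mU : measurable (\big[setU/set0]_(k <- index_iota l m.+1) (E k `|` E' k)).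
  by apply: bigsetU_measurable => j _; exact: measurableU.
by rewrite {1}/Pr eqU -lee_fin fineK ?fin_num_measure.
Qed.

End ConditionalMaximum.

Section LimitSuperior.
Context (R : realType).

Lemma limn_esup_le_eventually (v : nat -> \bar R) (B : \bar R) :
  (\forall n \near \oo, (v n <= B)%E) -> (limn_esup v <= B)%E.
Proof.
move=> [N _ hN]; apply: (@le_trans _ _ (ereal_sup [set v n | n in [set n | (N <= n)%N]])).
  by apply: ereal_inf_lbound; exists [set n | (N <= n)%N] => //; exists N.
by apply: ge_ereal_sup => _ [n /= Nn <-]; exact: hN.
Qed.

Lemma inv_powR_cvg0 (t : R) : 0 < t -> l.-1%:R `^ (- t) @[l --> \oo] --> (0 : R).
Proof.
move=> t0; apply/cvgrPdist_le => e e0.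
have /cvgrPdist_le/(_ e e0)[/= del del0 hdel] := powR_cvg0 t0.
have [J [hJ _]] := first_power_above del^-1 (ltr1n R 2).
exists (2 ^ J).+2 => // l /= Jl.
have l0 : 0 < l.-1%:R :> R by rewrite ltr0n -ltnS prednK ?(leq_trans _ Jl).
rewrite (_ : _ `^ (- t) = (l.-1%:R^-1) `^ t); last by rewrite -powR_inv1 ?ltW// -powRrM mulN1r.
apply: hdel => /=; last by rewrite invr_gt0.
rewrite sub0r normrN gtr0_norm ?invr_gt0// invf_plt ?posrE// (lt_trans hJ)//.
by rewrite -natrX ltr_nat; case: l Jl {l0}.
Qed.

End LimitSuperior.

(** * Ratio of the two tails and conclusion *)

Section RatioBound.
Context (R : realType) (alpha beta : R) (F : probability nat R).
Context d (T : measurableType d) (P : probability T R).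
Variable S : stable_regenerative_sources P alpha F.
Hypothesis alpha02 : 0 < alpha < 2.
Hypothesis hF : inter_renewal F beta.
Variable p : nat.
Hypothesis p_gt1 : (1 < p)%N.
Variable X0 : nat -> {RV P >-> R}.
Hypothesis hX0 : multistable_process S p X0.

Local Notation u := (renewal_seq (ir_pmf F)).

(** The common factor [x ^ (- alpha) * (1 + ln x) ^ p.-1] cancels; here [1 < p] makes the
    second term smaller by one logarithm. *)
Lemma conditional_exceedance_le : exists C x1 : R, [/\ 0 <= C, 1 <= x1 & forall x k, x1 <= x ->
  (Pr P [set w | x < `|X0 0%N w|])^-1 * Pr P [set w | x < `|X0 0%N w| /\ x < `|X0 k w|] <=
  C * (u k ^+ p + (1 + ln x)^-1)].
Proof.
have p0 : (0 < p)%N by exact: ltnW.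
have alpha0 : 0 < alpha by case/andP: alpha02.
have [c [x1 [c0 x11 lower]]] := exceedance_lower alpha0 hF p0 hX0.
have [C C0 upper] := limit_upper alpha02 hF p0 hX0.
exists (C / c), x1; split => //; first by rewrite divr_ge0// ltW.
move=> x k xx1; have x1' : 1 <= x by exact: le_trans xx1.
have x0 : 0 < x by exact: lt_le_trans x1'.
have mk i := measurable_exceedance (X0 i) x.
have mj := measurableI _ _ (mk 0%N) (mk k).
have := lower x xx1; have := upper k x x1'.
rewrite -[P _]fineK ?fin_num_measure// -/(Pr P _) lee_fin => hu.
rewrite -[P _]fineK ?fin_num_measure// -/(Pr P _) lee_fin => hl.
have L0 : 0 < 1 + ln x by rewrite ltr_wpDr ?ln_ge0.
have pm : p.-1 = p.-2.+1 by case: p p_gt1 => [|[]].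
set A := x `^ (- alpha) in hl hu; have A0 : 0 < A by exact: powR_gt0.
set B := Pr P _ in hl *.
have B0 : 0 < B by apply: lt_le_trans hl; rewrite !mulr_gt0// exprn_gt0.
rewrite ler_pdivrMl//; apply: (le_trans hu).
have u0 : 0 <= u k ^+ p by rewrite exprn_ge0// renewal_seq_ge0//; exact: ir_pmf_ge0.
have Z0 : 0 <= C / c * (u k ^+ p + (1 + ln x)^-1).
  by rewrite mulr_ge0 ?divr_ge0 ?addr_ge0 ?invr_ge0// ltW.
apply: le_trans (ler_wpM2r Z0 hl).
rewrite pm exprS; apply: eq_lew.
have c_neq0 : c != 0 by rewrite gt_eqF.
have L_neq0 : 1 + ln x != 0 by rewrite gt_eqF.
move: (1 + ln x) L_neq0 => L L_neq0; move: (u k ^+ p) => v; field.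
by rewrite L_neq0 c_neq0.
Qed.

End RatioBound.

Theorem lemma5p2 (R : realType)
    (alpha beta : R) (p : nat)
    (halpha : 0 < alpha < 2) (hbeta : 0 < beta < 1) (hp : (0 < p)%N)
    (hbetap : p%:R * beta - p%:R + 1 < 0)
    (F : probability nat R) (hF : inter_renewal F beta)
    (d0 : measure_display) (T0 : measurableType d0) (P0 : probability T0 R)
    (S : stable_regenerative_sources P0 alpha F)
    (X0 : nat -> {RV P0 >-> R}) (hX0 : multistable_process S p X0)
    (d : measure_display) (T : measurableType d) (P : probability T R)
    (X : int -> {RV P >-> R}) (hX : two_sided_extension P P0 X X0)
    (a : nat -> R) (r : nat -> nat)
    (ha : forall n, 0 < a n) (hr : forall n, (0 < r n)%N)
    (ha_oo : a @ \oo --> +oo) (hr_oo : r @ \oo --> \oo)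
    (har : (fun n => (r n)%:R : R) =o_\oo (fun n => ln (a n))) :
  forall eta : R, 0 < eta ->
  (forall n l : nat, (1 <= l <= r n)%N ->
     cond_Pr P [set w | a n * eta < two_sided_max X l (r n) w]
               [set w | a n * eta < `|X 0 w|]
     <= 2 / Pr P [set w | a n * eta < `|X 0 w|] *
        \sum_(l <= k < (r n).+1)
           Pr P [set w | a n * eta < `|X 0 w| /\ a n * eta < `|X k%:Z w|])
  /\
  limn_esup (fun n : nat =>
    ((Pr P [set w | a n * eta < `|X 0 w|])^-1 *
      \sum_(l <= k < (r n).+1)
         Pr P [set w | a n * eta < `|X 0 w| /\ a n * eta < `|X k%:Z w|])%:E)
    @[l --> \oo] --> 0%E.
Proof.
move=> eta eta0; have [statX lawX] := hX.
split; first by move=> n l _; apply: cond_max_le => //; exact: mulr_gt0.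
have p1 : (1 < p)%N.
  rewrite ltn_neqAle hp andbT; apply: contraTneq hbetap => <-.
  by rewrite mul1r subrK -leNgt ltW//; case/andP: hbeta.
have lawpair x k : Pr P [set w | x < `|X 0 w| /\ x < `|X k%:Z w|] =
    Pr P0 [set w | x < `|X0 0%N w| /\ x < `|X0 k w|].
  have := lawX [fset 0%N; k]%fset _ (fun=> measurable_norm_gt x).
  rewrite (_ : \bigcap_(i in _) _ = [set w | x < `|X 0 w| /\ x < `|X k%:Z w|]); last first.
    apply/seteqP; split=> w.
      move=> h; split; first by have := h 0%N; rewrite /= !inE eqxx; apply.
      by have := h k; rewrite /= !inE eqxx orbT; apply.
    by move=> [h0 hk] i /=; rewrite !inE => /orP[/eqP ->|/eqP ->].
  rewrite (_ : \bigcap_(i in _) _ = [set w | x < `|X0 0%N w| /\ x < `|X0 k w|]); last first.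
    apply/seteqP; split=> w.
      move=> h; split; first by have := h 0%N; rewrite /= !inE eqxx; apply.
      by have := h k; rewrite /= !inE eqxx orbT; apply.
    by move=> [h0 hk] i /=; rewrite !inE => /orP[/eqP ->|/eqP ->].
  by rewrite /Pr => ->.
have law0 x : Pr P [set w | x < `|X 0 w|] = Pr P0 [set w | x < `|X0 0%N w|].
  have := lawpair x 0%N; rewrite (_ : [set w | _ /\ _] = [set w | x < `|X 0 w|]).
    move=> ->; congr (Pr _ _); by apply/seteqP; split=> w //= -[].
  by apply/seteqP; split=> w //= -[].
have [C [x1 [C0 x11 hC]]] := conditional_exceedance_le halpha hF p1 hX0.
have [D [t [D0 t0 hD]]] := renewal_summable hF hbeta hbetap.
have bound l e : (1 < l)%N -> 0 < e -> \forall n \near \oo,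
    (Pr P [set w | a n * eta < `|X 0 w|])^-1 *
      \sum_(l <= k < (r n).+1)
         Pr P [set w | a n * eta < `|X 0 w| /\ a n * eta < `|X k%:Z w|] <=
    C * D * l.-1%:R `^ (- t) + e.
  move=> l1 e0; pose e' := e / (2 * (C + 1)).
  have e'0 : 0 < e' by rewrite divr_gt0// mulr_gt0// ltr_wpDl.
  (* [a n >= eta ^- 2] gives [ln (a n * eta) >= ln (a n) / 2] *)
  have /cvgryPge/(_ (Num.max (x1 / eta) (Num.max 1 (eta ^- 2)))) large := ha_oo.
  have /eqoP/(_ e' e'0) small := har.
  apply: filterS2 large small => n /=.
  rewrite !ge_max ler_pdivrMr// => /and3P[ax1 a1 aeta] ra.
  set x := a n * eta in ax1 *.
  have la0 : 0 <= ln (a n) by rewrite ln_ge0.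
  rewrite normr_nat ger0_norm// in ra.
  have L0 : ln (a n) / 2 <= 1 + ln x.
    rewrite lnM ?posrE//.
    have : ln (eta ^- 2) <= ln (a n) by rewrite ler_ln ?posrE ?invr_gt0 ?exprn_gt0.
    rewrite lnV ?posrE ?exprn_gt0// lnXn// mulr2n; lra.
  have L1 : 0 < 1 + ln x by rewrite ltr_wpDr// ln_ge0// (le_trans x11).
  rewrite mulr_sumr law0.
  apply: (@le_trans _ _ (\sum_(l <= k < (r n).+1)
      C * (renewal_seq (ir_pmf F) k ^+ p + (1 + ln x)^-1))).
    by apply: ler_sum => k _; rewrite lawpair; exact: hC.
  rewrite -mulr_sumr big_split/= sumr_const_nat mulrDr; apply: lerD.
    by rewrite -mulrA ler_wpM2l// hD.
  apply: (@le_trans _ _ (C * ((r n)%:R / (1 + ln x)))).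
    rewrite ler_wpM2l// -[leLHS]mulr_natl ler_wpM2r ?invr_ge0 ?(ltW L1)// ler_nat.
    by rewrite leq_subLR -add1n leq_add2r (ltnW l1).
  apply: (@le_trans _ _ (C * (2 * e'))).
    rewrite ler_wpM2l// ler_pdivrMr//; apply: (le_trans ra).
    by have := ler_wpM2l (ltW e'0) L0; lra.
  have -> : 2 * e' = e / (C + 1) by rewrite /e'; field; rewrite gt_eqF// ltr_wpDl.
  rewrite mulrA ler_pdivrMr ?ltr_wpDl//; nra.
apply: (@squeeze_cvge _ _ _ _ (cst 0%E) _ (fun l => (C * D * l.-1%:R `^ (- t))%:E)).
- exists 2 => // l /= l1; apply/andP; split.
    apply: limf_esup_ge0 => // n; rewrite lee_fin mulr_ge0 ?invr_ge0 ?fine_ge0//.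
    by apply: sumr_ge0 => k _; exact: fine_ge0.
  apply/lee_addgt0Pr => e e0; apply: limn_esup_le_eventually.
  by have := bound l e l1 e0; apply: filterS => n; rewrite -EFinD lee_fin.
- exact: cvg_cst.
- apply/fine_cvgP; split; first by apply: nearW.
  rewrite -[0](mulr0 (C * D)); apply: cvgMr; exact: inv_powR_cvg0.
Qed.
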